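(* Let $k$ be a field of characteristic zero, $n\ge 3$ and $h\ge 2$. Let $X_4\subset\mathbb{P}^{n+1}$ be an irreducible quartic hypersurface containing an $h$-dimensional linear subspace $\Lambda\subset\mathbb{P}^{n+1}$ (defined over $k$). Assume that $\dim(\Lambda\cap\mathrm{Sing}(X_4))\le h-2$ and that $X_4$ is not a cone over a quartic of smaller dimension. Then $X_4$ is unirational over $k$.
   Context: A variety $X$ of dimension $n$ is unirational over $k$ if there is a dominant rational map $\mathbb{P}^n_k\dashrightarrow X$. *)

(* Defs.v *)
From HB Require Import structures.
From mathcomp Require Import all_boot all_order all_algebra.
From mathcomp Require Import mpoly.

Set Implicit Arguments.
Unset Strict Implicit.
Unset Printing Implicit Defensive.

Import Order.TTheory GRing.Theory.
Local Open Scope ring_scope.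

Definition lin_subst (k : fieldType) (p q : nat) (A : 'M[k]_(p, q))
  : q.-tuple {mpoly k[p]} :=
  [tuple \sum_(i < p) A i j *: 'X_i | j < q].

Definition mpoly_irreducible (k : fieldType) (m : nat) (F : {mpoly k[m]}) :=
  (1 < msize F)%N /\
  forall G H : {mpoly k[m]}, F = G * H -> (msize G <= 1)%N \/ (msize H <= 1)%N.

Definition is_prime_ideal (k : fieldType) (m : nat) (P : {mpoly k[m]} -> Prop) :=
  [/\ P 0,
      forall a b, P a -> P b -> P (a + b),
      forall a b, P b -> P (a * b),
      ~ P 1
    & forall a b, P (a * b) -> P a \/ P b].

(* V(J) subset P^m (homogeneous polys J in m+1 variables) has dimension
   <= d : every chain P_0 < P_1 < ... < P_len of prime ideals containing J
   has len <= d+1 (Krull dimension of the affine cone k[y]/J is <= d+1). *)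
Definition proj_dim_le (k : fieldType) (m : nat) (J : seq {mpoly k[m.+1]}) (d : nat) :=
  forall (c : nat -> {mpoly k[m.+1]} -> Prop) (len : nat),
    (forall i, (i <= len)%N -> is_prime_ideal (c i) /\ (forall g, g \in J -> c i g)) ->
    (forall i, (i < len)%N ->
        (forall x, c i x -> c i.+1 x) /\ (exists x, c i.+1 x /\ ~ c i x)) ->
    (len <= d.+1)%N.

Definition is_cone (k : fieldType) (N : nat) (F : {mpoly k[N.+1]}) :=
  exists A : 'M[k]_(N.+1), A \in unitmx /\
    forall mo, mo \in msupp (F \mPo lin_subst A) -> mo ord_max = 0%N.

(* A subset P^{n+1} = V(F) (F irreducible) is unirational over k: there is a
   dominant rational map P^n --> X, given by homogeneous polynomials G_j of a
   common degree in n+1 variables, not all zero, with F(G) = 0, such that the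
   image is Zariski dense in X: every polynomial vanishing on the image
   (H(G) = 0) vanishes on X, i.e. is divisible by F. *)
Definition unirational_hypersurface (k : fieldType) (n : nat) (F : {mpoly k[n.+2]}) :=
  exists (d : nat) (G : 'I_(n.+2) -> {mpoly k[n.+1]}),
    [/\ forall j, G j \is d.-homog,
        exists j, G j != 0,
        F \mPo [tuple G j | j < n.+2] = 0
      & forall H : {mpoly k[n.+2]},
          H \mPo [tuple G j | j < n.+2] = 0 -> exists Q, H = Q * F].

(* Main.v *)
Require Import Defs.
From HB Require Import structures.
From mathcomp Require Import all_boot all_order all_algebra.
From mathcomp Require Import perm mpoly ring zify.
From Stdlib Require Import Classical.
Set Implicit Arguments.
Unset Strict Implicit.
Unset Printing Implicit Defensive.
Import Order.TTheory GRing.Theory.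
Local Open Scope ring_scope.

(** Polarize [F] into a symmetric 4-linear form and write [pqrs] for its values; on
    [Lambda] it vanishes identically.  For [p] in [Lambda] and [v] with [pppv = ppvv = 0],
    the line through [p] and [v] meets the quartic [X] in a single point away from [p].
    Every [U] in [Lambda] satisfies [pppU = ppUU = 0], so it makes the quadric of such
    directions [v] rational, and this gives an explicit rational map
    from pairs ([p], direction) to [X].  We restrict it to a linear space of such pairs and
    compute its differential; the map is dominant as soon as there is one point of [X]
    satisfying some open conditions, a good point.

    If there is none, consider the cubics [pppy] on [Lambda].  By the hypothesis on the
    singular locus two of them, [f] and [g], are coprime, and the absence of good points forces
    [f / g] to be constant along the kernel of its differential.  This makes the polars of
    [f] and [g] depend on only two linear forms, and finally gives a [u] in [Lambda] with
    [pquy = 0] for all [p], [q] in [Lambda] and all [y].  The absence of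
    good points now gives [puyy = 0], so that [F] is linear in the direction [u];
    as [X] is not a cone, projecting from [u] shows that [X] is rational. *)

(** * Unique factorization *)

(** A point p of Lambda has h parameters and its quadric of directions has dimension n - 2, so h >=
    2 is what leaves room for dominance. As [k] need not be algebraically closed, dominance is
    certified by the differential at one rational point x of X. The family of pairs is cut down to a
    linear one in which every tangent vector of X at x lifts to a motion of the pair that preserves
    pppx = ppxx = 0 to first order. Finding the lift is a triangular linear system in two unknowns;
    its diagonal entries, multiples of p p u1 x and p u2 x x, give two of the open conditions of a
    good point.

    These conditions may fail identically. The failure is exploited through v = g(p) y - f(p) c,
    where f = pppy and g = pppc: it is the combination of y and c with pppv = 0. First, pwwv = 0
    whenever ppwv = 0 and ppav is nonzero for some a, which yields a differential equation for f / g
    along lines. Secondly, once u is found, puvv = 0; this is an identity between f, g and the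
    linear forms puyy, puyc, pucc, in which coprimality and degrees force pucc = 0. *)

Definition divides (R : idomainType) (q a : R) := exists c, a = c * q.

Definition prime_elt (R : idomainType) (q : R) :=
  [/\ q != 0, q \isn't a GRing.unit
    & forall a b, divides q (a * b) -> divides q a \/ divides q b].

Definition factors (R : idomainType) (x : R) (s : seq R) :=
  (forall q, q \in s -> prime_elt q) /\
  exists2 u, u \is a GRing.unit & x = u * \prod_(q <- s) q.

Definition is_ufd (R : idomainType) :=
  forall x : R, x != 0 -> exists s, factors x s.

Definition coprime_elt (R : idomainType) (f g : R) :=
  forall q, prime_elt q -> divides q f -> ~ divides q g.

Section Divisibility.
Variable R : idomainType.
Implicit Types (a b c d q r u x y f g h : R) (s : seq R).

Lemma dividesD q a b : divides q a -> divides q b -> divides q (a + b).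
Proof. by case=> [c ->] [d ->]; exists (c + d); rewrite mulrDl. Qed.

Lemma dividesB q a b : divides q a -> divides q b -> divides q (a - b).
Proof. by case=> [c ->] [d ->]; exists (c - d); rewrite mulrBl. Qed.

Lemma divides_mull q a b : divides q b -> divides q (a * b).
Proof. by case=> [c ->]; exists (a * c); rewrite mulrA. Qed.

Lemma divides_mulr q a b : divides q a -> divides q (a * b).
Proof. by move=> h; rewrite mulrC; apply: divides_mull. Qed.

Lemma dividesxx q : divides q q.
Proof. by exists 1; rewrite mul1r. Qed.

Lemma divides0 q : divides q 0.
Proof. by exists 0; rewrite mul0r. Qed.

Lemma prime_ndiv_unit q u : prime_elt q -> u \is a GRing.unit -> ~ divides q u.
Proof.
by case=> _ /negP qU _ uU [c e]; apply: qU; move: uU; rewrite e unitrM => /andP[].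
Qed.

Lemma prime_divides_prod q s :
  prime_elt q -> divides q (\prod_(r <- s) r) -> exists2 r, r \in s & divides q r.
Proof.
move=> qp; elim: s => [|r s ih]; rewrite ?big_nil ?big_cons.
  by move=> h; case: (prime_ndiv_unit qp (unitr1 R)).
case: (qp) => _ _ h /h[h1|/ih[r' r's h1]]; first by exists r; rewrite ?mem_head.
by exists r'; rewrite // inE r's orbT.
Qed.

Lemma divides_prod s r : r \in s -> divides r (\prod_(q <- s) q).
Proof.
by move=> rs; rewrite (big_rem r) //=; apply/divides_mulr/dividesxx.
Qed.

Lemma prime_divides_factors q x s :
  prime_elt q -> factors x s -> divides q x -> exists2 r, r \in s & divides q r.
Proof.
move=> qp [sp [u uU ->]]; case: (qp) => _ _ h /h[h1|]; last exact: prime_divides_prod.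
by case: (prime_ndiv_unit qp uU).
Qed.

Lemma prime_divides_prime q r : prime_elt q -> prime_elt r -> divides q r ->
  exists2 u, u \is a GRing.unit & r = u * q.
Proof.
move=> [q0 qU _] [r0 _ rp] [c e].
have [|[d ed]|[d ed]] := rp c q; first by rewrite -e; apply: dividesxx.
  exfalso; move/negP: qU; apply; apply/unitrPr; exists d.
  have : r * (1 - d * q) = 0 by transitivity (r - d * r * q); [ring|rewrite -ed -e subrr].
  by move/eqP; rewrite mulf_eq0 (negPf r0) subr_eq0 /= => /eqP ->; rewrite mulrC.
exists c => //; apply/unitrPr; exists d.
have : q * (1 - d * c) = 0 by transitivity (q - d * (c * q)); [ring|rewrite -e -ed subrr].
by move/eqP; rewrite mulf_eq0 (negPf q0) subr_eq0 /= => /eqP ->; rewrite mulrC.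
Qed.

Lemma factors_nil u : u \is a GRing.unit -> factors u [::].
Proof. by move=> uU; split=> //; exists u; rewrite ?big_nil ?mulr1. Qed.

Lemma factors_mul x y s t : factors x s -> factors y t -> factors (x * y) (s ++ t).
Proof.
move=> [sp [u uU ->]] [tp [v vU ->]]; split.
  by move=> q; rewrite mem_cat => /orP[/sp|/tp].
by exists (u * v); rewrite ?unitrM ?uU // big_cat /=; ring.
Qed.

(** Each prime of [c] divides [g] or [h]; cancelling the primes one at a time distributes [c] over
    the two factors. It serves for Euclid's lemma, for contents and for clearing denominators. *)
Lemma factors_split c s f g h : factors c s -> c * f = g * h ->
  exists c1 c2 g' h', [/\ c = c1 * c2, g = c1 * g', h = c2 * h' & f = g' * h'].
Proof.
move=> [sp [u uU]]; elim: s c f g h sp => [|q s ih] c f g h sp ->.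
  rewrite big_nil mulr1 => e; exists u, 1, (u^-1 * g), h.
  by rewrite mulr1 mul1r mulVKr // -mulrA -e mulKr.
rewrite big_cons => e; have [q0 _ qp] : prime_elt q by apply: sp; rewrite mem_head.
have sp' r : r \in s -> prime_elt r by move=> rs; apply: sp; rewrite inE rs orbT.
have [|[g' eg]|[h' eh]] := qp g h.
- by exists (u * \prod_(j <- s) j * f); rewrite -e; ring.
- have [|c1 [c2 [g1 [h1 [e1 e2 e3 e4]]]]] := ih (u * \prod_(r <- s) r) f g' h sp' erefl.
    by apply: (mulfI q0); transitivity (g * h); [rewrite -e|rewrite eg]; ring.
  by exists (q * c1), c2, g1, h1; split=> //; [rewrite mulrCA e1|rewrite eg e2]; ring.
- have [|c1 [c2 [g1 [h1 [e1 e2 e3 e4]]]]] := ih (u * \prod_(r <- s) r) f g h' sp' erefl.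
    by apply: (mulfI q0); transitivity (g * h); [rewrite -e|rewrite eh]; ring.
  by exists c1, (q * c2), g1, h1; split=> //; [rewrite mulrCA e1|rewrite eh e3]; ring.
Qed.

(** Distributing [f] over [g * h] gives a part [c1] dividing both [f] and [g], a unit by
    coprimality, so all of [f] goes into [h]. *)
Lemma coprime_Gauss f g h :
  is_ufd R -> f != 0 -> coprime_elt f g -> divides f (g * h) -> divides f h.
Proof.
move=> ufd f0 cop [c e]; have [s fs] := ufd f f0.
have e' : f * c = g * h by rewrite e mulrC.
have [c1 [c2 [g' [h' [e1 e2 e3 e4]]]]] := factors_split fs e'.
have c10 : c1 != 0 by apply: contraNneq f0 => z; rewrite e1 z mul0r.
have [t ft] := ufd c1 c10.
suff c1U : c1 \is a GRing.unit.
  by exists (h' * c1^-1); rewrite e1 e3 mulrA mulrVK // mulrC.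
case: ft => tp [u uU ec]; case: t tp ec => [|q t] tp ec; first by rewrite ec big_nil mulr1.
have qp : prime_elt q by apply: tp; rewrite mem_head.
have qc : divides q c1 by rewrite ec big_cons; exists (u * \prod_(j <- t) j); ring.
by case: (cop q qp); [rewrite e1|rewrite e2]; apply: divides_mulr.
Qed.

End Divisibility.

Section PolyFactorial.
Variable R : idomainType.
Implicit Types (a b f g h : {poly R}) (q c : R).

Lemma divides_polyCP q a : divides q%:P a <-> forall i, divides q a`_i.
Proof.
split=> [[c ->] i|]; first by rewrite coefMC; exists c`_i.
elim/poly_ind: a => [|p c ih] h; first exact: divides0.
apply: dividesD.
  apply: divides_mulr; apply: ih => i; have := h i.+1.
  by rewrite coefD coefMX coefC addr0.
by have := h 0%N; rewrite coefD coefMX coefC add0r => -[d ->]; exists d%:P; rewrite polyCM.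
Qed.

Lemma polyMXaddC_ex a : exists a' c, a = a' * 'X + c%:P.
Proof.
by elim/poly_ind: a => [|p c _]; [exists 0, 0; rewrite mul0r addr0 | exists p, c].
Qed.

(** If [q] divides a product, it divides the constant term of one factor. Dropping that term and
    dividing by 'X lowers the total size, the induction measure. *)
Lemma prime_polyC q : prime_elt q -> prime_elt q%:P.
Proof.
move=> [q0 qU qp]; split; rewrite ?polyC_eq0 //.
  by rewrite poly_unitE size_polyC q0 coefC eqxx.
move=> a b; move: {2}(size a + size b)%N (leqnn (size a + size b)) => m.
elim: m a b => [|m ih] a b.
  rewrite leqn0 addn_eq0 size_poly_eq0 => /andP[/eqP-> _] _.
  by left; apply: divides0.
have key a1 b1 a' c : a1 = a' * 'X + c%:P -> a1 != 0 -> divides q c ->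
    (size a1 + size b1 <= m.+1)%N -> divides q%:P (a1 * b1) ->
    divides q%:P a1 \/ divides q%:P b1.
  move=> ea a10 qc hs hd.
  have hda : divides q%:P c%:P by case: qc => d ->; exists d%:P; rewrite polyCM.
  have [||h|h] := ih a' b1.
  - move: hs a10; rewrite ea size_MXaddC; case: ifP => [/andP[/eqP-> /eqP->]|_ hs _].
      by rewrite mul0r addr0 eqxx.
    by rewrite addSn ltnS in hs.
  - have /divides_polyCP hX : divides q%:P (a' * b1 * 'X).
      have -> : a' * b1 * 'X = a1 * b1 - c%:P * b1 by rewrite ea; ring.
      by apply: dividesB hd _; apply: divides_mulr.
    by apply/divides_polyCP => i; have := hX i.+1; rewrite coefMX.
  - by left; rewrite ea; apply: dividesD => //; apply: divides_mulr.
  - by right.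
move=> hs hd.
have [->|a0] := eqVneq a 0; first by left; apply: divides0.
have [->|b0] := eqVneq b 0; first by right; apply: divides0.
have [a' [c ea]] := polyMXaddC_ex a; have [b' [d eb]] := polyMXaddC_ex b.
have : divides q (c * d).
  have /divides_polyCP/(_ 0%N) := hd.
  by rewrite coef0M ea eb !coefD !coefMX !coefC /= !add0r.
move=> /qp[qc|qd]; first exact: (key a b a' c).
case: (key b a b' d eb b0 qd); rewrite 1?addnC 1?mulrC //; by [right|left].
Qed.

Hypothesis ufd : is_ufd R.

Lemma factors_polyC c s : factors c s -> factors c%:P [seq q%:P | q <- s].
Proof.
move=> [sp [u uU ->]]; split; first by move=> _ /mapP[q /sp qp ->]; apply: prime_polyC.
exists u%:P; first by rewrite rmorph_unit.
by rewrite polyCM big_map rmorph_prod.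
Qed.

Definition primitive_poly f := forall q, prime_elt q -> ~ divides q%:P f.

(** A prime constant dividing [f] also divides its leading coefficient, so the number of prime
    factors of the latter bounds how many can be pulled out. *)
Lemma primitive_partP f : f != 0 ->
  exists c f', [/\ f = c%:P * f', c != 0 & primitive_poly f'].
Proof.
move=> f0; have [|s fs] := ufd (x := lead_coef f); first by rewrite lead_coef_eq0.
move: {2}(size s) (erefl (size s)) => m.
elim: m s f f0 fs => [|m ih] s f f0 fs hs;
    (have [fp|nfp] := classic (primitive_poly f); first by exists 1, f; rewrite mul1r oner_eq0);
    (have [q [qp [g ef]]] : exists q, prime_elt q /\ divides q%:P f
      by apply: NNPP => h; apply: nfp => q qp qf; apply: h; exists q);
    (have [|r rs qr] := prime_divides_factors qp fs;
      first by rewrite ef lead_coefM lead_coefC; apply/divides_mull/dividesxx).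
  by move/size0nil: hs rs => ->.
have [rsp [u uU el]] := fs; have [v vU er] := prime_divides_prime qp (rsp r rs) qr.
have [q0 _ _] := qp; have g0 : g != 0 by apply: contraNneq f0; rewrite ef => ->; rewrite mul0r.
have [||c [f' [eg c0 fp']]] := ih (rem r s) g g0.
- split; first by move=> z /mem_rem/rsp.
  exists (u * v); rewrite ?unitrM ?uU //; apply: (mulIf q0).
  by rewrite -[q in LHS]lead_coefC -lead_coefM -ef el (big_rem r) //= er; ring.
- by rewrite size_rem // hs.
by exists (c * q), f'; rewrite mulf_neq0 // ef eg polyCM; split=> //; ring.
Qed.

(** Gauss's lemma in the form that removes denominators: the part of [c] absorbed by [f] is a
    constant dividing a primitive polynomial, hence a unit. *)
Lemma primitive_cancel c f a b : c != 0 -> primitive_poly f ->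
  c%:P * a = f * b -> divides f a.
Proof.
move=> c0 fp e; have [s /factors_polyC fs] := ufd c0.
have [c1 [c2 [g' [h' [e1 e2 e3 e4]]]]] := factors_split fs e.
have c10 : c1 != 0 by apply: contraNneq c0 => z; move: e1; rewrite z mul0r => /eqP;
  rewrite polyC_eq0.
have sz : size c1 = 1%N.
  have c20 : c2 != 0 by apply: contraNneq c0 => z; move: e1; rewrite z mulr0 => /eqP;
    rewrite polyC_eq0.
  have : size (c1 * c2) = 1%N by rewrite -e1 size_polyC c0.
  by rewrite size_mul // => h; move: c10 c20 h; rewrite -!size_poly_gt0; case: (size c1) =>
    [|[|?]] //; case: (size c2) => [|[|?]] //; rewrite ?addnS.
have /size_poly1P[d d0 ed] : size c1 == 1%N by rewrite sz.
have [t [tp [u uU et]]] := ufd d0.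
suff dU : d \is a GRing.unit.
  exists (h' * (d^-1)%:P); rewrite e4 e2 ed.
  have : d%:P * (d^-1)%:P = 1 :> {poly R} by rewrite -polyCM mulrV.
  by move=> h; transitivity (d%:P * (d^-1)%:P * (g' * h')); [rewrite h mul1r|ring].
case: t tp et => [|q t] tp et; first by rewrite et big_nil mulr1.
exfalso; have qp : prime_elt q by apply: tp; rewrite mem_head.
apply: (fp q qp); rewrite e2 ed et big_cons; apply: divides_mulr.
by exists (u * \prod_(j <- t) j)%:P; rewrite -polyCM; congr (_%:P); ring.
Qed.

Lemma size_polyM_gt1 g h : g * h != 0 -> (size (g * h)%R <= size g)%N -> size h = 1%N.
Proof.
rewrite mulf_eq0 negb_or -!size_poly_gt0 => /andP[g0 h0].
by rewrite size_mul -?size_poly_gt0 //; lia.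
Qed.

(** Gauss's theorem by induction on the degree. The fraction field is never formed: divisibility
    over it is the pseudo-divisibility [dvdp], and [primitive_cancel] brings it back to [R]. *)
Lemma ufd_poly : is_ufd {poly R}.
Proof.
move=> f; move: {2}(size f) (leqnn (size f)) => n.
elim: n f => [|n ih] f hs f0; first by move: hs; rewrite leqNgt size_poly_gt0 f0.
have [c [f' [ef c0 fp]]] := primitive_partP f0.
have f'0 : f' != 0 by apply: contraNneq f0; rewrite ef => ->; rewrite mulr0.
have [s /factors_polyC fs] := ufd c0.
suff [t ft] : exists t, factors f' t by exists ([seq q%:P | q <- s] ++ t); rewrite ef;
  apply: factors_mul.
have hs' : (size f' <= n.+1)%N by rewrite (leq_trans _ hs) // ef size_Cmul.
have [/size1_polyC e1|s1] := leqP (size f') 1.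
  have : f'`_0 != 0 by rewrite -polyC_eq0 -e1.
  by move/ufd => [t /factors_polyC ft]; exists [seq q%:P | q <- t]; rewrite e1.
(* A proper factorization of [f'] over the fraction field, with its denominators collected in
   [d]. *)
have [[d [g [h [d0 egh sg sh]]]]|irr] := classic (exists d g h,
    [/\ d != 0, d%:P * f' = g * h, (size g < size f')%N & (size h < size f')%N]).
  have [t /factors_polyC ft] := ufd d0.
  have [c1 [c2 [g' [h' [e1 e2 e3 e4]]]]] := factors_split ft egh.
  have g'0 : g' != 0 by apply: contraNneq f'0; rewrite e4 => ->; rewrite mul0r.
  have h'0 : h' != 0 by apply: contraNneq f'0; rewrite e4 => ->; rewrite mulr0.
  have c120 : c1 * c2 != 0 by rewrite -e1 polyC_eq0.
  move: (c120); rewrite mulf_eq0 negb_or => /andP[c10 c20].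
  have [|t1 ft1] := ih g' _ g'0.
    rewrite -ltnS (leq_trans _ hs') // (leq_ltn_trans _ sg) // e2 size_mul //.
    by rewrite -[size c1]prednK ?size_poly_gt0 // addSn /= leq_addl.
  have [|t2 ft2] := ih h' _ h'0.
    rewrite -ltnS (leq_trans _ hs') // (leq_ltn_trans _ sh) // e3 size_mul //.
    by rewrite -[size c2]prednK ?size_poly_gt0 // addSn /= leq_addl.
  by exists (t1 ++ t2); rewrite e4; apply: factors_mul.
exists [:: f']; split; last by exists 1; rewrite ?unitr1 // big_seq1 mul1r.
move=> z; rewrite inE => /eqP->; split=> //.
  by rewrite poly_unitE; case: eqP s1 => // ->.
move=> a b [c' eab].
have irrS d g h : d != 0 -> d%:P * f' = g * h -> size g = 1%N \/ size h = 1%N.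
  move=> d0 e; have sz : size (g * h) = size f' by rewrite -e size_Cmul.
  have gh0 : g * h != 0 by rewrite -size_poly_gt0 sz size_poly_gt0.
  have [sg|sg] := ltnP (size g) (size f'); last by right; apply: (@size_polyM_gt1 g); rewrite ?sz.
  have [sh|sh] := ltnP (size h) (size f'); first by case: irr; exists d, g, h.
  by left; apply: (@size_polyM_gt1 h); rewrite mulrC ?sz.
have gcdc x y : f' * y = x -> dvdp f' x.
  by move=> <-; apply: Pdiv.Idomain.dvdp_mulr.
(* By irreducibility [d] is associate to [f'] over the fraction field, so that [f'] divides [a], or
   it is constant, so that [f'] is coprime to [a] and divides [b]. *)
pose d := gcdp f' a.
have dvdP x : dvdp f' x -> divides f' x.
  by case/Pdiv.WeakIdomain.dvdpP => -[k q] /= k0; rewrite -mul_polyC => e;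
    apply: (primitive_cancel k0 fp (b := q)); rewrite e mulrC.
have : dvdp d f' by apply: Pdiv.Idomain.dvdp_gcdl.
case/Pdiv.WeakIdomain.dvdpP => -[k q] /= k0; rewrite -mul_polyC => ek.
have [sq|sd] := irrS k q d k0 ek.
  left; apply: dvdP; apply: Pdiv.Idomain.dvdp_trans (Pdiv.Idomain.dvdp_gcdr f' a).
  have /size_poly1P[e e0 eq] : size q == 1%N by rewrite sq.
  apply/Pdiv.WeakIdomain.dvdpP; exists (e, k%:P) => //=.
  by rewrite -mul_polyC -eq -ek.
have cop : coprimep f' a by rewrite Pdiv.Idomain.coprimep_def; apply/eqP.
right; apply: dvdP; rewrite -(Pdiv.Idomain.Gauss_dvdpr _ cop).
by rewrite eab; apply: Pdiv.Idomain.dvdp_mull (Pdiv.Idomain.dvdpp _).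
Qed.
End PolyFactorial.

(** * Multivariate polynomials over a field *)

Lemma mpoly_rmorph_ext (R S : comNzRingType) (n : nat)
    (phi psi : {rmorphism {mpoly R[n]} -> S}) :
  (forall c, phi c%:MP = psi c%:MP) -> (forall i, phi 'X_i = psi 'X_i) ->
  phi =1 psi.
Proof.
move=> hC hX p; rewrite (mpolyE p) !rmorph_sum /=; apply: eq_bigr => m _.
rewrite -mul_mpolyC !rmorphM hC; congr (_ * _).
by rewrite mpolyXE_id !rmorph_prod /=; apply: eq_bigr => i _; rewrite !rmorphXn /= hX.
Qed.

Lemma mpoly_gen_ind (R : comNzRingType) (n : nat) (P : {mpoly R[n]} -> Prop) :
  (forall c, P c%:MP) -> (forall i, P 'X_i) ->
  (forall p q, P p -> P q -> P (p + q)) -> (forall p q, P p -> P q -> P (p * q)) ->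
  forall p, P p.
Proof.
move=> hC hX hD hM p; rewrite (mpolyE p).
apply: (big_ind P) => [||m _]; [by rewrite -mpolyC0|exact: (hD)|].
rewrite -mul_mpolyC; apply: (hM) => //; rewrite mpolyXE_id.
apply: (big_ind P) => [||i _]; [by rewrite -mpolyC1|exact: (hM)|].
by elim: (m i) => [|e ih]; rewrite ?expr0 -?mpolyC1 // exprS; apply: hM.
Qed.

Section SplitVariable.
Variables (k : fieldType) (n : nat) (j : 'I_n.+1).

Definition split_var (i : 'I_n.+1) : {poly {mpoly k[n]}} :=
  if unlift j i is Some i' then ('X_i')%:P else 'X.

(** The distinguished variable [j] is arbitrary: elimination must single out a variable in which the
    derivative of F is nonzero, and chains of primes one whose hyperplane does not contain a given
    hypersurface. *)
Definition mpoly_split : {mpoly k[n.+1]} -> {poly {mpoly k[n]}} :=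
  mmap (polyC \o @mpolyC n k) split_var.

Definition mpoly_lift : {mpoly k[n]} -> {mpoly k[n.+1]} :=
  mmap (@mpolyC n.+1 k) (fun i => 'X_(lift j i)).

Definition mpoly_join (p : {poly {mpoly k[n]}}) : {mpoly k[n.+1]} :=
  (map_poly mpoly_lift p).['X_j].

HB.instance Definition _ := GRing.RMorphism.on mpoly_split.
HB.instance Definition _ := GRing.RMorphism.on mpoly_lift.

Fact mpoly_join_is_zmod_morphism : zmod_morphism mpoly_join.
Proof. by move=> p q; rewrite /mpoly_join rmorphB hornerD hornerN. Qed.
Fact mpoly_join_is_monoid_morphism : monoid_morphism mpoly_join.
Proof.
by split; [rewrite /mpoly_join rmorph1 hornerC|move=> p q; rewrite /mpoly_join rmorphM hornerM].
Qed.
HB.instance Definition _ := GRing.isZmodMorphism.Build _ _ mpoly_join mpoly_join_is_zmod_morphism.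
HB.instance Definition _ :=
  GRing.isMonoidMorphism.Build _ _ mpoly_join mpoly_join_is_monoid_morphism.

Lemma mpoly_joinC p : mpoly_join p%:P = mpoly_lift p.
Proof. by rewrite /mpoly_join map_polyC hornerC. Qed.

Lemma mpoly_joinX : mpoly_join 'X = 'X_j.
Proof. by rewrite /mpoly_join map_polyX hornerX. Qed.

Lemma mpoly_liftC c : mpoly_lift c%:MP = c%:MP.
Proof. by rewrite /mpoly_lift mmapC. Qed.

Lemma mpoly_liftX i : mpoly_lift 'X_i = 'X_(lift j i).
Proof. by rewrite /mpoly_lift mmapX mmap1U. Qed.

Lemma mpoly_splitC c : mpoly_split c%:MP = c%:MP%:P.
Proof. by rewrite /mpoly_split mmapC. Qed.

Lemma mpoly_splitX i : mpoly_split 'X_i = split_var i.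
Proof. by rewrite /mpoly_split mmapX mmap1U. Qed.

Lemma mpoly_split_lift p : mpoly_split (mpoly_lift p) = p%:P.
Proof.
apply: (@mpoly_rmorph_ext k _ n (mpoly_split \o mpoly_lift) polyC) => [c|i] /=.
  by rewrite mpoly_liftC mpoly_splitC.
by rewrite mpoly_liftX mpoly_splitX /split_var liftK.
Qed.

Lemma mpoly_splitK : cancel mpoly_split mpoly_join.
Proof.
apply: (@mpoly_rmorph_ext k _ _ (mpoly_join \o mpoly_split) idfun) => [c|i] /=.
  by rewrite mpoly_splitC mpoly_joinC mpoly_liftC.
rewrite mpoly_splitX /split_var; case: unliftP => [i' ->|->].
  by rewrite mpoly_joinC mpoly_liftX.
exact: mpoly_joinX.
Qed.

Lemma mpoly_joinK : cancel mpoly_join mpoly_split.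
Proof.
elim/poly_ind => [|p c ih]; first by rewrite !rmorph0.
rewrite !rmorphD !rmorphM /= ih mpoly_joinX mpoly_joinC mpoly_split_lift.
by rewrite mpoly_splitX /split_var unlift_none.
Qed.

Definition insert_at (T : Type) (c : T) (v : 'I_n -> T) (i : 'I_n.+1) : T :=
  if unlift j i is Some i' then v i' else c.

Lemma mpoly_split_eval (c : k) (v : 'I_n -> k) p :
  (map_poly (meval v) (mpoly_split p)).[c] = p.@[insert_at c v].
Proof.
have ext := @mpoly_rmorph_ext k k _
  (horner_eval c \o (map_poly (meval v) \o mpoly_split)) (meval (insert_at c v)).
apply: ext => [a|i] /=.
  by rewrite mpoly_splitC map_polyC /= /horner_eval hornerC !mevalC.
rewrite mpoly_splitX /horner_eval mevalXU /split_var /insert_at.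
by case: unliftP => [i' _|_]; rewrite ?map_polyC ?map_polyX ?hornerC ?hornerX //= mevalXU.
Qed.

End SplitVariable.

Section Transfer.
Variables (R S : idomainType) (phi : {rmorphism R -> S}) (psi : {rmorphism S -> R}).
Hypotheses (phiK : cancel phi psi) (psiK : cancel psi phi).

Lemma prime_elt_iso q : prime_elt q -> prime_elt (psi q).
Proof.
move=> [q0 qU qp]; split.
- by apply: contraNneq q0 => /(congr1 phi); rewrite psiK rmorph0 => ->.
- by apply: contraNN qU => /(rmorph_unit phi); rewrite /= psiK.
move=> a b [c e]; have [|[d ed]|[d ed]] := qp (phi a) (phi b).
- by exists (phi c); rewrite -rmorphM e rmorphM /= psiK.
- by left; exists (psi d); rewrite -rmorphM -ed phiK.
- by right; exists (psi d); rewrite -rmorphM -ed phiK.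
Qed.

Lemma ufd_iso : is_ufd S -> is_ufd R.
Proof.
move=> ufd x x0; have [|s [sp [u uU e]]] := ufd (phi x).
  by apply: contraNneq x0 => /(congr1 psi); rewrite phiK rmorph0 => ->.
exists [seq psi q | q <- s]; split.
  by move=> _ /mapP[q /sp qp ->]; apply: prime_elt_iso.
exists (psi u); first exact: rmorph_unit.
by rewrite big_map -rmorph_prod -rmorphM -e phiK.
Qed.
End Transfer.

Section FieldPoly.
Variables (k : fieldType).

Lemma mpoly_unitC n (c : k) : c != 0 -> c%:MP \is a @GRing.unit {mpoly k[n]}.
Proof.
by move=> c0; apply/unitrPr; exists (c^-1)%:MP; rewrite -mpolyCM mulfV.
Qed.

Lemma mpoly_unitP n (p : {mpoly k[n]}) : p != 0 -> (msize p <= 1)%N -> p \is a GRing.unit.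
Proof.
move=> p0 /msize1_polyC e; rewrite e; apply: mpoly_unitC.
by apply: contraNneq p0 => z; rewrite e z mpolyC0.
Qed.

Lemma msize_unit n (p : {mpoly k[n]}) : p \is a GRing.unit -> msize p = 1%N.
Proof.
move=> /unitrPr[q e]; have pq0 : p * q != 0 by rewrite e oner_eq0.
move: (pq0); rewrite mulf_eq0 negb_or => /andP[p0 q0].
have := msizeM p0 q0; rewrite e msize1.
move: p0 q0; rewrite -!msize_poly_eq0; move: (mmeasure _ p) (mmeasure _ q) => a b; lia.
Qed.

Lemma ufd_mpoly n : is_ufd {mpoly k[n]}.
Proof.
elim: n => [|n ih].
  move=> p p0; exists [::]; apply: factors_nil.
  by apply: mpoly_unitP => //; rewrite (nvar0_mpolyC p) msizeC; case: (_ != 0).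
exact: (ufd_iso (@mpoly_splitK k n ord0) (@mpoly_joinK k n ord0) (ufd_poly ih)).
Qed.

Lemma prime_elt_unit (R : idomainType) (u q : R) :
  u \is a GRing.unit -> prime_elt q -> prime_elt (u * q).
Proof.
move=> uU [q0 qU qp]; have dvd a : divides q a -> divides (u * q) a.
  by case=> c ->; exists (c * u^-1); rewrite mulrA divrK.
split; first by rewrite mulf_neq0 //; apply: contraTneq uU => ->; rewrite unitr0.
  by rewrite unitrMr.
move=> a b [c e]; have [|h|h] := qp a b; first by exists (c * u); rewrite e mulrA.
  by left; apply: dvd.
by right; apply: dvd.
Qed.

Lemma mpoly_irreducible_prime n (F : {mpoly k[n]}) : mpoly_irreducible F -> prime_elt F.
Proof.
move=> [s1 irr]; have F0 : F != 0 by rewrite -msize_poly_eq0; case: (msize F) s1.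
have [[|q s] [sp [u uU e]]] := ufd_mpoly F0.
  by move: s1; rewrite e big_nil mulr1 (msize_unit uU).
have qp : prime_elt q by apply: sp; rewrite mem_head.
have [q0 /negP qU _] := qp; move: F0 e; rewrite big_cons mulrCA => F0 e.
have uv0 : u * \prod_(j <- s) j != 0 by apply: contraNneq F0; rewrite e => ->; rewrite mulr0.
case: (irr _ _ e) => [/(mpoly_unitP q0)//|/(mpoly_unitP uv0) uv].
by rewrite e mulrC; apply: prime_elt_unit.
Qed.

Hypothesis k0 : [pchar k] =i pred0.

Lemma char0_natf_inj (i j : nat) : i%:R = j%:R :> k -> i = j.
Proof.
move: i j; suff h i j : (i <= j)%N -> i%:R = j%:R :> k -> i = j.
  by move=> i j e; case/orP: (leq_total i j) => l; [|symmetry]; apply: h.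
move=> l /eqP; rewrite eq_sym -subr_eq0 -natrB // (pcharf0P _).1 // subn_eq0 => l'.
by apply/eqP; rewrite eqn_leq l.
Qed.

Lemma char0_natf_neq0 (i : nat) : (0 < i)%N -> i%:R != 0 :> k.
Proof. by move=> i0; rewrite (pcharf0P _).1 // -lt0n. Qed.

Lemma poly_eval_eq0 (p : {poly k}) : (forall c, p.[c] = 0) -> p = 0.
Proof.
move=> h; apply: (@roots_geq_poly_eq0 _ p [seq i%:R | i <- iota 0 (size p)]).
- by apply/allP => x _; rewrite rootE h.
- by rewrite map_inj_uniq ?iota_uniq //; apply: char0_natf_inj.
by rewrite size_map size_iota.
Qed.

Lemma mpoly_eval_eq0 n (p : {mpoly k[n]}) : (forall v, p.@[v] = 0) -> p = 0.
Proof.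
elim: n p => [|n ih] p h.
  by have := h (fun=> 0); rewrite (nvar0_mpolyC p) mevalC => ->; rewrite mpolyC0.
apply: (can_inj (@mpoly_splitK k n ord0)); rewrite rmorph0.
apply/polyP => i; rewrite coef0; apply: ih => v.
rewrite -coef_map /= (_ : map_poly _ _ = 0) ?coef0 //.
by apply: poly_eval_eq0 => c; rewrite mpoly_split_eval h.
Qed.

Lemma poly_neq0_eval (p : {poly k}) : p != 0 -> exists c, p.[c] != 0.
Proof.
move=> /eqP p0; apply: NNPP => h; apply: p0; apply: poly_eval_eq0 => c.
by apply/eqP/negPn/negP => hc; apply: h; exists c.
Qed.

Lemma mpoly_neq0_eval n (p : {mpoly k[n]}) : p != 0 -> exists v, p.@[v] != 0.
Proof.
move=> /eqP p0; apply: NNPP => h; apply: p0; apply: mpoly_eval_eq0 => c.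
by apply/eqP/negPn/negP => hc; apply: h; exists c.
Qed.

End FieldPoly.

(** * The Jacobian criterion for dominance *)

(** A prime of positive degree stays irreducible over the fraction field, so its gcd with [h] is
    constant there; [c] is the cleared denominator. *)
Lemma prime_poly_Bezout (R : idomainType) (f h : {poly R}) :
  prime_elt f -> (1 < size f)%N -> ~ divides f h ->
  exists u v c, c != 0 /\ u * f + v * h = c%:P.
Proof.
move=> [f0 fU fpr] sf fh.
have sizeC (c : R) : c != 0 -> ~ divides f c%:P.
  move=> c0 [g e]; have g0 : g != 0 by apply: contraNneq c0 => g0; move/eqP: e;
    rewrite g0 mul0r polyC_eq0.
  have := size_polyC c; rewrite e size_mul // c0.
  by move: g0 sf; rewrite -size_poly_gt0; move: (size _) (size _) => a b /=; lia.
have pf (p : {poly R}) : dvdp f p -> divides f p.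
  case/Pdiv.WeakIdomain.dvdpP => -[c q] /= c0; rewrite -mul_polyC => e.
  by case: (fpr c%:P p) => [|/(sizeC c c0)|//]; exists q.
have cop : coprimep f h.
  rewrite Pdiv.Idomain.coprimep_def.
  case/Pdiv.WeakIdomain.dvdpP: (Pdiv.Idomain.dvdp_gcdl f h) => -[c q] /= c0.
  rewrite -mul_polyC => e.
  case: (fpr q (gcdp f h)) => [|[g eg]|fg]; first by exists c%:P; rewrite e.
    have : c%:P = g * gcdp f h by apply: (mulIf f0); rewrite e eg; ring.
    move=> ec; have : g * gcdp f h != 0 by rewrite -ec polyC_eq0.
    rewrite mulf_eq0 negb_or => /andP[g0 d0].
    have := size_polyC c; rewrite ec size_mul // c0; move: g0 d0; rewrite -!size_poly_gt0.
    by move: (size g) (size (gcdp f h)) => a b /=; lia.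
  case: fh; apply: pf; apply: Pdiv.Idomain.dvdp_trans (Pdiv.Idomain.dvdp_gcdr f h).
  by case: fg => g ->; apply: Pdiv.Idomain.dvdp_mull (Pdiv.Idomain.dvdpp _).
have [[u v] /=] := Pdiv.Idomain.Bezout_coprimepP f h cop.
case/Pdiv.Idomain.eqpP => -[c1 c2] /= /andP[c10 c20].
rewrite -!mul_polyC mulr1 => e.
by exists (c1%:P * u), (c1%:P * v), c2; rewrite -e; split=> //; ring.
Qed.

Section Jacobian.
Variable k : fieldType.

Lemma mderivXU n (i j : 'I_n) : ('X_i : {mpoly k[n]})^`M(j) = (i == j)%:R.
Proof.
rewrite mderivX mnm1E; case: eqP => [->|_]; last by rewrite scale0r.
by rewrite scale1r (_ : (U_(j) - U_(j))%MM = 0%MM) ?mpolyX0 //; apply/mnmP => l;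
  rewrite mnmBE subnn mnm0E.
Qed.

Lemma comp_mpoly_tupleX m n (G : 'I_m -> {mpoly k[n]}) i :
  'X_i \mPo [tuple G j | j < m] = G i.
Proof. by rewrite comp_mpolyXU -tnth_nth tnth_map tnth_ord_tuple. Qed.

Lemma mderiv_comp m n (G : 'I_m -> {mpoly k[n]}) (c : {mpoly k[m]}) (l : 'I_n) :
  (c \mPo [tuple G j | j < m])^`M(l) =
  \sum_i (c^`M(i) \mPo [tuple G j | j < m]) * (G i)^`M(l).
Proof.
elim/mpoly_gen_ind: c => [c|j|p q ihp ihq|p q ihp ihq].
- by rewrite comp_mpolyC mderivC big1 // => i _; rewrite mderivC comp_mpoly0 mul0r.
- rewrite comp_mpoly_tupleX (bigD1 j) //= mderivXU eqxx comp_mpoly1 mul1r.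
  rewrite big1 ?addr0 // => i ij; rewrite mderivXU eq_sym (negPf ij) /=.
  by rewrite comp_mpoly0 mul0r.
- rewrite comp_mpolyD mderivD ihp ihq -big_split /=; apply: eq_bigr => i _.
  by rewrite mderivD comp_mpolyD mulrDl.
- rewrite rmorphM mderivM ihp ihq mulr_suml mulr_sumr -big_split /=.
  by apply: eq_bigr => i _; rewrite mderivM comp_mpolyD !rmorphM /=; ring.
Qed.

Lemma msize_mderiv n (p : {mpoly k[n]}) i : p != 0 -> (msize p^`M(i) < msize p)%N.
Proof.
move=> p0; have sp : (0 < msize p)%N by rewrite lt0n msize_poly_eq0.
rewrite -[X in (_ < X)%N]prednK // ltnS {1}mmeasureE.
apply/bigmax_leqP_seq => m hm _.
have : (m + U_(i))%MM \in msupp p.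
  by move: hm; rewrite !mcoeff_msupp mcoeff_deriv; apply: contraNneq => ->; rewrite mul0rn.
by move=> /msize_mdeg_lt; rewrite mdegD mdeg1; move: (mmeasure _ p) => N; rewrite addn1 => h;
  rewrite -ltnS prednK // (leq_trans _ h).
Qed.

Hypothesis k0 : [pchar k] =i pred0.

Lemma mderiv_coeff_eq0 n (p : {mpoly k[n]}) i (m : 'X_{1..n}) :
  p^`M(i) = 0 -> m i != 0%N -> p@_m = 0.
Proof.
move=> h mi; have : p^`M(i)@_(m - U_(i))%MM = 0 by rewrite h mcoeff0.
rewrite mcoeff_deriv submK ?lep1mP // mnmBE mnm1E eqxx => /eqP.
by rewrite -mulr_natr mulf_eq0 (negPf (char0_natf_neq0 k0 (ltn0Sn _))) orbF => /eqP.
Qed.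

Lemma mderiv_eq0_const n (p : {mpoly k[n]}) : (forall i, p^`M(i) = 0) -> p = (p@_0)%:MP.
Proof.
move=> h; apply/mpolyP => m; rewrite mcoeffC.
have [->|] := eqVneq 0%MM m; first by rewrite mulr1.
move=> m0; rewrite mulr0.
have [i mi] : exists i, m i != 0%N.
  apply: NNPP => hn; move/eqP: m0; apply; apply/mnmP => i; rewrite mnm0E.
  by apply/eqP; rewrite eq_sym; apply/negPn/negP => mi; apply: hn; exists i.
exact: mderiv_coeff_eq0 (h i) mi.
Qed.

(** By the chain rule the partial derivatives of a relation [c], evaluated at [G], form a vector
    killed by the Jacobian matrix. They are therefore relations of smaller size, zero by induction;
    so [c] is constant, and then zero. *)
Lemma jacobian_independent n (G : 'I_n -> {mpoly k[n]}) :
  \det (\matrix_(l, i) (G i)^`M(l)) != 0 ->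
  forall c : {mpoly k[n]}, c \mPo [tuple G j | j < n] = 0 -> c = 0.
Proof.
move=> detN c; move: {2}(msize c) (leqnn (msize c)) => s.
elim: s c => [|s ih] c; first by rewrite leqn0 msize_poly_eq0 => /eqP.
move=> hs hc; have [//|c0] := eqVneq c 0.
pose v : 'cV_n := \col_i (c^`M(i) \mPo [tuple G j | j < n]).
have hv : (\matrix_(l, i) (G i)^`M(l)) *m v = 0.
  apply/colP => l; rewrite !mxE; transitivity ((c \mPo [tuple G j | j < n])^`M(l)).
    by rewrite mderiv_comp; apply: eq_bigr => i _; rewrite !mxE mulrC.
  by rewrite hc mderiv0.
have v0 : v = 0.
  have : \adj (\matrix_(l, i) (G i)^`M(l)) *m ((\matrix_(l, i) (G i)^`M(l)) *m v) = 0.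
    by rewrite hv mulmx0.
  rewrite mulmxA mul_adj_mx mul_scalar_mx => /eqP.
  by rewrite scalemx_eq0 (negPf detN) => /eqP.
have dc i : c^`M(i) = 0.
  apply: ih; first by rewrite -ltnS (leq_trans (msize_mderiv i c0) hs).
  by have := congr1 (fun w : 'cV_n => w i 0) v0; rewrite !mxE.
by move: hc; rewrite (mderiv_eq0_const dc) comp_mpolyC.
Qed.

Section Elimination.
Variables (n : nat) (j : 'I_n.+1).

Lemma mderiv_lift (c : {mpoly k[n]}) : (mpoly_lift j c)^`M(j) = 0.
Proof.
elim/mpoly_gen_ind: c => [c|i|p q ihp ihq|p q ihp ihq].
- by rewrite mpoly_liftC mderivC.
- by rewrite mpoly_liftX mderivXU eq_sym (negPf (neq_lift j i)).
- by rewrite rmorphD mderivD ihp ihq addr0.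
- by rewrite rmorphM mderivM ihp ihq mul0r mulr0 addr0.
Qed.

Lemma comp_lift m (G : 'I_n.+1 -> {mpoly k[m]}) (c : {mpoly k[n]}) :
  mpoly_lift j c \mPo [tuple G i | i < n.+1] = c \mPo [tuple G (lift j i) | i < n].
Proof.
apply: (@mpoly_rmorph_ext k _ n
  (comp_mpoly [tuple G i | i < n.+1] \o mpoly_lift j)
  (comp_mpoly [tuple G (lift j i) | i < n])) => [a|i] /=.
  by rewrite mpoly_liftC !comp_mpolyC.
by rewrite mpoly_liftX comp_mpoly_tupleX (comp_mpoly_tupleX (fun i => G (lift j i))).
Qed.

(** [c] plays the role of the resultant of [F] and [H] with respect to variable [j]. The condition
    on the derivative guarantees that this variable occurs in [F]. *)
Lemma eliminate_var (F H : {mpoly k[n.+1]}) : prime_elt F -> F^`M(j) != 0 ->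
  ~ divides F H -> exists u v c, c != 0 /\ u * F + v * H = mpoly_lift j c.
Proof.
move=> Fp dF FH; have ufd := @ufd_mpoly k n.
have fp := prime_elt_iso (@mpoly_joinK k n j) (@mpoly_splitK k n j) Fp.
set f := mpoly_split j F in fp; pose h := mpoly_split j H.
have fh : ~ divides f h.
  case=> c e; apply: FH; exists (mpoly_join j c).
  by rewrite -[H](mpoly_splitK j) -/h e rmorphM; congr (_ * _); apply: mpoly_splitK.
have sf : (1 < size f)%N.
  rewrite ltnNge; apply: contraNN dF => /size1_polyC e.
  by rewrite -[F](mpoly_splitK j) -/f e mpoly_joinC mderiv_lift.
have [u [v [c [c0 e]]]] : exists (u v : {poly {mpoly k[n]}}) (c : {mpoly k[n]}),
    c != 0 /\ u * f + v * h = c%:P by exact: prime_poly_Bezout fp sf fh.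
exists (mpoly_join j u), (mpoly_join j v), c; split=> //.
transitivity (mpoly_join j (u * f + v * h)); last by rewrite e; exact: mpoly_joinC.
have joinD (p q : {poly {mpoly k[n]}}) : mpoly_join j (p + q) = mpoly_join j p + mpoly_join j q by exact: rmorphD.
have joinM (p q : {poly {mpoly k[n]}}) : mpoly_join j (p * q) = mpoly_join j p * mpoly_join j q by exact: rmorphM.
have eF : mpoly_join j f = F by exact: mpoly_splitK.
have eH : mpoly_join j h = H by exact: mpoly_splitK.
move: f h eF eH e {fp fh sf} => f h eF eH e.
by rewrite (joinD (u * f)) (joinM u) (joinM v) eF eH.
Qed.

End Elimination.

(** If [H] vanished on the image without being a multiple of [F], eliminating variable [j] would
    give an algebraic relation between the other n + 1 coordinates of [G], although their Jacobian
    determinant is nonzero at [e]. *)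
Lemma unirational_of_jacobian n (F : {mpoly k[n.+2]}) d
    (G : 'I_n.+2 -> {mpoly k[n.+1]}) (e : 'I_n.+1 -> k) (j : 'I_n.+2) :
  prime_elt F -> (forall i, G i \is d.-homog) ->
  F \mPo [tuple G i | i < n.+2] = 0 ->
  (F^`M(j) \mPo [tuple G i | i < n.+2]).@[e] != 0 ->
  \rank (\matrix_(l < n.+1, i < n.+2) ((G i)^`M(l)).@[e]) = n.+1 ->
  unirational_hypersurface F.
Proof.
move=> Fp Gh FG dF; set J := \matrix_(l, i) _ => rJ.
have dF0 : F^`M(j) != 0 by apply: contraNneq dF => ->; rewrite comp_mpoly0 meval0.
exists d, G; split=> //.
  apply: NNPP => hG; suff J0 : J = 0 by move: rJ; rewrite J0 mxrank0.
  apply/matrixP => l i; rewrite !mxE; suff -> : G i = 0 by rewrite mderiv0 meval0.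
  by apply/eqP/negPn/negP => Gi; apply: hG; exists i.
move=> H HG; apply: NNPP => FH.
have [u [v [c [c0 e1]]]] := eliminate_var Fp dF0 FH.
move/eqP: c0; apply; apply: (@jacobian_independent _ (fun i => G (lift j i))); last first.
  by rewrite -comp_lift -e1 rmorphD !rmorphM /= FG HG !mulr0 addr0.
suff : (\det (\matrix_(l, i) (G (lift j i))^`M(l))).@[e] != 0.
  by apply: contraNneq => ->; rewrite meval0.
rewrite -det_map_mx; apply/det0P => -[w w0 hw]; move/eqP: w0; apply.
have wJ0 i : i != j -> (w *m J) 0 i = 0.
  case: (unliftP j i) => [i' -> _|->]; last by rewrite eqxx.
  have := congr1 (fun z : 'rV_n.+1 => z 0 i') hw; rewrite !mxE => {2}<-.
  by apply: eq_bigr => l _; rewrite !mxE.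
(* Differentiating F(G) = 0 shows that the gradient of [F] kills [J]. Its entry [j] is nonzero, so a
   [w] that kills every other column of [J] kills column [j] too. *)
pose g : 'cV_n.+2 := \col_i (F^`M(i) \mPo [tuple G i | i < n.+2]).@[e].
have Jg : J *m g = 0.
  apply/colP => l; rewrite !mxE.
  transitivity ((F \mPo [tuple G i | i < n.+2])^`M(l)).@[e].
    by rewrite mderiv_comp rmorph_sum; apply: eq_bigr => i _; rewrite !mxE rmorphM /= mulrC.
  by rewrite FG mderiv0 meval0.
have wJj : (w *m J) 0 j = 0.
  have : (w *m J *m g) 0 0 = 0 by rewrite -mulmxA Jg mulmx0 mxE.
  rewrite mxE (bigD1 j) //= big1 ?addr0; last by move=> i ij; rewrite wJ0 // mul0r.
  by move/eqP; rewrite mulf_eq0 => /orP[/eqP//|]; rewrite mxE (negPf dF).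
have wJ : w *m J = 0.
  by apply/rowP => i; rewrite [RHS]mxE; have [->|/wJ0] := eqVneq i j.
have Jfree : row_free J by rewrite /row_free rJ.
by apply/eqP; rewrite -(mulmx_free_eq0 _ Jfree) wJ.
Qed.

End Jacobian.

(** * Chains of primes and coprime members of linear systems *)

(** Strip from [r] its powers of 'X: comparing orders at 0, they account for all of 'X^d, and what
    remains is a factorization of a constant. *)
Lemma divisor_monomial_const (R : idomainType) (f : R) (s r : {poly R}) d :
  f != 0 -> f%:P * 'X^d = s * r -> s`_0 != 0 -> s = (s`_0)%:P.
Proof.
move=> f0 E s0; have sr0 : s * r != 0.
  by rewrite -E mulf_neq0 ?polyC_eq0 // monic_neq0 // monicXn.
move: (sr0); rewrite mulf_eq0 negb_or => /andP[sn0 r0].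
have [m [r1 /implyP/(_ r0) rr]] := multiplicity_XsubC r 0.
rewrite subr0 => er; move: E; rewrite er mulrA => E.
have c0 : (s * r1)`_0 != 0.
  by rewrite -horner_coef0 hornerM mulf_neq0 // horner_coef0.
have edm : d = m.
  have [md|md|//] := ltngtP m d.
    have : (f%:P * 'X^d)`_m = 0 by rewrite coefMXn md.
    by rewrite E coefMXn ltnn subnn => /eqP; rewrite (negPf c0).
  have : (s * r1 * 'X^m)`_d = 0 by rewrite coefMXn md.
  by rewrite -E coefMXn ltnn subnn coefC eqxx => /eqP; rewrite (negPf f0).
move: E; rewrite edm => /(mulIf (monic_neq0 (monicXn _ m))) E.
have r10 : r1 != 0 by apply: contraNneq c0 => ->; rewrite mulr0 coef0.
apply: size1_polyC; have : size (s * r1) = 1%N by rewrite -E size_polyC f0.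
rewrite size_mul //; move: sn0 r10; rewrite -!size_poly_gt0.
by move: (size _) (size _) => a b; lia.
Qed.

Section Chains.
Variable k : fieldType.

Lemma kernel_prime_ideal m n (phi : {rmorphism {mpoly k[m]} -> {mpoly k[n]}}) P :
  is_prime_ideal P -> is_prime_ideal (fun f => P (phi f)).
Proof.
case=> P0 PD PM P1 Pp; split=> [|a b|a b||a b].
- by rewrite rmorph0.
- by rewrite rmorphD; apply: PD.
- by rewrite rmorphM; apply: PM.
- by rewrite rmorph1.
- by rewrite rmorphM; apply: Pp.
Qed.

Lemma principal_prime_ideal n (q : {mpoly k[n]}) :
  prime_elt q -> is_prime_ideal (divides q).
Proof.
move=> qp; case: (qp) => q0 qU qpr; split=> // [|a b|a b|].
- exact: divides0.
- exact: dividesD.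
- exact: divides_mull.
- by move=> h; apply: (prime_ndiv_unit qp (unitr1 _)).
Qed.

Definition restrict_var n (j : 'I_n.+1) (p : {mpoly k[n.+1]}) : {mpoly k[n]} :=
  (mpoly_split j p).[0].

Fact restrict_var_is_zmod_morphism n (j : 'I_n.+1) : zmod_morphism (restrict_var j).
Proof. by move=> p q; rewrite /restrict_var rmorphB hornerD hornerN. Qed.
Fact restrict_var_is_monoid_morphism n (j : 'I_n.+1) : monoid_morphism (restrict_var j).
Proof.
by split; [rewrite /restrict_var rmorph1 hornerC|move=> p q; rewrite /restrict_var rmorphM hornerM].
Qed.
HB.instance Definition _ n (j : 'I_n.+1) :=
  GRing.isZmodMorphism.Build _ _ (restrict_var j) (restrict_var_is_zmod_morphism j).
HB.instance Definition _ n (j : 'I_n.+1) :=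
  GRing.isMonoidMorphism.Build _ _ (restrict_var j) (restrict_var_is_monoid_morphism j).

Lemma restrict_varM n (j : 'I_n.+1) p q :
  restrict_var j (p * q) = restrict_var j p * restrict_var j q.
Proof. exact: rmorphM. Qed.

Lemma restrict_varX n (j : 'I_n.+1) : restrict_var j 'X_j = 0.
Proof. by rewrite /restrict_var mpoly_splitX /split_var unlift_none hornerX. Qed.

Lemma restrict_var_eval0 n (j : 'I_n.+1) p :
  (restrict_var j p).@[fun=> 0] = p.@[fun=> 0].
Proof.
rewrite /restrict_var -horner_map /= rmorph0 mpoly_split_eval.
by apply: meval_eq => i; rewrite /insert_at; case: unlift.
Qed.

Lemma restrict_var_eq0 n (j : 'I_n.+1) p : restrict_var j p = 0 -> divides 'X_j p.
Proof.
move=> h; have [a [c e]] := polyMXaddC_ex (mpoly_split j p).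
move: h; rewrite /restrict_var e hornerD hornerM hornerX mulr0 add0r hornerC => c0.
exists (mpoly_join j a); apply: (can_inj (@mpoly_splitK k n j)).
by rewrite rmorphM /= mpoly_joinK e c0 addr0 mpoly_splitX /split_var unlift_none.
Qed.

Lemma mpolyX_neq0 n (i : 'I_n) : ('X_i : {mpoly k[n]}) != 0.
Proof.
apply/eqP => /(congr1 (meval (fun=> 1))); rewrite mevalXU meval0 => /eqP.
by rewrite oner_eq0.
Qed.

(** The hypersurface q = 0 through the origin has dimension m there. The chain starts with the ideal
    of a prime factor [p] of [q] vanishing at 0 and goes on with the preimages of a chain for the
    restriction of [p] to a coordinate hyperplane. *)
Lemma prime_chain m (q : {mpoly k[m.+1]}) : q != 0 -> q.@[fun=> 0] = 0 ->
  exists c : nat -> {mpoly k[m.+1]} -> Prop,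
    (forall i, (i <= m)%N -> is_prime_ideal (c i) /\ c i q) /\
    (forall i, (i < m)%N ->
        (forall x, c i x -> c i.+1 x) /\ (exists x, c i.+1 x /\ ~ c i x)).
Proof.
elim: m q => [|m ih] q q0 qz.
  exists (fun _ f => f.@[fun=> 0] = 0); split=> // i _; split=> //.
  split=> [|a b ha hb|a b hb||a b].
  - exact: meval0.
  - by rewrite mevalD ha hb addr0.
  - by rewrite mevalM hb mulr0.
  - by rewrite meval1; apply/eqP; rewrite oner_eq0.
  - by rewrite mevalM => /eqP; rewrite mulf_eq0 => /orP[] /eqP; [left|right].
have [s [sp [u uU eq]]] := ufd_mpoly q0.
have [p ps pz] : exists2 p, p \in s & p.@[fun=> 0] = 0.
  move: qz; rewrite eq rmorphM rmorph_prod /= => /eqP; rewrite mulf_eq0.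
  case/orP => [/eqP uz|].
    by have := rmorph_unit (meval (fun=> 0)) uU; rewrite /= uz unitr0.
  by rewrite prodf_seq_eq0 => /hasP[p ps /= /eqP pz]; exists p.
have pp := sp p ps; have [p0 pU ppr] := pp.
have pq : divides p q by rewrite eq; apply: divides_mull; apply: divides_prod.
(* Otherwise every variable divides [p]. Then [p] is associate to the first variable, whose
   restriction to the last hyperplane is not zero, there being at least two variables. *)
have [j rj] : exists j, restrict_var j p != 0.
  apply: NNPP => hn; have rz j : restrict_var j p = 0.
    by apply/eqP/negPn/negP => hj; apply: hn; exists j.
  have [g eg] := restrict_var_eq0 (rz ord0).
  have [|[h eh]|[h eh]] := ppr g 'X_ord0; first by rewrite -eg; apply: dividesxx.
    have /(congr1 (meval (fun=> 0))) : 1 = h * 'X_ord0.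
      by apply: (mulIf p0); rewrite mul1r {1}eg eh; ring.
    by rewrite meval1 rmorphM /= mevalXU mulr0 => /eqP; rewrite oner_eq0.
  have := congr1 (restrict_var ord_max) eh; rewrite restrict_varM rz mulr0.
  rewrite /restrict_var mpoly_splitX /split_var; case: unliftP => // i' _.
  by rewrite hornerC => /eqP; rewrite (negPf (mpolyX_neq0 i')).
have [|c [c1 c2]] := ih (restrict_var j p) rj; first by rewrite restrict_var_eval0.
exists (fun i => if i is i'.+1 then fun f => c i' (restrict_var j f) else divides p).
split=> [[_|i hi]|[_|i hi]].
- by split=> //; apply: principal_prime_ideal.
- have [cp cr] := c1 i hi; split; first exact: kernel_prime_ideal.
  by case: pq => g ->; case: cp => _ _ h _ _; rewrite restrict_varM; apply: h.
- have [[cz _ cM _ _] cr] := c1 0%N (leq0n _).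
  split=> [_ [g ->]|]; first by rewrite restrict_varM; apply: cM.
  exists 'X_j; rewrite restrict_varX; split=> // -[g eg].
  have rg : restrict_var j g = 0.
    by apply: (mulIf rj); rewrite mul0r -restrict_varM -eg restrict_varX.
  have [g' eg'] := restrict_var_eq0 rg.
  move/negP: pU; apply; apply/unitrPr; exists g'; apply: (mulIf (mpolyX_neq0 j)).
  by rewrite mul1r [RHS]eg eg'; ring.
- have [ci [x [cx ncx]]] := c2 i hi; split=> [x'|]; first exact: ci.
  exists (mpoly_lift j x).
  by rewrite /restrict_var mpoly_split_lift hornerC.
Qed.

(** A common divisor would leave a hypersurface of the linear space; its affine cone has chains of
    primes of length h, while the bound allows only h - 1. *)
Lemma proj_dim_le_no_divisor h (J : seq {mpoly k[h.+1]}) (q : {mpoly k[h.+1]}) :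
  (2 <= h)%N -> proj_dim_le J (h - 2) -> q != 0 -> q.@[fun=> 0] = 0 ->
  ~ (forall g, g \in J -> divides q g).
Proof.
move=> h2 dimJ q0 qz qJ; have [c [c1 c2]] := prime_chain q0 qz.
have := dimJ c h; suff l : (h <= (h - 2).+1)%N -> False by move=> H; apply/l/H; [|exact: c2];
  move=> i hi; have [cp cq] := c1 i hi; split=> // g /qJ[a ->]; case: cp => _ _ H' _ _; apply: H'.
by lia.
Qed.

Definition scale_vars n : {mpoly k[n]} -> {poly {mpoly k[n]}} :=
  mmap (polyC \o @mpolyC n k) (fun i : 'I_n => ('X_i)%:P * 'X).
HB.instance Definition _ n := GRing.RMorphism.on (@scale_vars n).

(** [scale_vars] multiplies each variable by a parameter T, so it sends [f] to f T^d. If q(0) were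
    nonzero, the image of [q] would be a divisor of f T^d with nonzero constant term in T, hence
    free of T, and [q] would be the constant q(0). *)
Lemma homog_divisor_eval0 n d (q f : {mpoly k[n]}) : f != 0 -> f \is d.-homog ->
  q \isn't a GRing.unit -> divides q f -> q.@[fun=> 0] = 0.
Proof.
move=> f0 fh qU [r e].
have sigC c : scale_vars c%:MP = c%:MP%:P by rewrite /scale_vars mmapC.
have sigX i : scale_vars 'X_i = ('X_i)%:P * 'X by rewrite /scale_vars mmapX mmap1U.
have sig1 p : (@scale_vars n p).[1] = p.
  apply: (@mpoly_rmorph_ext k _ n (horner_eval 1 \o @scale_vars n) idfun) => [c|i] /=.
    by rewrite sigC /horner_eval hornerC.
  by rewrite sigX /horner_eval hornerM hornerC hornerX mulr1.
have sig0 p : (@scale_vars n p).[0] = (p.@[fun=> 0])%:MP.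
  apply: (@mpoly_rmorph_ext k _ n (horner_eval 0 \o @scale_vars n) (@mpolyC n k \o meval (fun=>
    0))) => [c|i] /=.
    by rewrite sigC /horner_eval hornerC mevalC.
  by rewrite sigX /horner_eval hornerM hornerX mulr0 mevalXU mpolyC0.
have sigf : scale_vars f = f%:P * 'X^d.
  rewrite {1}(mpolyE f) {3}(mpolyE f) !rmorph_sum mulr_suml !big_seq; apply: eq_bigr => m hm.
  rewrite -mul_mpolyC !rmorphM /= sigC -mulrA; congr (_ * _).
  rewrite mpolyXE_id !rmorph_prod /=.
  have -> : d = \sum_(i < n) m i by have := dhomog_mf fh hm; rewrite /= mdegE => <-.
  rewrite expr_sum -big_split /=; apply: eq_bigr => i _.
  by rewrite !rmorphXn /= sigX exprMn.
apply/eqP/negPn/negP => qz.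
have sq : scale_vars q = ((scale_vars q)`_0)%:P.
  apply: (@divisor_monomial_const _ f _ (scale_vars r) d f0); last first.
    by rewrite -horner_coef0 sig0 mpolyC_eq0.
  by rewrite -sigf e mulrC; exact: rmorphM.
move/negP: qU; apply; rewrite -(sig1 q) sq hornerC -horner_coef0 sig0.
exact: mpoly_unitC.
Qed.

Lemma coprime_elt_sym (R : idomainType) (f g : R) : coprime_elt f g -> coprime_elt g f.
Proof. by move=> h q qp qg qf; apply: (h q). Qed.

Hypothesis k0 : [pchar k] =i pred0.

Lemma exists_notin (bad : seq k) : exists t, t \notin bad.
Proof.
apply: NNPP => h; have sub : {subset [seq i%:R | i <- iota 0 (size bad).+1] <= bad}.
  by move=> x _; apply/negPn/negP => hx; apply: h; exists x.
have := uniq_leq_size _ sub; rewrite size_map size_iota ltnn map_inj_uniq ?iota_uniq.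
  by move=> H; have := H isT.
exact: char0_natf_inj.
Qed.

(** Each [q] excludes at most one [t]: if it divided a + t b for two values of [t], it would divide
    both [b] and [a]. *)
Lemma avoid_primes n (qs : seq {mpoly k[n]}) (a b : {mpoly k[n]}) :
  (forall q, q \in qs -> ~ (divides q a /\ divides q b)) ->
  exists bad : seq k, forall t, t \notin bad ->
    forall q, q \in qs -> ~ divides q (a + t *: b).
Proof.
elim: qs => [|q qs ih] h; first by exists [::].
have [|bad hb] := ih; first by move=> r rs; apply: h; rewrite inE rs orbT.
have [[t0 ht0]|hn] := classic (exists t, divides q (a + t *: b)); last first.
  exists bad => t /hb ht r; rewrite inE => /orP[/eqP-> qt|/ht//].
  by apply: hn; exists t.
exists (t0 :: bad) => t; rewrite inE negb_or => /andP[tt0 /hb ht] r.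
rewrite inE => /orP[/eqP-> qt|/ht//]; apply: (h q); first exact: mem_head.
have qb : divides q b.
  have := dividesB qt ht0; rewrite opprD addrACA subrr add0r -scalerBl.
  case=> c ec; exists ((t - t0)^-1 *: c).
  by rewrite -scalerAl -ec scalerA mulVf ?scale1r // subr_eq0.
split=> //; have := dividesB qt (divides_mull t%:MP qb).
by rewrite mul_mpolyC addrK.
Qed.

Lemma coprime_pencil n (f a g : {mpoly k[n]}) : g != 0 -> coprime_elt f g ->
  exists bad : seq k, forall t, t \notin bad -> coprime_elt (f + t *: a) g.
Proof.
move=> g0 cop; have [s fs] := ufd_mpoly g0; have [sp [u uU eg]] := fs.
have sg r : r \in s -> divides r g.
  by move=> rs; rewrite eg; apply: divides_mull; apply: divides_prod.
have [|bad hb] := @avoid_primes _ s f a.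
  by move=> q qs [qf _]; apply: (cop q (sp q qs) qf); apply: sg.
exists bad => t /hb ht q qp qf qg.
have [r rs qr] := prime_divides_factors qp fs qg.
have [v vU er] := prime_divides_prime qp (sp r rs) qr.
apply: (ht r rs); case: qf => c ->; exists (c * v^-1).
by rewrite er mulrA divrK.
Qed.

Lemma exists_coprime_pair n m (J : 'rV[k]_m -> {mpoly k[n]}) :
  (forall y c t, J (y + t *: c) = J y + t *: J c) ->
  (forall q, prime_elt q -> exists y, ~ divides q (J y)) ->
  forall y, J y != 0 -> exists c, coprime_elt (J y) (J c).
Proof.
move=> Jlin nodiv y y0; have [s fs] := ufd_mpoly y0; have [sp _] := fs.
have [c hc] : exists c, forall q, q \in s -> ~ divides q (J c).
  elim: s sp {fs} => [|q s ih] sp; first by exists 0.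
  have [|c hc] := ih; first by move=> r rs; apply: sp; rewrite inE rs orbT.
  have [z hz] := nodiv q (sp q (mem_head _ _)).
  have [|bad hb] := @avoid_primes _ (q :: s) (J c) (J z).
    by move=> r; rewrite inE => /orP[/eqP-> [_ /hz]|/hc h [/h]].
  have [t ht] := exists_notin bad; exists (c + t *: z) => r rs.
  by rewrite Jlin; apply: hb.
exists c => q qp qf qg.
have [r rs qr] := prime_divides_factors qp fs qf.
have [v vU er] := prime_divides_prime qp (sp r rs) qr.
by apply: (hc r rs); case: qg => a ->; exists (a * v^-1); rewrite er mulrA divrK.
Qed.

End Chains.

(** * Symmetric quadrilinear forms *)

Section SymmetricForm.
Variables (R : comNzRingType) (V : lmodType R).

Record sym4 (M : V -> V -> V -> V -> R) : Prop := Sym4 {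
  sym4D : forall a b c d e, M (a + b) c d e = M a c d e + M b c d e;
  sym4Z : forall t a c d e, M (t *: a) c d e = t * M a c d e;
  sym4_12 : forall a b c d, M a b c d = M b a c d;
  sym4_23 : forall a b c d, M a b c d = M a c b d;
  sym4_34 : forall a b c d, M a b c d = M a b d c }.

Variable M : V -> V -> V -> V -> R.
Hypothesis symM : sym4 M.
Implicit Types (a b c d e x y v w z : V) (s t : R).

Local Notation MD := (sym4D symM).
Local Notation MZ := (sym4Z symM).
Local Notation M12 := (sym4_12 symM).
Local Notation M23 := (sym4_23 symM).
Local Notation M34 := (sym4_34 symM).

Lemma form_comb1 a b t c d e : M (a + t *: b) c d e = M a c d e + t * M b c d e.
Proof. by rewrite MD MZ. Qed.

Lemma form_comb2 a b t c d e : M c (a + t *: b) d e = M c a d e + t * M c b d e.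
Proof. by rewrite M12 form_comb1 !(M12 _ c). Qed.

Lemma form_comb3 a b t c d e : M c d (a + t *: b) e = M c d a e + t * M c d b e.
Proof. by rewrite M23 form_comb2 !(M23 c _ d). Qed.

Lemma form_comb4 a b t c d e : M c d e (a + t *: b) = M c d e a + t * M c d e b.
Proof. by rewrite M34 form_comb3 !(M34 c d _ e). Qed.

Lemma form_square a b t v w : M (a + t *: b) (a + t *: b) v w =
  M a a v w + 2 * t * M a b v w + t ^+ 2 * M b b v w.
Proof. by rewrite form_comb1 !form_comb2 (M12 b a); ring. Qed.

Lemma form_cube a b t v : M (a + t *: b) (a + t *: b) (a + t *: b) v =
  M a a a v + 3 * t * M a a b v + 3 * t ^+ 2 * M a b b v + t ^+ 3 * M b b b v.
Proof.
rewrite form_square !form_comb3 (M23 a b a) (M23 b b a) (M12 b a b); ring.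
Qed.

Lemma form_quart a b t : M (a + t *: b) (a + t *: b) (a + t *: b) (a + t *: b) =
  M a a a a + 4 * t * M a a a b + 6 * t ^+ 2 * M a a b b + 4 * t ^+ 3 * M a b b b
  + t ^+ 4 * M b b b b.
Proof.
rewrite form_cube !form_comb4 (M34 a a b a) (M34 a b b a) (M34 b b b a).
by rewrite (M23 a b a b) (M23 b b a b) (M12 b a b b); ring.
Qed.

Lemma form_rot a b c d : M a b c d = M b c d a.
Proof. by rewrite M12 M23 M34. Qed.

Lemma form_zero1 b c d : M 0 b c d = 0.
Proof. by rewrite -(scale0r 0) MZ mul0r. Qed.

End SymmetricForm.

Section GoodPoints.
Variables (k : fieldType) (V : lmodType k) (M : V -> V -> V -> V -> k).
Hypothesis symM : sym4 M.
Hypothesis k0 : [pchar k] =i pred0.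
Variable Lam : V -> Prop.
Hypothesis isoL : forall a b c d, Lam a -> Lam b -> Lam c -> Lam d -> M a b c d = 0.

(* [M P P P c != 0] says that the quartic is smooth at [P]; the vanishing conditions that
   [x] is the residual point of a line with third-order contact at [P]; the rest makes the
   parametrization of these points submersive at [x]. *)
Definition good_point := exists P u1 u2 x c : V,
  [/\ Lam P, Lam u1 & Lam u2] /\
  [/\ M P P P c != 0, M P P P x = 0, M P P x x = 0 & M x x x x = 0] /\
  [/\ M P P u1 x != 0, M P P u2 x = 0, M P u2 x x != 0 & M P x x x != 0].

Local Notation M12 := (sym4_12 symM).
Local Notation M23 := (sym4_23 symM).
Local Notation M34 := (sym4_34 symM).
Local Notation exp := (form_comb1 symM, form_comb2 symM, form_comb3 symM, form_comb4 symM).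

Local Notation srt x y := (fun c d => M12 x y c d, fun a d => M23 a x y d, fun a b => M34 a b x y).

(** The last condition, that [x] lies on the quartic, comes for free: on the line through [x] and
    [P] the quartic is affine in the parameter with slope 4 M P x x x, and moving along [P]
    preserves the other conditions. *)
Lemma good_point_adjust (P u1 u2 x c : V) :
  Lam P -> Lam u1 -> Lam u2 ->
  M P P P c != 0 -> M P P P x = 0 -> M P P x x = 0 ->
  M P P u1 x != 0 -> M P P u2 x = 0 -> M P u2 x x != 0 -> M P x x x != 0 -> good_point.
Proof.
move=> lP l1 l2 hc h1 h2 h3 h4 h5 h6.
pose t := - M x x x x / (4 * M P x x x).
have c4 : (4 : k) != 0 := char0_natf_neq0 k0 (isT : (0 < 4)%N).
exists P, u1, u2, (x + t *: P), c; split=> //; split; split=> //.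
- by rewrite !exp h1 (isoL lP lP lP lP) mulr0 addr0.
- rewrite !exp !(srt x P) h2 h1 (isoL lP lP lP lP) //; ring.
- rewrite (form_quart symM) !(srt x P) h1 h2 (isoL lP lP lP lP) /t.
  by field; rewrite h6.
- by rewrite !exp !(srt u1 P) (isoL lP lP lP l1) mulr0 addr0.
- by rewrite !exp !(srt u2 P) (isoL lP lP lP l2) h4 mulr0 addr0.
- rewrite !exp !(srt x P) !(srt u2 P) (isoL lP lP lP l2) h4.
  by apply: contraNneq h5 => <-; apply/eqP; ring.
- rewrite !exp !(srt x P) h1 h2 (isoL lP lP lP lP).
  by apply: contraNneq h6 => <-; apply/eqP; ring.
Qed.

(** [v] is first moved along [u1] to reach M P P x x = 0, then along [U], if necessary, to make M P
    x x x nonzero. The vanishing conditions on [U] make these moves harmless to the rest. *)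
Lemma good_point_of_direction (P U u1 v c : V) :
  Lam P -> Lam U -> Lam u1 ->
  M P P P c != 0 -> M P P P v = 0 -> M P P u1 v != 0 ->
  M P P U v = 0 -> M P u1 U v = 0 -> M P U U v = 0 -> M P U v v != 0 -> good_point.
Proof.
move=> lP lU l1 hc h1 h2 h3 h4 h5 h6.
have two : (2 : k) != 0 := char0_natf_neq0 k0 (isT : (0 < 2)%N).
have three : (3 : k) != 0 := char0_natf_neq0 k0 (isT : (0 < 3)%N).
pose x0 := v + (- M P P v v / (2 * M P P u1 v)) *: u1.
have iso a b d : Lam a -> Lam b -> Lam d -> M P a b d = 0 by move=> *; apply: isoL.
have e1 : M P P P x0 = 0 by rewrite /x0 !exp h1 (iso P P u1) // mulr0 addr0.
have e2 : M P P x0 x0 = 0.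
  by rewrite /x0 !exp !(srt v u1) (iso P u1 u1) //; field; rewrite h2.
have e3 : M P P u1 x0 = M P P u1 v by rewrite /x0 !exp (iso P u1 u1) // mulr0 addr0.
have e4 : M P P U x0 = 0 by rewrite /x0 !exp (iso P U u1) // h3 mulr0 addr0.
have e5 : M P U x0 x0 = M P U v v.
  by rewrite /x0 !exp !(srt v u1) !(srt U u1) (iso u1 u1 U) // h4; ring.
have e6 : M P U U x0 = 0 by rewrite /x0 !exp h5 (iso U U u1) // mulr0 addr0.
clearbody x0.
have [t ht] : exists t, M P x0 x0 x0 + 3 * t * M P U v v != 0.
  have [e|] := eqVneq (M P x0 x0 x0) 0; last by move=> e; exists 0; rewrite mulr0 mul0r addr0.
  by exists 1; rewrite e add0r mulr1 mulf_neq0.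
apply: (@good_point_adjust P u1 U (x0 + t *: U) c) => //.
- by rewrite !exp e1 (iso P P U) // mulr0 addr0.
- by rewrite !exp !(srt x0 U) e2 e4 (iso P U U) //; ring.
- by rewrite !exp e3 (iso P u1 U) // mulr0 addr0.
- by rewrite !exp e4 (iso P U U) // mulr0 addr0.
- rewrite !exp !(srt x0 U) e5 e6 (iso U U U) //.
  by apply: contraNneq h6 => <-; apply/eqP; ring.
- rewrite !exp !(srt x0 U) e5 e6 (iso U U U) //.
  by apply: contraNneq ht => <-; apply/eqP; ring.
Qed.

(** The point is sought near [W] itself, as W + t y with [y] a correction of [v]; [W] also serves as
    the second direction [u2]. *)
Lemma good_point_of_inflection (P W u0 v c : V) :
  Lam P -> Lam W -> Lam u0 ->
  M P P P c != 0 -> M P P P v = 0 -> M P P W v = 0 -> M P W W v != 0 ->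
  M P P u0 v != 0 -> good_point.
Proof.
move=> lP lW l0 hc h1 h2 h3 h4.
have two : (2 : k) != 0 := char0_natf_neq0 k0 (isT : (0 < 2)%N).
have three : (3 : k) != 0 := char0_natf_neq0 k0 (isT : (0 < 3)%N).
have iso a b d : Lam a -> Lam b -> Lam d -> M P a b d = 0 by move=> *; apply: isoL.
pose y := v + (- M P P v v / (2 * M P P u0 v)) *: u0.
have e1 : M P P P y = 0 by rewrite /y !exp h1 (iso P P u0) // mulr0 addr0.
have e2 : M P P y y = 0.
  by rewrite /y !exp !(srt v u0) (iso P u0 u0) //; field; rewrite h4.
have e3 : M P P u0 y = M P P u0 v by rewrite /y !exp (iso P u0 u0) // mulr0 addr0.
have e4 : M P P W y = 0 by rewrite /y !exp (iso P W u0) // h2 mulr0 addr0.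
have e5 : M P W W y = M P W W v by rewrite /y !exp (iso W W u0) // mulr0 addr0.
clearbody y.
(* At x = W + t y the values M P W x x and M P x x x are t q1(t) and t q2(t). Both constant terms
   are nonzero multiples of M P W W v, so some nonzero [t] avoids all zeros. *)
pose q1 := (2 * M P W W v)%:P + M P W y y *: 'X : {poly k}.
pose q2 := (3 * M P W W v)%:P + (3 * M P W y y) *: 'X + M P y y y *: 'X^2 : {poly k}.
have [t] : exists t, ('X * q1 * q2).[t] != 0.
  apply: poly_neq0_eval => //; rewrite !mulf_neq0 ?polyX_eq0 //.
    have : q1.[0] != 0 by rewrite (_ : q1.[0] = 2 * M P W W v) ?mulf_neq0 // /q1 !hornerE; ring.
    by apply: contraNneq => ->; rewrite horner0.
  have : q2.[0] != 0 by rewrite (_ : q2.[0] = 3 * M P W W v) ?mulf_neq0 // /q2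
    !(hornerD, hornerC, hornerZ, hornerX, hornerXn); ring.
  by apply: contraNneq => ->; rewrite horner0.
rewrite !hornerM !mulf_eq0 !negb_or /q1 /q2 !(hornerD, hornerC, hornerZ, hornerX, hornerXn) =>
  /andP[/andP[t0 ht1] ht2].
apply: (@good_point_adjust P u0 W (W + t *: y) c) => //.
- by rewrite !exp e1 (iso P P W) // mulr0 addr0.
- by rewrite !exp !(srt y W) e2 e4 (iso P W W) //; ring.
- by rewrite !exp e3 (iso P u0 W) // add0r mulf_neq0.
- by rewrite !exp e4 (iso P W W) // mulr0 addr0.
- rewrite !exp !(srt y W) e5 (iso W W W) //.
  have : t * (2 * M P W W v + M P W y y * t) != 0 by rewrite mulf_neq0.
  by apply: contraNneq => <-; apply/eqP; ring.
- rewrite !exp !(srt y W) e5 (iso W W W) //.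
  have : t * (3 * M P W W v + 3 * M P W y y * t + M P y y y * t ^+ 2) != 0.
    by rewrite mulf_neq0.
  by apply: contraNneq => <-; apply/eqP; ring.
Qed.

End GoodPoints.

Section TensorForm.
Variables (R : comNzRingType) (N : nat) (m : 'I_N -> 'I_N -> 'I_N -> 'I_N -> R).

Definition tensor_form (a b c d : 'rV[R]_N) : R :=
  \sum_i \sum_j \sum_l \sum_r m i j l r * (a 0 i * b 0 j * c 0 l * d 0 r).

Lemma tensor_form_sym4 :
  (forall i j l r, m i j l r = m j i l r) ->
  (forall i j l r, m i j l r = m i l j r) ->
  (forall i j l r, m i j l r = m i j r l) -> sym4 tensor_form.
Proof.
move=> m12 m23 m34; split.
- move=> a b c d e; rewrite /tensor_form.
  do 4! (rewrite -big_split; apply: eq_bigr => ? _ /=).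
  by rewrite !mxE; ring.
- move=> t a c d e; rewrite /tensor_form.
  do 4! (rewrite mulr_sumr; apply: eq_bigr => ? _ /=).
  by rewrite !mxE; ring.
- move=> a b c d; rewrite /tensor_form exchange_big /=.
  by do 4! (apply: eq_bigr => ? _); rewrite m12; ring.
- move=> a b c d; rewrite /tensor_form; apply: eq_bigr => i _; rewrite exchange_big /=.
  by do 3! (apply: eq_bigr => ? _); rewrite m23; ring.
- move=> a b c d; rewrite /tensor_form; apply: eq_bigr => i _; apply: eq_bigr => j _.
  by rewrite exchange_big /=; do 2! (apply: eq_bigr => ? _); rewrite m34; ring.
Qed.

End TensorForm.

Lemma tensor_form_map (R S : comNzRingType) (phi : {rmorphism R -> S}) N m
    (a b c d : 'rV[R]_N) :
  phi (tensor_form m a b c d) =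
  tensor_form (fun i j l r => phi (m i j l r))
    (map_mx phi a) (map_mx phi b) (map_mx phi c) (map_mx phi d).
Proof.
rewrite /tensor_form; do 4! (rewrite rmorph_sum; apply: eq_bigr => ? _ /=).
by rewrite !rmorphM !mxE.
Qed.

Lemma form_sum1 (R : comNzRingType) N (M : 'rV[R]_N -> 'rV[R]_N -> 'rV[R]_N -> 'rV[R]_N -> R)
    p (a : 'rV[R]_p) (A : 'M[R]_(p, N)) b c d : sym4 M ->
  M (a *m A) b c d = \sum_i a 0 i * M (row i A) b c d.
Proof.
move=> symM; rewrite mulmx_sum_row.
apply: (big_ind2 (fun x y => M x b c d = y)) => [|x1 y1 x2 y2 <- <-|i _].
- exact: form_zero1.
- exact: sym4D.
- exact: sym4Z.
Qed.

Lemma form_isotropic (R : comNzRingType) N (M : 'rV[R]_N -> 'rV[R]_N -> 'rV[R]_N -> 'rV[R]_N -> R)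
    p (A : 'M[R]_(p, N)) : sym4 M ->
  (forall i j l r, M (row i A) (row j A) (row l A) (row r A) = 0) ->
  forall a b c d, M (a *m A) (b *m A) (c *m A) (d *m A) = 0.
Proof.
move=> symM h a b c d; rewrite form_sum1 // big1 // => i _.
rewrite (form_rot symM (row i A)) form_sum1 // big1 ?mulr0 // => j _.
rewrite (form_rot symM (row j A)) form_sum1 // big1 ?mulr0 // => l _.
rewrite (form_rot symM (row l A)) form_sum1 // big1 ?mulr0 // => r _.
by rewrite h mulr0.
Qed.

Section Quartic.
Variable k : fieldType.
Hypothesis k0 : [pchar k] =i pred0.

Lemma mpoly_Euler n d (p : {mpoly k[n]}) : p \is d.-homog ->
  d%:R *: p = \sum_i 'X_i * p^`M(i).
Proof.
move=> hp; rewrite {1}(mpolyE p) scaler_sumr.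
under [RHS]eq_bigr => i _ do rewrite {1}(mpolyE p) raddf_sum mulr_sumr.
rewrite exchange_big /= !big_seq; apply: eq_bigr => m hm.
rewrite -(dhomog_mf hp hm) /= mdegE natr_sum scaler_suml; apply: eq_bigr => i _.
rewrite mderivZ mderivX -!scalerAr !scalerA mulrC -mpolyXD.
have [->|mi] := eqVneq (m i) 0%N; first by rewrite mulr0 !scale0r.
by rewrite addmC submK // lep1mP.
Qed.

Lemma mderiv_homog n d (p : {mpoly k[n]}) i : p \is d.+1.-homog -> p^`M(i) \is d.-homog.
Proof.
move=> hp; apply/dhomogP => m hm.
have : (m + U_(i))%MM \in msupp p.
  by move: hm; rewrite !mcoeff_msupp mcoeff_deriv; apply: contraNneq => ->; rewrite mul0rn.
by move/(dhomog_mf hp) => /=; rewrite mdegD mdeg1 addn1 => -[].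
Qed.

Variables (N : nat) (F : {mpoly k[N]}).
Hypothesis Fh : F \is 4.-homog.

(** The fourth derivatives are constants, read off as constant coefficients; dividing by 4! makes
    the form restrict to [F] on the diagonal. *)
Definition quartic_tensor (i j l r : 'I_N) : k :=
  (F^`M(i)^`M(j)^`M(l)^`M(r))@_0 / 24%:R.

(** The coefficients are transported along [phi] so that the same form is available over [k], over
    univariate polynomials (curves) and over multivariate ones (parametrizations). *)
Definition quartic_form (R : comNzRingType) (phi : {rmorphism k -> R}) :=
  tensor_form (fun i j l r => phi (quartic_tensor i j l r)).

Lemma quartic_form_sym4 R phi : sym4 (@quartic_form R phi).
Proof.
apply: tensor_form_sym4 => i j l r; rewrite /quartic_tensor.
- by rewrite (mderiv_comm i j).
- by rewrite (mderiv_comm j l).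
- by rewrite (mderiv_comm l r).
Qed.

Let row_of (R : comNzRingType) (v : 'I_N -> R) : 'rV[R]_N := \row_i v i.

Lemma homog0_const n (p : {mpoly k[n]}) : p \is 0.-homog -> p = (p@_0)%:MP.
Proof.
move=> hp; apply/msize1_polyC; rewrite mmeasureE.
by apply/bigmax_leqP_seq => m /(dhomog_mf hp) /= ->.
Qed.

Lemma mderiv_quartic_form i :
  F^`M(i) = 4%:R *: quartic_form (@mpolyC N k) (row_of (fun j => 'X_j)) (row_of (fun j => 'X_j))
    (row_of (fun j => 'X_j)) (delta_mx 0 i).
Proof.
have six : (24%:R : k) != 0 := char0_natf_neq0 k0 (isT : (0 < 24)%N).
have s6 : (6%:R : k) != 0 := char0_natf_neq0 k0 (isT : (0 < 6)%N).
apply: (scalerI s6); rewrite scalerA.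
have h1 := mderiv_homog i Fh.
(* Euler's identity for the successive derivatives, of degrees 3, 2 and 1; their product is the
   factor 6. *)
have -> : 6%:R *: F^`M(i) = \sum_j \sum_l \sum_r 'X_j * 'X_l * 'X_r * F^`M(i)^`M(j)^`M(l)^`M(r).
  have e6 : (6%:R : k) = 2%:R * 3%:R by rewrite -natrM.
  rewrite e6 -scalerA (mpoly_Euler h1) scaler_sumr.
  apply: eq_bigr => j _; have h2 := mderiv_homog j h1.
  rewrite scalerAr (mpoly_Euler h2) mulr_sumr; apply: eq_bigr => l _.
  have h3 := mderiv_homog l h2.
  rewrite -[X in _ * (_ * X)]scale1r (mpoly_Euler h3) !mulr_sumr; apply: eq_bigr => r _.
  by rewrite !mulrA.
rewrite -(form_rot (quartic_form_sym4 _) (delta_mx 0 i)).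
rewrite /quartic_form /tensor_form [in RHS](bigD1 i) //= [X in _ + X]big1 ?addr0.
  rewrite !scaler_sumr; apply: eq_bigr => j _; rewrite !scaler_sumr; apply: eq_bigr => l _.
  rewrite !scaler_sumr; apply: eq_bigr => r _; rewrite !mxE !eqxx /= mul1r.
  rewrite {1}[_^`M(r)]homog0_const; last by do 3! apply: mderiv_homog.
  rewrite /quartic_tensor mul_mpolyC scalerA mulrC mul_mpolyC; congr (_ *: _).
  by rewrite -natrM mulrC divfK.
move=> j ji; rewrite big1 // => l _; rewrite big1 // => r _; rewrite big1 // => s _.
by rewrite !mxE (negPf ji) /=; ring.
Qed.

Lemma quartic_formE :
  F = quartic_form (@mpolyC N k) (row_of (fun j => 'X_j)) (row_of (fun j => 'X_j))
    (row_of (fun j => 'X_j)) (row_of (fun j => 'X_j)).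
Proof.
have s4 : (4%:R : k) != 0 := char0_natf_neq0 k0 (isT : (0 < 4)%N).
apply: (scalerI s4); rewrite (mpoly_Euler Fh).
set X := row_of _; set Q := quartic_form _.
have -> : Q X X X X = Q (X *m 1%:M) X X X by rewrite mulmx1.
rewrite form_sum1; last exact: quartic_form_sym4.
rewrite scaler_sumr; apply: eq_bigr => i _; rewrite mderiv_quartic_form.
by rewrite row1 /Q (form_rot (quartic_form_sym4 _) (delta_mx 0 i)) -scalerAr !mxE.
Qed.

Lemma quartic_form_mmap (R : comNzRingType) (phi : {rmorphism k -> R}) (v : 'rV[R]_N) :
  mmap phi (v 0) F = quartic_form phi v v v v.
Proof.
rewrite {1}quartic_formE tensor_form_map.
have -> : map_mx (mmap phi (v 0)) (row_of (fun j => 'X_j)) = v.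
  by apply/rowP => j; rewrite !mxE mmapX mmap1U.
by rewrite /quartic_form /tensor_form; do 4! (apply: eq_bigr => ? _); rewrite /= mmapC.
Qed.

Lemma mderiv_form_mmap (R : comNzRingType) (phi : {rmorphism k -> R}) (v : 'rV[R]_N) i :
  mmap phi (v 0) F^`M(i) = 4 * quartic_form phi v v v (delta_mx 0 i).
Proof.
rewrite mderiv_quartic_form mmapZ tensor_form_map.
have -> : map_mx (mmap phi (v 0)) (row_of (fun j => 'X_j)) = v.
  by apply/rowP => j; rewrite !mxE mmapX mmap1U.
rewrite map_delta_mx rmorph_nat; congr (_ * _).
by rewrite /quartic_form /tensor_form; do 4! (apply: eq_bigr => ? _); rewrite /= mmapC.
Qed.

End Quartic.

(** * Dominance from first-order deformations *)

Lemma mmap_eq (R S : nzRingType) n (f : R -> S) (h1 h2 : 'I_n -> S) (p : {mpoly R[n]}) :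
  h1 =1 h2 -> mmap f h1 p = mmap f h2 p.
Proof.
by move=> h; apply: eq_bigr => m _; congr (_ * _); apply: mmap1_eq.
Qed.

Section Curves.
Variables (k : fieldType) (n : nat).
Implicit Types (e a : 'I_n -> k).

Definition curve_eval e a : {mpoly k[n]} -> {poly k} :=
  mmap polyC (fun i => (e i)%:P + (a i)%:P * 'X).
HB.instance Definition _ e a := GRing.RMorphism.on (curve_eval e a).

Lemma curve_evalC e a c : curve_eval e a c%:MP = c%:P.
Proof. by rewrite /curve_eval mmapC. Qed.

Lemma curve_evalX e a i : curve_eval e a 'X_i = (e i)%:P + (a i)%:P * 'X.
Proof. by rewrite /curve_eval mmapX mmap1U. Qed.

Lemma curve_eval_coef e a H : (curve_eval e a H)`_0 = H.@[e] /\
  (curve_eval e a H)`_1 = \sum_i a i * H^`M(i).@[e].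
Proof.
elim/mpoly_gen_ind: H => [c|i|p q [p0 p1] [q0 q1]|p q [p0 p1] [q0 q1]].
- rewrite curve_evalC !coefC mevalC; split=> //.
  by rewrite big1 // => i _; rewrite mderivC meval0 mulr0.
- rewrite curve_evalX !coefD !coefMX !coefC /= mevalXU addr0 add0r; split=> //.
  rewrite (bigD1 i) //= mderivXU eqxx meval1 mulr1 big1 ?addr0 // => j ji.
  by rewrite mderivXU eq_sym (negPf ji) meval0 mulr0.
- rewrite rmorphD !coefD p0 p1 q0 q1 mevalD; split=> //.
  by under [RHS]eq_bigr => i _ do rewrite mderivD mevalD mulrDr; rewrite big_split.
- rewrite rmorphM coef0M coefM !big_ord_recr big_ord0 /= p0 p1 q0 q1 mevalM; split=> //.
  under [RHS]eq_bigr => i _ do rewrite mderivM mevalD !mevalM mulrDr mulrA mulrCA.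
  by rewrite big_split /= -mulr_suml -mulr_sumr add0r addrC.
Qed.

End Curves.

Section Deformation.
Variable k : fieldType.
Hypothesis k0 : [pchar k] =i pred0.
Variables (n : nat) (F : {mpoly k[n.+2]}).
Hypotheses (Fh : F \is 4.-homog) (Fp : prime_elt F).

Local Notation idk := (idfun : {rmorphism k -> k}).
Local Notation cst := (map_mx polyC).

(** The expansion says that the differential of [G] at [e] sends the l-th basis vector to kap0 times
    row l of [Xi], modulo [x]. Since [x] itself lies in the image by Euler's identity, the
    differential has full rank n + 1. *)
Lemma unirational_of_deformation (x : 'rV[k]_n.+2) (Xi : 'M[k]_(n.+1, n.+2))
    (e : 'rV[k]_n.+1) (G : 'rV[{mpoly k[n.+1]}]_n.+2) (d : nat) (kap0 : k) (j : 'I_n.+2) :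
  (0 < d)%N -> (forall i, G 0 i \is d.-homog) ->
  quartic_form F (@mpolyC n.+1 k) G G G G = 0 ->
  row_free Xi -> e *m Xi = x -> kap0 != 0 ->
  quartic_form F idk x x x (delta_mx 0 j) != 0 ->
  (forall l, exists (kap : {poly k}) w, kap`_0 = kap0 /\
     map_mx (curve_eval (e 0) (fun i => (i == l)%:R)) G =
     kap *: (cst x + 'X *: cst (row l Xi)) + 'X^2 *: w) ->
  unirational_hypersurface F.
Proof.
move=> d0 Gh FG Xifree eXi kap00 dFx def.
have Ge i : (G 0 i).@[e 0] = kap0 * x 0 i.
  have [kap [w [e0 eG]]] := def ord0.
  rewrite -(curve_eval_coef _ (fun i => (i == ord0)%:R) _).1.
  have := congr1 (fun v : 'rV[{poly k}]_n.+2 => (v 0 i)`_0) eG; rewrite !mxE => ->.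
  by rewrite coefD coef0M coefXnM /= addr0 e0 coefD coefXM coefC /= addr0.
apply: (@unirational_of_jacobian k k0 n F d (fun i => G 0 i) (e 0) j Fp Gh).
- rewrite /comp_mpoly -[RHS]FG -(quartic_form_mmap k0 Fh); apply: mmap_eq => i.
  by rewrite tnth_map tnth_ord_tuple.
- rewrite comp_mpoly_meval.
  have -> : F^`M(j).@[fun i => (tnth [tuple G 0 i | i < n.+2] i).@[e 0]] =
            mmap idk ((kap0 *: x) 0) F^`M(j).
    by apply: meval_eq => i; rewrite tnth_map tnth_ord_tuple Ge !mxE.
  rewrite (mderiv_form_mmap k0 Fh).
  have sM := quartic_form_sym4 F idk.
  rewrite (sym4Z sM) (sym4_12 sM) (sym4Z sM) (sym4_23 sM) (sym4_12 sM) (sym4Z sM).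
  by rewrite !mulf_neq0 // (char0_natf_neq0 k0 (isT : (0 < 4)%N)).
set J := \matrix_(l, i) _.
have eJ : e *m J = (d%:R * kap0) *: x.
  apply/rowP => i; rewrite !mxE -mulrA -Ge -mevalZ (mpoly_Euler (Gh i)) rmorph_sum /=.
  by apply: eq_bigr => l _; rewrite !mxE mevalM mevalXU.
have xJ : (x <= J)%MS.
  have dk : d%:R * kap0 != 0 by rewrite mulf_neq0 // char0_natf_neq0.
  by rewrite -[x]scale1r -(mulVf dk) -scalerA -eJ scalemx_sub // submxMl.
have XiJ : (Xi <= J)%MS.
  apply/row_subP => l; have [kap [w [e0 eG]]] := def l.
  have eJl : row l J = kap0 *: row l Xi + kap`_1 *: x.
    apply/rowP => i; have [_] := curve_eval_coef (e 0) (fun i => (i == l)%:R) (G 0 i).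
    rewrite (bigD1 l) //= eqxx mul1r big1 ?addr0; last first.
      by move=> i' /negPf ->; rewrite mul0r.
    rewrite !mxE => <-; have := congr1 (fun v : 'rV[{poly k}]_n.+2 => (v 0 i)`_1) eG;
      rewrite !mxE => ->.
    rewrite coefD coefXnM /= addr0 coefM !big_ord_recr big_ord0 /= !coefD !coefXM !coefC /=.
    by rewrite e0; ring.
  have -> : row l Xi = kap0^-1 *: (row l J - kap`_1 *: x).
    by rewrite eJl addrK scalerA mulVf // scale1r.
  by rewrite scalemx_sub // addmx_sub ?row_sub // eqmx_opp scalemx_sub.
apply/eqP; rewrite eqn_leq rank_leq_row /=.
by have := mxrankS XiJ; rewrite (eqP Xifree).
Qed.

(** The rows of [Xi] span the tangent hyperplane at the smooth point [x]; it contains [x] because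
    [x] is on the quartic. *)
Lemma exists_tangent_basis (x : 'rV[k]_n.+2) : quartic_form F idk x x x x = 0 ->
  (exists j, quartic_form F idk x x x (delta_mx 0 j) != 0) ->
  exists (Xi : 'M[k]_(n.+1, n.+2)) (e : 'rV[k]_n.+1),
    [/\ row_free Xi, e *m Xi = x & forall l, quartic_form F idk x x x (row l Xi) = 0].
Proof.
move=> hx [j hj]; have sM := quartic_form_sym4 F idk.
pose g : 'cV_n.+2 := \col_i quartic_form F idk x x x (delta_mx 0 i).
have gE v : quartic_form F idk x x x v = (v *m g) 0 0.
  rewrite -(form_rot sM) -{1}[v]mulmx1 form_sum1 // mxE; apply: eq_bigr => i _.
  by rewrite mxE row1 (form_rot sM).
have g0 : g != 0 by apply: contraNneq hj => g0; have := congr1 (fun c : 'cV_n.+2 => c j 0) g0;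
  rewrite !mxE => ->.
have rg : \rank g = 1%N.
  apply/eqP; rewrite eqn_leq rank_leq_col lt0n mxrank_eq0 //.
have rK : \rank (kermx g) = n.+1 by rewrite mxrank_ker rg subn1.
have ex_base (A : 'M[k]_n.+2) r : \rank A = r ->
    exists Xi : 'M[k]_(r, n.+2), row_free Xi /\ (Xi :=: A)%MS.
  by move=> <-; exists (row_base A); split; [exact: row_base_free|exact: eq_row_base].
have [Xi [fXi XiK]] := ex_base _ _ rK.
have xXi : (x <= Xi)%MS.
  rewrite XiK; apply/sub_kermxP; apply/rowP => i; rewrite ord1 -gE hx mxE //.
have [e he] := submxP xXi; exists Xi, e; split=> // l.
have : (row l Xi <= kermx g)%MS by rewrite -XiK row_sub.
by move/sub_kermxP; rewrite gE => ->; rewrite mxE.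
Qed.

End Deformation.

(** * Parametrizations by residual points *)

Section Residual.
Variables (R : comNzRingType) (V : lmodType R) (M : V -> V -> V -> V -> R).
Hypothesis symM : sym4 M.
Implicit Types (a b c d e P U v w z : V) (s t : R).

Local Notation MD := (sym4D symM).
Local Notation MZ := (sym4Z symM).
Local Notation M12 := (sym4_12 symM).
Local Notation M23 := (sym4_23 symM).
Local Notation M34 := (sym4_34 symM).

Lemma form_lin1 s a t b c d e : M (s *: a + t *: b) c d e = s * M a c d e + t * M b c d e.
Proof. by rewrite MD !MZ. Qed.

Lemma form_lin2 s a t b c d e : M c (s *: a + t *: b) d e = s * M c a d e + t * M c b d e.
Proof. by rewrite M12 form_lin1 !(M12 _ c). Qed.

Lemma form_lin3 s a t b c d e : M c d (s *: a + t *: b) e = s * M c d a e + t * M c d b e.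
Proof. by rewrite M23 form_lin2 !(M23 c _ d). Qed.

Lemma form_lin4 s a t b c d e : M c d e (s *: a + t *: b) = s * M c d e a + t * M c d e b.
Proof. by rewrite M34 form_lin3 !(M34 c d _ e). Qed.

Lemma form_scale2 t b c d e : M c (t *: b) d e = t * M c b d e.
Proof. by rewrite M12 MZ M12. Qed.

Lemma form_scale3 t b c d e : M c d (t *: b) e = t * M c d b e.
Proof. by rewrite M23 form_scale2 M23. Qed.

Lemma form_scale4 t b c d e : M c d e (t *: b) = t * M c d e b.
Proof. by rewrite M34 form_scale3 M34. Qed.

Lemma form_lin_square34 s a t b v w : M v w (s *: a + t *: b) (s *: a + t *: b) =
  s ^+ 2 * M v w a a + 2 * s * t * M v w a b + t ^+ 2 * M v w b b.
Proof. by rewrite form_lin3 !form_lin4 (M34 v w b a); ring. Qed.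

Lemma form_lin_quart s a t b :
  M (s *: a + t *: b) (s *: a + t *: b) (s *: a + t *: b) (s *: a + t *: b) =
  s ^+ 4 * M a a a a + 4 * s ^+ 3 * t * M a a a b + 6 * s ^+ 2 * t ^+ 2 * M a a b b
  + 4 * s * t ^+ 3 * M a b b b + t ^+ 4 * M b b b b.
Proof.
rewrite form_lin1 !form_lin2 !form_lin3 !form_lin4.
rewrite !(M12 b a) !(M23 _ b a) !(M12 b a) !(M34 _ _ b a) !(M23 _ b a) !(M12 b a); ring.
Qed.

(* [z] is [b] moved along [c] into the tangent hyperplane at [P]; [v] is the second
   point of the quadric [M P P v v = 0] on the line joining its point [U] to [z]; the line
   through [P] and [v] then meets the quartic three times at [P] and once at [residual]. *)
Definition residual_z P b c := (M P P P c) *: b + (- M P P P b) *: c.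

Definition residual_v P U b c :=
  let z := residual_z P b c in (M P P z z) *: U + (- (2 * M P P U z)) *: z.

Definition residual P U b c :=
  let v := residual_v P U b c in (M v v v v) *: P + (- (4 * M P v v v)) *: v.

Definition residual_coef P U b c :=
  let v := residual_v P U b c in
  - (4 * M P v v v) * (- (2 * M P P U (residual_z P b c)) * M P P P c).

(** Since PPPP, PPPv and PPvv vanish, the quartic at s P + t v is t^3 (4 s M P v v v + t M v v v v);
    the coefficients in [residual] are the root of the linear factor. *)
Lemma residual_on_quartic P U b c :
  M P P P P = 0 -> M P P P U = 0 -> M P P U U = 0 ->
  let y := residual P U b c in M y y y y = 0.
Proof.
move=> h0 h1 h2 /=; rewrite /residual /=.
set v := residual_v P U b c.
have e1 : M P P P v = 0.
  have ez : M P P P (residual_z P b c) = 0 by rewrite /residual_z form_lin4; ring.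
  by rewrite /v /residual_v form_lin4 h1 ez; ring.
have e2 : M P P v v = 0.
  by rewrite /v /residual_v form_lin_square34 h2; ring.
clearbody v; rewrite form_lin_quart h0 e1 e2; ring.
Qed.

(* A [b] that is to first order a residual point of [P] is to first order a multiple of
   its own image; this computes the differential of the parametrization. *)
Lemma residual_deform (eps : R) P U b c (e1 e2 e3 : R) :
  M P P P b = eps * e1 -> M P P b b = eps * e2 -> M b b b b = eps * e3 ->
  exists w, residual P U b c = residual_coef P U b c *: b + eps *: w.
Proof.
move=> h1 h2 h3; rewrite /residual /residual_coef /residual_v.
set z := residual_z P b c; set g := M P P P c.
have ez : z = g *: b + (eps * - e1) *: c by rewrite /z /residual_z h1 mulrN.
have [f1 ->] : exists f1, M P P z z = eps * f1.
  exists (g ^+ 2 * e2 + 2 * g * - e1 * M P P b c + eps * e1 ^+ 2 * M P P c c).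
  by rewrite ez form_lin_square34 h2; ring.
move: (2 * _) => h; set v := _ *: U + _ *: z.
pose w1 := f1 *: U + (h * e1) *: c.
have ev : v = (- h * g) *: b + eps *: w1.
  rewrite /v ez /w1 !scalerDr !scalerA addrCA; congr (_ + (_ *: U + _ *: c)); ring.
have [f2 ->] : exists f2, M v v v v = eps * f2.
  exists ((- h * g) ^+ 4 * e3 + 4 * (- h * g) ^+ 3 * M b b b w1
    + 6 * (- h * g) ^+ 2 * eps * M b b w1 w1
    + 4 * (- h * g) * eps ^+ 2 * M b w1 w1 w1 + eps ^+ 3 * M w1 w1 w1 w1).
  by rewrite ev form_lin_quart h3; ring.
move: (4 * _) => q; exists (f2 *: P + (- q) *: w1).
rewrite [in LHS]ev !scalerDr !scalerA addrCA; congr (_ + (_ + (_ *: U + _ *: c))); ring.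
Qed.

(** The right-hand side is nonzero under the open conditions of a good point, with [u1] as [U]; it
    is the factor by which the parametrization multiplies [x]. *)
Lemma residual_at P U b c : M P P P b = 0 -> M P P b b = 0 ->
  residual_coef P U b c = - (64 * M P P P c ^+ 8 * M P P U b ^+ 4 * M P b b b).
Proof.
move=> h1 h2; rewrite /residual_coef /residual_v.
have ez : residual_z P b c = M P P P c *: b by rewrite /residual_z h1 oppr0 scale0r addr0.
rewrite !ez !form_scale4 !form_scale3 h2 !mulr0 scale0r add0r scalerA.
rewrite !form_scale4 !form_scale3 !form_scale2; ring.
Qed.

End Residual.

Section Constructions.
Variable k : fieldType.

Lemma quartic_form_map (R S : comNzRingType) N (F : {mpoly k[N]})
    (psi : {rmorphism k -> R}) (phi : {rmorphism R -> S}) (chi : {rmorphism k -> S}) :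
  (forall c, phi (psi c) = chi c) -> forall a b c d,
  phi (quartic_form F psi a b c d) =
  quartic_form F chi (map_mx phi a) (map_mx phi b) (map_mx phi c) (map_mx phi d).
Proof.
move=> h a b c d; rewrite tensor_form_map /quartic_form /tensor_form.
by do 4! (apply: eq_bigr => ? _); rewrite h.
Qed.

Section Residual_map.
Variables (R S : comNzRingType) (N : nat) (F : {mpoly k[N]}).
Variables (psi : {rmorphism k -> R}) (phi : {rmorphism R -> S}) (chi : {rmorphism k -> S}).
Hypothesis phi_psi : forall c, phi (psi c) = chi c.
Variables P U b c : 'rV[R]_N.

Let Q := quartic_form F psi.
Let Q' := quartic_form F chi.
Let mapE := quartic_form_map F phi_psi.

Lemma residual_z_map : map_mx phi (residual_z Q P b c) =
  residual_z Q' (map_mx phi P) (map_mx phi b) (map_mx phi c).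
Proof. by rewrite /residual_z map_mxD !map_mxZ rmorphN !mapE. Qed.

Lemma residual_v_map : map_mx phi (residual_v Q P U b c) =
  residual_v Q' (map_mx phi P) (map_mx phi U) (map_mx phi b) (map_mx phi c).
Proof.
by rewrite /residual_v map_mxD !map_mxZ rmorphN rmorphM rmorph_nat !mapE residual_z_map.
Qed.

Lemma residual_map : map_mx phi (residual Q P U b c) =
  residual Q' (map_mx phi P) (map_mx phi U) (map_mx phi b) (map_mx phi c).
Proof.
by rewrite /residual map_mxD !map_mxZ rmorphN rmorphM rmorph_nat !mapE residual_v_map.
Qed.

Lemma residual_coef_map : phi (residual_coef Q P U b c) =
  residual_coef Q' (map_mx phi P) (map_mx phi U) (map_mx phi b) (map_mx phi c).
Proof.
by rewrite /residual_coef !(rmorphM, rmorphN) !rmorph_nat !mapE residual_v_map residual_z_map.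
Qed.

End Residual_map.

Section Homogeneity.
Variables (n N : nat) (F : {mpoly k[N]}).
Let R := {mpoly k[n]}.
Let Q := quartic_form F (@mpolyC n k).
Definition row_homog d (a : 'rV[{mpoly k[n]}]_N) := forall i, a 0 i \is d.-homog.

Lemma row_homogD d a b : row_homog d a -> row_homog d b -> row_homog d (a + b).
Proof. by move=> ha hb i; rewrite mxE rpredD. Qed.

Lemma row_homogZ d d' (s : R) a : s \is d.-homog -> row_homog d' a -> row_homog (d + d') (s *: a).
Proof. by move=> hs ha i; rewrite mxE dhomogM. Qed.

Lemma form_homog da db dc dd a b c d :
  row_homog da a -> row_homog db b -> row_homog dc c -> row_homog dd d ->
  Q a b c d \is (da + db + dc + dd).-homog.
Proof.
move=> ha hb hc hd; rewrite /Q /quartic_form /tensor_form.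
do 4! (apply: rpred_sum => ? _); rewrite mul_mpolyC; apply: dhomogZ.
by apply: dhomogM => //; apply: dhomogM => //; apply: dhomogM.
Qed.

Lemma dhomogMnat d m (s : R) : s \is d.-homog -> m%:R * s \is d.-homog.
Proof. by move=> hs; rewrite mulr_natl rpredMn. Qed.

(** Degrees: z has 3 + 1 = 4, v has 10 = 6 + 4, and the residual point has 40 + 1 = 31 + 10 = 41. *)
Lemma residual_homog P U b c : row_homog 1 P -> row_homog 0 U -> row_homog 1 b ->
  row_homog 0 c -> row_homog 41 (residual Q P U b c).
Proof.
move=> hP hU hb hc.
have hz : row_homog 4 (residual_z Q P b c).
  apply: row_homogD; first exact: (row_homogZ (form_homog hP hP hP hc) hb).
  by apply: (@row_homogZ 4 0) => //; rewrite rpredN; apply: (form_homog hP hP hP hb).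
have hv : row_homog 10 (residual_v Q P U b c).
  apply: row_homogD; first exact: (row_homogZ (form_homog hP hP hz hz) hU).
  apply: (@row_homogZ 6 4) => //; rewrite rpredN; apply: dhomogMnat.
  exact: (form_homog hP hP hU hz).
apply: row_homogD; first exact: (row_homogZ (form_homog hv hv hv hv) hP).
apply: (@row_homogZ 31 10) => //; rewrite rpredN; apply: dhomogMnat.
exact: (form_homog hP hv hv hv).
Qed.

Lemma row_homog_const (a : 'rV[k]_N) : row_homog 0 (map_mx (@mpolyC n k) a).
Proof.
by move=> i; rewrite mxE; apply/dhomogP => m; rewrite msuppC; case: eqP => // _; rewrite inE =>
  /eqP->; rewrite /= mdeg0.
Qed.

Definition var_row : 'rV[{mpoly k[n]}]_n := \row_i 'X_i.

Lemma row_homog_var (A : 'M[k]_(n, N)) : row_homog 1 (var_row *m map_mx (@mpolyC n k) A).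
Proof.
move=> i; rewrite mxE; apply: rpred_sum => j _; rewrite !mxE mulrC mul_mpolyC.
by apply: dhomogZ; rewrite -[_ \is _]/(_ \is 1.-homog) dhomogX /= mdeg1.
Qed.

End Homogeneity.

Lemma curve_eval_var_row n p (e : 'rV[k]_n) l (A : 'M[k]_(n, p)) :
  map_mx (curve_eval (e 0) (fun i => (i == l)%:R)) (var_row n *m map_mx (@mpolyC n k) A) =
  map_mx polyC (e *m A) + 'X *: map_mx polyC (row l A).
Proof.
apply/rowP => j; rewrite !mxE rmorph_sum /=.
under eq_bigr => i _ do
  rewrite !mxE rmorphM /= curve_evalX curve_evalC mulrDl.
rewrite big_split /= rmorph_sum /=; congr (_ + _).
  by apply: eq_bigr => i _; rewrite polyCM.
rewrite (bigD1 l) //= eqxx big1 ?addr0 ?mul1r //.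
by move=> i /negPf ->; rewrite polyC0 !mul0r.
Qed.

Lemma curve_eval_const n p (e a : 'I_n -> k) (v : 'rV[k]_p) :
  map_mx (curve_eval e a) (map_mx (@mpolyC n k) v) = map_mx polyC v.
Proof. by apply/rowP => j; rewrite !mxE curve_evalC. Qed.

End Constructions.

(** * Differentials of the two parametrizations *)

Section FirstOrder.
Variables (R : comNzRingType) (V : lmodType R) (M : V -> V -> V -> V -> R).
Hypothesis symM : sym4 M.
Variables (P pi x xi : V) (t : R).

Lemma form31_first_order : exists r,
  M (P + t *: pi) (P + t *: pi) (P + t *: pi) (x + t *: xi) =
  M P P P x + t * (M P P P xi + 3 * M P P pi x) + t ^+ 2 * r.
Proof.
exists (3 * M P P pi xi + 3 * M P pi pi x + t * (3 * M P pi pi xi + M pi pi pi x)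
  + t ^+ 2 * M pi pi pi xi).
by rewrite (form_cube symM) !(form_comb4 symM); ring.
Qed.

Lemma form22_first_order : exists r,
  M (P + t *: pi) (P + t *: pi) (x + t *: xi) (x + t *: xi) =
  M P P x x + t * (2 * M P P x xi + 2 * M P pi x x) + t ^+ 2 * r.
Proof.
exists (M P P xi xi + 4 * M P pi x xi + 2 * t * M P pi xi xi
  + M pi pi x x + 2 * t * M pi pi x xi + t ^+ 2 * M pi pi xi xi).
rewrite (form_square symM) !(form_comb3 symM) !(form_comb4 symM).
by rewrite !(sym4_34 symM _ _ xi x); ring.
Qed.

Lemma form4_first_order : exists r,
  M (x + t *: xi) (x + t *: xi) (x + t *: xi) (x + t *: xi) =
  M x x x x + t * (4 * M x x x xi) + t ^+ 2 * r.
Proof.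
exists (6 * M x x xi xi + 4 * t * M x xi xi xi + t ^+ 2 * M xi xi xi xi).
by rewrite (form_quart symM); ring.
Qed.

End FirstOrder.

(** When M U U vanishes, the quartic at s b + t U is s^3 (s M b b b b + 4 t M U b b b): this is its
    root on the line joining [b] to [U]. *)
Definition linear_residual (R : comNzRingType) (V : lmodType R)
    (M : V -> V -> V -> V -> R) (U b : V) :=
  (4 * M U b b b) *: b + (- M b b b b) *: U.

Lemma linear_residual_on_quartic (R : comNzRingType) (V : lmodType R)
    (M : V -> V -> V -> V -> R) (U b : V) : sym4 M ->
  (forall a a', M U U a a' = 0) ->
  let y := linear_residual M U b in M y y y y = 0.
Proof.
move=> symM hU /=; rewrite /linear_residual (form_lin_quart symM).
rewrite !(fun c d => sym4_12 symM b U c d, fun a d => sym4_23 symM a b U d,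
  fun a c => sym4_34 symM a c b U) !hU; ring.
Qed.

Lemma linear_residual_map (k : fieldType) (R S : comNzRingType) N (F : {mpoly k[N]})
    (psi : {rmorphism k -> R}) (phi : {rmorphism R -> S}) (chi : {rmorphism k -> S})
    (U b : 'rV[R]_N) : (forall c, phi (psi c) = chi c) ->
  map_mx phi (linear_residual (quartic_form F psi) U b) =
  linear_residual (quartic_form F chi) (map_mx phi U) (map_mx phi b).
Proof.
move=> h; rewrite /linear_residual map_mxD !map_mxZ rmorphN rmorphM rmorph_nat.
by rewrite !(quartic_form_map F h).
Qed.

Section Constructions.
Variable k : fieldType.
Hypothesis k0 : [pchar k] =i pred0.
Variables (n : nat) (F : {mpoly k[n.+2]}).
Hypotheses (Fh : F \is 4.-homog) (Fp : prime_elt F).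

Local Notation idk := (idfun : {rmorphism k -> k}).
Local Notation cst := (map_mx (polyC : k -> {poly k})).
Local Notation Q := (quartic_form F idk).
Local Notation QP := (quartic_form F (polyC : {rmorphism k -> {poly k}})).
Local Notation QM := (quartic_form F (@mpolyC n.+1 k : {rmorphism k -> {mpoly k[n.+1]}})).

Let symQ : sym4 Q := quartic_form_sym4 F idk.
Let symQP : sym4 QP := quartic_form_sym4 F _.
Let symQM : sym4 QM := quartic_form_sym4 F _.

Local Notation exp := (form_comb1 symQ, form_comb2 symQ, form_comb3 symQ, form_comb4 symQ).
Local Notation srt x y := (fun c d => sym4_12 symQ x y c d,
  fun a d => sym4_23 symQ a x y d, fun a b => sym4_34 symQ a b x y).

Lemma quartic_form_cst a b c d : QP (cst a) (cst b) (cst c) (cst d) = (Q a b c d)%:P.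
Proof. by rewrite -(@quartic_form_map k _ _ _ F idk polyC polyC). Qed.

Lemma horner_cst s p (a : 'rV[k]_p) : map_mx (horner_eval s) (cst a) = a.
Proof. by apply/rowP => i; rewrite !mxE /horner_eval hornerC. Qed.

Lemma horner_line s p (a b : 'rV[k]_p) :
  map_mx (horner_eval s) (cst a + 'X *: cst b) = a + s *: b.
Proof.
by apply/rowP => i; rewrite !mxE /horner_eval hornerD hornerM hornerX !hornerC.
Qed.

Lemma quartic_form_horner s (a b c d : 'rV[{poly k}]_n.+2) : (QP a b c d).[s] =
  Q (map_mx (horner_eval s) a) (map_mx (horner_eval s) b)
    (map_mx (horner_eval s) c) (map_mx (horner_eval s) d).
Proof.
by apply: (@quartic_form_map k _ _ _ F polyC (horner_eval s) idk) => x; apply: hornerC.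
Qed.

Lemma quartic_form_mcst a b c d :
  QM (map_mx (@mpolyC n.+1 k) a) (map_mx (@mpolyC n.+1 k) b)
     (map_mx (@mpolyC n.+1 k) c) (map_mx (@mpolyC n.+1 k) d) = (Q a b c d)%:MP.
Proof. by rewrite -(@quartic_form_map k _ _ _ F idk (@mpolyC n.+1 k) (@mpolyC n.+1 k)). Qed.

Lemma form_last_linear a b c v : Q a b c v = (v *m \col_i Q a b c (delta_mx 0 i)) 0 0.
Proof.
rewrite -(form_rot symQ) -{1}[v]mulmx1 form_sum1 // mxE; apply: eq_bigr => i _.
by rewrite mxE row1 (form_rot symQ).
Qed.

Lemma form_neq0_basis a b c v : Q a b c v != 0 -> exists j, Q a b c (delta_mx 0 j) != 0.
Proof.
move=> h; apply: NNPP => hn; move/eqP: h; apply.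
rewrite form_last_linear mxE big1 // => i _; rewrite mxE.
suff -> : Q a b c (delta_mx 0 i) = 0 by rewrite mulr0.
by apply/eqP/negPn/negP => hi; apply: hn; exists i.
Qed.

(** The inverse of the projection from [U] onto a hyperplane. The hyperplane is the tangent one at a
    point [x0] of X, where [b] agrees with its residual point to first order, up to a factor. *)
Lemma unirational_of_linear_direction (U : 'rV[k]_n.+2) :
  (forall x y, Q U U x y = 0) -> (exists x, Q U x x x != 0) -> unirational_hypersurface F.
Proof.
move=> hU [x hx].
have c4 : (4 : k) != 0 := char0_natf_neq0 k0 (isT : (0 < 4)%N).
(* Moving [x] along [U] by [t] puts it on the quartic, which is affine in that direction. *)
pose t := - Q x x x x / (4 * Q U x x x).
have [x0 [e1 e2]] : exists x0, Q U x0 x0 x0 = Q U x x x /\ Q x0 x0 x0 x0 = 0.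
  exists (x + t *: U); split.
    by rewrite !exp !(srt x U) !hU; ring.
  rewrite (form_quart symQ) !(srt x U) !hU /t.
  by field; rewrite hx.
rewrite -{}e1 in hx => {t x}.
have dx : Q x0 x0 x0 U != 0 by rewrite -(form_rot symQ).
have [j hj] := form_neq0_basis dx.
have [Xi [e [fXi eXi hXi]]] := exists_tangent_basis e2 (ex_intro _ j hj).
pose b := var_row k n.+1 *m map_mx (@mpolyC n.+1 k) Xi.
pose Uc := map_mx (@mpolyC n.+1 k) U.
have hUR a a' : QM Uc Uc a a' = 0.
  rewrite -[a]mulmx1 -[a']mulmx1 (form_rot symQM) (form_rot symQM) form_sum1 //.
  rewrite big1 // => i _; rewrite (form_rot symQM) form_sum1 // big1 ?mulr0 // => i' _.
  rewrite !row1 -!(map_delta_mx (@mpolyC n.+1 k)) quartic_form_mcst.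
  by rewrite !(form_rot symQ _ _ U) hU mpolyC0 mulr0.
pose G := linear_residual QM Uc b.
have hb : row_homog 1 b by apply: row_homog_var.
have hUc : row_homog 0 Uc by apply: row_homog_const.
apply: (@unirational_of_deformation k k0 n F Fh Fp x0 Xi e G 4 (4 * Q U x0 x0 x0) j) => //.
- apply: row_homogD; first by apply: (@row_homogZ k _ _ 3 1 _ _ _ hb); apply: dhomogMnat;
    apply: (form_homog _ hUc hb hb hb).
  by apply: (@row_homogZ k _ _ 4 0 _ _ _ hUc); rewrite rpredN; apply: (form_homog _ hb hb hb hb).
- exact: linear_residual_on_quartic.
- by rewrite mulf_neq0.
move=> l; pose bs := cst x0 + 'X *: cst (row l Xi).
have [r hr] := form4_first_order symQP (cst x0) (cst (row l Xi)) 'X.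
exists (4 * QP (cst U) bs bs bs), (- r *: cst U); split.
  rewrite -horner_coef0 hornerM quartic_form_horner horner_cst horner_line scale0r addr0.
  by rewrite -polyC_natr hornerC.
rewrite (linear_residual_map _ _ _ (@curve_evalC k n.+1 _ _)).
rewrite curve_eval_var_row curve_eval_const eXi -/bs /linear_residual hr !quartic_form_cst.
by rewrite e2 hXi scalerA mulr0 polyC0 mulr0 !add0r mulrN.
Qed.

(** The point [b] runs over the tangent hyperplane at [x], while [P] follows it linearly within the
    isotropic space by the map [T]. [T] is chosen so that [b] remains to first order a residual
    point of [P], and [residual_deform] then gives the differential. *)
Lemma unirational_of_good_point p (L : 'M[k]_(p, n.+2)) :
  (forall a b c d, Q (a *m L) (b *m L) (c *m L) (d *m L) = 0) ->
  good_point Q (fun v => exists u, v = u *m L) -> unirational_hypersurface F.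
Proof.
move=> isoL [P [U1 [U2 [x [c]]]]] [[[p' eP] [u1 eU1] [u2 eU2]]].
case=> [[hc h1 h2 h3]] [h4 h5 h6 h7].
have three : (3 : k) != 0 := char0_natf_neq0 k0 (isT : (0 < 3)%N).
have dx : Q x x x P != 0 by rewrite -(form_rot symQ).
have [j hj] := form_neq0_basis dx.
have [Xi [e [fXi eXi hXi]]] := exists_tangent_basis h3 (ex_intro _ j hj).
have x0 : x != 0 by apply: contraNneq h7 => ->; rewrite -(form_rot symQ) (form_zero1 symQ).
have [i0 xi0] : exists i, x 0 i != 0.
  apply: NNPP => hn; move/eqP: x0; apply; apply/rowP => i; rewrite mxE.
  by apply/eqP/negPn/negP => hi; apply: hn; exists i.
pose al := Q P P U1 x; pose be := Q P U2 x x.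
(* [fA] and [fB] are the components of the motion of [P] along [U1] and [U2]. They solve the two
   linear equations of [defP], a triangular system because M P P U2 x = 0; [fL] only serves to send
   [x] to [P]. *)
pose fA v := - Q P P P v / (3 * al).
pose fB v := - (Q P P x v + fA v * Q P U1 x x) / be.
pose fL (v : 'rV[k]_n.+2) := v 0 i0 / x 0 i0.
have [A [B [La [hA hB hL]]]] : exists A B La : 'cV[k]_n.+2,
    [/\ forall v, (v *m A) 0 0 = fA v, forall v, (v *m B) 0 0 = fB v
      & forall v, (v *m La) 0 0 = fL v].
  exists (\col_i fA (delta_mx 0 i)), (\col_i fB (delta_mx 0 i)), (\col_i fL (delta_mx 0 i)).
  have hA v : (v *m \col_i fA (delta_mx 0 i)) 0 0 = fA v.
    rewrite /fA (form_last_linear _ _ _ v) !mxE mulNr mulr_suml -sumrN.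
    by apply: eq_bigr => i _; rewrite !mxE mulNr mulrN mulrA.
  split=> // v.
    rewrite /fB -hA (form_last_linear _ _ _ v) !mxE mulr_suml -big_split /= -sumrN mulr_suml.
    by apply: eq_bigr => i _; rewrite !mxE; ring.
  rewrite /fL mxE {2}(row_sum_delta v) summxE mulr_suml.
  by apply: eq_bigr => i _; rewrite !mxE mulrA.
have fAx : fA x = 0 by rewrite /fA h1 oppr0 mul0r.
have fBx : fB x = 0 by rewrite /fB fAx h2 mul0r addr0 oppr0 mul0r.
have fLx : fL x = 1 by rewrite /fL mulfV.
pose T := A *m u1 + B *m u2 + La *m p'.
have T1 v : v *m T = fA v *: u1 + fB v *: u2 + fL v *: p'.
  rewrite /T !mulmxDr !mulmxA [v *m A]mx11_scalar [v *m B]mx11_scalar [v *m La]mx11_scalar.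
  by rewrite hA hB hL !mul_scalar_mx.
have eT : e *m (Xi *m T *m L) = P.
  by rewrite !mulmxA eXi T1 fAx fBx fLx !scale0r scale1r !add0r eP.
have defP l : 3 * Q P P (row l (Xi *m T *m L)) x + Q P P P (row l Xi) = 0 /\
    2 * Q P P x (row l Xi) + 2 * Q P (row l (Xi *m T *m L)) x x = 0.
  rewrite !row_mul T1 !mulmxDl -!scalemxAl -eU1 -eU2 -eP.
  move: (row l Xi) => v; split.
    rewrite (form_comb3 symQ) (form_lin3 symQ) h1 h5 /fA -/al.
    by field; rewrite three h4.
  rewrite (form_comb2 symQ) (form_lin2 symQ) h2 /fB -/be.
  by field; rewrite h6.
pose Pm := var_row k n.+1 *m map_mx (@mpolyC n.+1 k) (Xi *m T *m L).
pose b := var_row k n.+1 *m map_mx (@mpolyC n.+1 k) Xi.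
pose Um := map_mx (@mpolyC n.+1 k) U1; pose cm := map_mx (@mpolyC n.+1 k) c.
have isoM : forall a b c d, QM (a *m map_mx (@mpolyC n.+1 k) L) (b *m map_mx (@mpolyC n.+1 k) L)
    (c *m map_mx (@mpolyC n.+1 k) L) (d *m map_mx (@mpolyC n.+1 k) L) = 0.
  apply: form_isotropic => // i1 i2 i3 i4.
  by rewrite -!map_row quartic_form_mcst !rowE isoL mpolyC0.
have ePm : Pm = var_row k n.+1 *m map_mx (@mpolyC n.+1 k) (Xi *m T) *m map_mx (@mpolyC n.+1 k) L.
  by rewrite /Pm map_mxM mulmxA.
have eUm : Um = map_mx (@mpolyC n.+1 k) u1 *m map_mx (@mpolyC n.+1 k) L.
  by rewrite /Um eU1 map_mxM.
pose G := residual QM Pm Um b cm.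
apply: (@unirational_of_deformation k k0 n F Fh Fp x Xi e G 41 (residual_coef Q P U1 x c) j) => //.
- by apply: residual_homog; try exact: row_homog_var; exact: row_homog_const.
- by apply: residual_on_quartic => //; rewrite ePm ?eUm isoM.
- rewrite (residual_at symQ) // oppr_eq0 !mulf_neq0 ?expf_neq0 //.
  exact: (char0_natf_neq0 k0 (isT : (0 < 64)%N)).
move=> l; have [d1 d2] := defP l.
pose Ps := cst P + 'X *: cst (row l (Xi *m T *m L)); pose bs := cst x + 'X *: cst (row l Xi).
have [r1 hr1] :=
  form31_first_order symQP (cst P) (cst (row l (Xi *m T *m L))) (cst x) (cst (row l Xi)) 'X.
have [r2 hr2] :=
  form22_first_order symQP (cst P) (cst (row l (Xi *m T *m L))) (cst x) (cst (row l Xi)) 'X.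
have [r3 hr3] := form4_first_order symQP (cst x) (cst (row l Xi)) 'X.
have natC m : (m%:R : {poly k}) = (m%:R)%:P by rewrite polyC_natr.
have E1 : QP Ps Ps Ps bs = 'X^2 * r1.
  rewrite hr1 !quartic_form_cst h1 natC -polyCM -polyCD [_ + _ * Q P P _ x]addrC d1.
  by rewrite polyC0 mulr0 !add0r.
have E2 : QP Ps Ps bs bs = 'X^2 * r2.
  by rewrite hr2 !quartic_form_cst h2 natC -!polyCM -polyCD d2 polyC0 mulr0 !add0r.
have E3 : QP bs bs bs bs = 'X^2 * r3.
  by rewrite hr3 !quartic_form_cst h3 hXi polyC0 !mulr0 !add0r.
have [w hw] := residual_deform symQP (cst U1) (cst c) E1 E2 E3.
exists (residual_coef QP Ps (cst U1) bs (cst c)), w; split.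
  rewrite -horner_coef0.
  have h0 := @residual_coef_map k {poly k} k n.+2 F polyC (horner_eval 0) idk
    (fun z => hornerC z 0) Ps (cst U1) bs (cst c).
  by rewrite !horner_cst !horner_line !scale0r !addr0 in h0.
rewrite -hw /G (residual_map _ (@curve_evalC k n.+1 _ _)).
by rewrite !curve_eval_var_row !curve_eval_const eXi eT.
Qed.

End Constructions.

(** * The cubics cut out on the linear space when there are no good points *)

Section Aux.
Variable k : fieldType.
Hypothesis k0 : [pchar k] =i pred0.

(* The vanishing order of [o'] at [0] is one less than that of [o]. *)
Lemma poly_ode_eq0 (o e r : {poly k}) :
  o`_0 = 0 -> e`_0 != 0 -> e * o^`() = o * r -> o = 0.
Proof.
move=> o0 e0 E; apply/polyP => i; rewrite coef0.
elim/ltn_ind: i => -[//|i] ih.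
have : (e * o^`())`_i = 0.
  by rewrite E coefM big1 // => j _; rewrite ih ?mul0r // ltnS -ltnS.
rewrite coefM big_ord_recl /= subn0 big1 ?addr0.
  rewrite coef_deriv => /eqP; rewrite mulf_eq0 (negPf e0) /= -mulr_natr mulf_eq0.
  by rewrite (negPf (char0_natf_neq0 k0 (ltn0Sn i))) orbF => /eqP.
move=> j _; rewrite coef_deriv ih ?mul0rn ?mulr0 //= /bump /=.
by have := ltn_ord j; lia.
Qed.

Lemma mpoly_neq0_row n (p : {mpoly k[n]}) : p != 0 -> exists v : 'rV[k]_n, p.@[v 0] != 0.
Proof.
case/(mpoly_neq0_eval k0) => v hv; exists (\row_i v i).
by rewrite (meval_eq (v2 := v)) // => i; rewrite mxE.
Qed.

Lemma mpoly_row_eq0 n (p : {mpoly k[n]}) : (forall v : 'rV[k]_n, p.@[v 0] = 0) -> p = 0.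
Proof.
move=> h; apply/eqP/negPn/negP => /mpoly_neq0_row[v].
by rewrite h eqxx.
Qed.

Lemma mpoly_row_ext n (p q : {mpoly k[n]}) :
  (forall v : 'rV[k]_n, p.@[v 0] = q.@[v 0]) -> p = q.
Proof.
move=> h; apply/eqP; rewrite -subr_eq0; apply/eqP; apply: mpoly_row_eq0 => v.
by rewrite mevalB h subrr.
Qed.

(* One point [e] with [V e <> 0] serves for all three roots: substituting
   [U = D + c V] with [D e = 0], the coefficients vanish one after the other. *)
Lemma cubic_relation_proportional n (U V : {mpoly k[n]}) (a0 a1 a2 a3 : k) :
  a3 != 0 -> V != 0 ->
  a3%:MP * U ^+ 3 + a2%:MP * U ^+ 2 * V + a1%:MP * U * V ^+ 2 + a0%:MP * V ^+ 3 = 0 ->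
  exists c, U = c *: V.
Proof.
move=> a30 V0 E; have [e Ve] := mpoly_neq0_row V0.
pose c := U.@[e 0] / V.@[e 0]; exists c; apply/eqP; rewrite -subr_eq0.
set D := U - c *: V; have eU : U = D + c%:MP * V by rewrite /D mul_mpolyC subrK.
have De : D.@[e 0] = 0 by rewrite /D mevalB mevalZ divfK ?subrr.
clearbody D; apply/negPn/negP => D0.
pose b2 := a2 + 3 * a3 * c; pose b1 := a1 + 2 * a2 * c + 3 * a3 * c ^+ 2.
pose b0 := a0 + a1 * c + a2 * c ^+ 2 + a3 * c ^+ 3.
have E0 : a3%:MP * D ^+ 3 + b2%:MP * D ^+ 2 * V + b1%:MP * D * V ^+ 2 + b0%:MP * V ^+ 3 = 0.
  rewrite -E eU /b0 /b1 /b2 !(mpolyCD, mpolyCM, mpolyC_nat, rmorphXn) /=; ring.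
have kill b m : (b%:MP * V ^+ m).@[e 0] = 0 -> b = 0.
  rewrite mevalM mevalC rmorphXn /= => /eqP; rewrite mulf_eq0 => /orP[/eqP//|].
  by rewrite expf_eq0 (negPf Ve) andbF.
have z0 : b0 = 0.
  apply: (kill _ 3); have := congr1 (meval (e 0)) E0; rewrite meval0 !mevalD => <-.
  by rewrite !mevalM De; ring.
have E1 : a3%:MP * D ^+ 2 + b2%:MP * D * V + b1%:MP * V ^+ 2 = 0.
  by apply: (mulfI D0); rewrite mulr0 -E0 z0 mpolyC0; ring.
have z1 : b1 = 0.
  apply: (kill _ 2); have := congr1 (meval (e 0)) E1; rewrite meval0 !mevalD => <-.
  by rewrite !mevalM De; ring.
have E2 : a3%:MP * D + b2%:MP * V ^+ 1 = 0.
  by apply: (mulfI D0); rewrite mulr0 -E1 z1 mpolyC0; ring.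
have z2 : b2 = 0.
  apply: (kill _ 1%N); have := congr1 (meval (e 0)) E2; rewrite meval0 !mevalD => <-.
  by rewrite !mevalM De; ring.
move/eqP: E2; rewrite z2 mpolyC0 mul0r addr0 mulf_eq0 (negPf D0) orbF mpolyC_eq0.
by rewrite (negPf a30).
Qed.

End Aux.

Section CubicSystem.
Variable k : fieldType.
Hypothesis k0 : [pchar k] =i pred0.
Variables (n m : nat) (F : {mpoly k[n.+2]}) (L : 'M[k]_(m, n.+2)).

Local Notation idk := (idfun : {rmorphism k -> k}).
Local Notation cst := (map_mx (polyC : k -> {poly k})).
Local Notation mcst := (map_mx (@mpolyC m k)).
Local Notation Q := (quartic_form F idk).
Local Notation QP := (quartic_form F (polyC : {rmorphism k -> {poly k}})).
Local Notation QM := (quartic_form F (@mpolyC m k : {rmorphism k -> {mpoly k[m]}})).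

Let symQ : sym4 Q := quartic_form_sym4 F idk.
Let symQP : sym4 QP := quartic_form_sym4 F _.

Hypothesis isoL : forall a b c d, Q (a *m L) (b *m L) (c *m L) (d *m L) = 0.

Implicit Types (p q u w a x : 'rV[k]_m) (y c v : 'rV[k]_n.+2).

Definition in_span v := exists u, v = u *m L.
Hypothesis nogood : ~ good_point Q in_span.

Lemma in_span_mul u : in_span (u *m L).
Proof. by exists u. Qed.

Definition generic_pt : 'rV[{mpoly k[m]}]_n.+2 := var_row k m *m mcst L.
Definition cubic_of := locked (fun y => QM generic_pt generic_pt generic_pt (mcst y)).
Definition polar_of :=
  locked (fun u y => QM generic_pt generic_pt (mcst (u *m L)) (mcst y)).

Lemma generic_pt_eval p : map_mx (meval (p 0)) generic_pt = p *m L.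
Proof.
apply/rowP => j; rewrite !mxE rmorph_sum /=; apply: eq_bigr => i _.
by rewrite !mxE mevalM mevalXU mevalC.
Qed.

Lemma mcst_eval p v : map_mx (meval (p 0)) (mcst v) = v.
Proof. by apply/rowP => j; rewrite !mxE mevalC. Qed.

Lemma form_eval p (a b c d : 'rV[{mpoly k[m]}]_n.+2) : (QM a b c d).@[p 0] =
  Q (map_mx (meval (p 0)) a) (map_mx (meval (p 0)) b)
    (map_mx (meval (p 0)) c) (map_mx (meval (p 0)) d).
Proof.
exact: (@quartic_form_map k _ _ _ F (@mpolyC m k) (meval (p 0)) idk (mevalC (p 0))).
Qed.

Lemma cubic_eval p y : (cubic_of y).@[p 0] = Q (p *m L) (p *m L) (p *m L) y.
Proof. by rewrite /cubic_of -lock form_eval !generic_pt_eval mcst_eval. Qed.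

Lemma polar_eval p u y : (polar_of u y).@[p 0] = Q (p *m L) (p *m L) (u *m L) y.
Proof. by rewrite /polar_of -lock form_eval !generic_pt_eval !mcst_eval. Qed.

Lemma cubic_homog y : cubic_of y \is 3.-homog.
Proof.
have hg : row_homog 1 generic_pt by apply: row_homog_var.
rewrite /cubic_of -lock; exact: (form_homog _ hg hg hg (row_homog_const _ _)).
Qed.

Lemma polar_homog u y : polar_of u y \is 2.-homog.
Proof.
have hg : row_homog 1 generic_pt by apply: row_homog_var.
rewrite /polar_of -lock.
exact: (form_homog _ hg hg (row_homog_const _ _) (row_homog_const _ _)).
Qed.

Lemma cubic_lin y c t : cubic_of (y + t *: c) = cubic_of y + t *: cubic_of c.
Proof.
apply: (@mpoly_row_ext k k0 m (cubic_of (y + t *: c)) (cubic_of y + t *: cubic_of c)) => p.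
rewrite (mevalD (p 0) (cubic_of y)) (mevalZ (p 0) t (cubic_of c)).
apply: (etrans (cubic_eval p (y + t *: c))).
apply: (etrans (form_comb4 symQ _ _ _ _ _ _)).
exact: esym (congr2 (fun r s => r + t * s) (cubic_eval p y) (cubic_eval p c)).
Qed.

Lemma deriv_cube P W y : let Ps := cst P + 'X *: cst W in
  (QP Ps Ps Ps (cst y))^`() = 3 * QP Ps Ps (cst W) (cst y).
Proof.
move=> Ps; rewrite /Ps (form_cube symQP) (form_square symQP) !quartic_form_cst.
rewrite -!polyC_natr !(derivD, derivM, derivXn, derivX, derivC) /= !polyC_natr; ring.
Qed.

Lemma deriv_square P W y : let Ps := cst P + 'X *: cst W in
  (QP Ps Ps (cst W) (cst y))^`() = 2 * QP Ps (cst W) (cst W) (cst y).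
Proof.
move=> Ps; rewrite /Ps (form_square symQP) (form_comb1 symQP) !quartic_form_cst.
rewrite -!polyC_natr !(derivD, derivM, derivXn, derivX, derivC) /= !polyC_natr; ring.
Qed.

Lemma horner_span_line s p w : map_mx (horner_eval s) (cst (p *m L) + 'X *: cst (w *m L)) =
  (p + s *: w) *m L.
Proof. by rewrite horner_line mulmxDl scalemxAl. Qed.

Section Pair.
Variables y0 c0 : 'rV[k]_n.+2.

(* The differential of [cubic_of y0 / cubic_of c0] at [p], up to a nonzero factor. *)
Definition omega p u :=
  Q (p *m L) (p *m L) (p *m L) c0 * Q (p *m L) (p *m L) (u *m L) y0
  - Q (p *m L) (p *m L) (p *m L) y0 * Q (p *m L) (p *m L) (u *m L) c0.

(** With v = g(p) y0 - f(p) c0, where f and g are the cubics of [y0] and [c0], [omega p u] is ppuv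
    and [hess p w a] is pwav. *)
Definition hess p w a :=
  Q (p *m L) (p *m L) (p *m L) c0 * Q (p *m L) (w *m L) (a *m L) y0
  - Q (p *m L) (p *m L) (p *m L) y0 * Q (p *m L) (w *m L) (a *m L) c0.

Lemma omega_pt p : omega p p = 0.
Proof. by rewrite /omega mulrC subrr. Qed.

Lemma omega_lin p s a t b : omega p (s *: a + t *: b) = s * omega p a + t * omega p b.
Proof. by rewrite /omega mulmxDl -!scalemxAl !(form_lin3 symQ); ring. Qed.

Lemma no_inflection p w u : omega p w = 0 -> omega p u != 0 -> hess p w w = 0.
Proof.
move=> h hu; apply/eqP/negPn/negP => hw; apply: nogood.
pose v := Q (p *m L) (p *m L) (p *m L) c0 *: y0 + - Q (p *m L) (p *m L) (p *m L) y0 *: c0.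
have vE a b : Q (p *m L) (a *m L) (b *m L) v =
    Q (p *m L) (p *m L) (p *m L) c0 * Q (p *m L) (a *m L) (b *m L) y0
    - Q (p *m L) (p *m L) (p *m L) y0 * Q (p *m L) (a *m L) (b *m L) c0.
  by rewrite /v (form_lin4 symQ) mulNr.
have [c hc] : exists c, Q (p *m L) (p *m L) (p *m L) c != 0.
  have [e|] := eqVneq (Q (p *m L) (p *m L) (p *m L) c0) 0; last by exists c0.
  have [e'|] := eqVneq (Q (p *m L) (p *m L) (p *m L) y0) 0; last by exists y0.
  by move: hu; rewrite /omega e e' !mul0r subrr eqxx.
apply: (@good_point_of_inflection k _ Q symQ k0 in_span _ (p *m L) (w *m L) (u *m L) v c).
- by move=> _ _ _ _ [a1 ->] [a2 ->] [a3 ->] [a4 ->]; apply: isoL.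
- exact: in_span_mul.
- exact: in_span_mul.
- exact: in_span_mul.
- exact: hc.
- by rewrite vE mulrC subrr.
- by rewrite vE.
- by rewrite vE.
- by rewrite vE.
Qed.

(** The expression is [hess p w' w'] for a combination [w'] of [w] and [a] in the kernel of
    [omega p], so [no_inflection] applies as soon as [omega p] is nonzero at [a] or [w]. *)
Lemma hess_omega p w a :
  omega p a ^+ 2 * hess p w w - 2 * omega p a * omega p w * hess p w a
  + omega p w ^+ 2 * hess p a a = 0.
Proof.
pose w' := omega p a *: w + - omega p w *: a.
have e : omega p a ^+ 2 * hess p w w - 2 * omega p a * omega p w * hess p w a
  + omega p w ^+ 2 * hess p a a = hess p w' w'.
  rewrite /hess /w' !mulmxDl -!scalemxAl !(form_lin2 symQ) !(form_lin3 symQ).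
  by rewrite !(sym4_23 symQ _ (a *m L) (w *m L)); ring.
have w'0 : omega p w' = 0.
  by rewrite /w' omega_lin; ring.
rewrite e; have [ea|ha] := eqVneq (omega p a) 0; last exact: no_inflection w'0 ha.
have [ew|hw] := eqVneq (omega p w) 0.
  by rewrite -e ea ew; ring.
by rewrite -e ea (no_inflection ea hw); ring.
Qed.

(* Along the line from [p] to [x], [omega] in the direction of the line satisfies by
   [hess_omega] a linear differential equation and vanishes at [p]. *)
Lemma constant_on_kernel p a x : omega p a != 0 -> Q (p *m L) (p *m L) (p *m L) c0 != 0 ->
  omega p x = 0 ->
  Q (p *m L) (p *m L) (p *m L) c0 * Q (x *m L) (x *m L) (x *m L) y0 =
  Q (p *m L) (p *m L) (p *m L) y0 * Q (x *m L) (x *m L) (x *m L) c0.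
Proof.
move=> ha gp hx; pose w := x - p.
have hw : omega p w = 0.
  by have := omega_lin p 1 x (-1) p; rewrite scale1r scaleN1r -/w omega_pt hx => ->; ring.
pose Ps := cst (p *m L) + 'X *: cst (w *m L); pose W := cst (w *m L); pose A := cst (a *m L).
pose f := QP Ps Ps Ps (cst y0); pose g := QP Ps Ps Ps (cst c0).
pose o := g * QP Ps Ps W (cst y0) - f * QP Ps Ps W (cst c0).
pose e := g * QP Ps Ps A (cst y0) - f * QP Ps Ps A (cst c0).
pose qww := g * QP Ps W W (cst y0) - f * QP Ps W W (cst c0).
pose qwa := g * QP Ps W A (cst y0) - f * QP Ps W A (cst c0).
pose qaa := g * QP Ps A A (cst y0) - f * QP Ps A A (cst c0).
have oE s : o.[s] = omega (p + s *: w) w.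
  by rewrite /o /f /g /W /Ps !(hornerD, hornerN, hornerM) !(quartic_form_horner F s)
    !horner_span_line !horner_cst.
have eE s : e.[s] = omega (p + s *: w) a.
  by rewrite /e /f /g /A /Ps !(hornerD, hornerN, hornerM) !(quartic_form_horner F s)
    !horner_span_line !horner_cst.
have id : e ^+ 2 * qww - 2 * e * o * qwa + o ^+ 2 * qaa = 0.
  apply: (poly_eval_eq0 k0) => s; have := hess_omega (p + s *: w) w a.
  rewrite -oE -eE /hess => <-.
  rewrite -polyC_natr !(hornerD, hornerN, hornerM, horner_exp, hornerC).
  by rewrite /qww /qwa /qaa /f /g /A /W /Ps ?(hornerD, hornerN, hornerM) !(quartic_form_horner F s)
    !horner_span_line !horner_cst.
(* The terms with the derivatives of [f] and [g] cancel, both being 3 times the same product. *)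
have od : o^`() = 2 * qww.
  rewrite /o derivB !derivM /f /g /W /Ps !deriv_cube !deriv_square /qww /f /g /W /Ps; ring.
have o0 : o = 0.
  apply: (poly_ode_eq0 k0 (e := e ^+ 2) (r := 4 * e * qwa - 2 * o * qaa)).
  - by rewrite -horner_coef0 oE scale0r addr0.
  - by rewrite -horner_coef0 horner_exp eE scale0r addr0 expf_neq0.
  - rewrite od -[RHS]addr0 -(mulr0 2) -id; ring.
(* The vanishing of [o] is the vanishing of the Wronskian of [f] and [g] along the line, so f / g is
   constant there; [phi] expresses this without dividing. *)
pose phi := (Q (p *m L) (p *m L) (p *m L) c0)%:P * f - (Q (p *m L) (p *m L) (p *m L) y0)%:P * g.
have phi0 : phi = 0.
  apply: (poly_ode_eq0 k0 (e := g) (r := g^`())).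
  - rewrite -horner_coef0 /phi /f /g /Ps !(hornerD, hornerN, hornerM, hornerC)
      !(quartic_form_horner F 0).
    by rewrite !horner_span_line !horner_cst scale0r addr0; ring.
  - by rewrite -horner_coef0 /g /Ps (quartic_form_horner F 0)
      !horner_span_line horner_cst scale0r addr0.
  - have fg : g * f^`() = f * g^`().
      apply/eqP; rewrite -subr_eq0 /f /g /Ps !deriv_cube -/Ps -/W -/f -/g.
      by apply/eqP; rewrite -[RHS](mulr0 3) -o0 /o; ring.
    rewrite /phi derivB !derivM !derivC !mul0r !add0r mulrBr mulrCA fg; ring.
have := congr1 (horner^~ 1) phi0; rewrite /phi /f /g /Ps horner0.
rewrite !(hornerD, hornerN, hornerM, hornerC) !(quartic_form_horner F 1) !horner_span_line
  !horner_cst.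
have -> : p + 1 *: w = x by rewrite scale1r /w addrC subrK.
by move/eqP; rewrite subr_eq0 => /eqP.
Qed.

End Pair.

End CubicSystem.

(** * Two coprime cubics whose quotient is constant on the kernels of its differential *)

Lemma meval_det (R : comNzRingType) n (v : 'I_n -> R) (a b c d : {mpoly R[n]}) :
  (a * b - c * d).@[v] = a.@[v] * b.@[v] - c.@[v] * d.@[v].
Proof. by rewrite mevalB !mevalM. Qed.

Lemma homog_divides_eq0 (k : fieldType) n d d' (f h : {mpoly k[n]}) :
  f != 0 -> f \is d.-homog -> h \is d'.-homog -> (d' < d)%N -> divides f h -> h = 0.
Proof.
move=> f0 hf hh dd [c e]; apply/eqP/negPn/negP => h0.
have c0 : c != 0 by apply: contraNneq h0 => c0; rewrite e c0 mul0r.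
have sz d1 (p : {mpoly k[n]}) : p != 0 -> p \is d1.-homog -> msize p = d1.+1.
  move=> p0 hp; have := dhomog_uniq p0 hp (dhomog_msize hp).
  by move: p0; rewrite -msize_poly_eq0; move: (mmeasure _ p) => a; lia.
have := msizeM c0 f0; rewrite -e (sz _ _ h0 hh) (sz _ _ f0 hf).
by move: c0; rewrite -msize_poly_eq0; move: (mmeasure _ c) => a; lia.
Qed.

Lemma homog_nonunit (k : fieldType) n d (f : {mpoly k[n]}) :
  f \is d.+1.-homog -> f \isn't a GRing.unit.
Proof.
move=> hf; apply/negP => fU; have := msize_unit fU; rewrite mmeasureE => s1.
have f0 : f != 0 by apply: contraTneq fU => ->; rewrite unitr0.
have := mlead_supp f0; move=> hm; have := dhomog_mf hf hm => /= e.
have := @leq_bigmax_seq _ (msupp f) xpredT (fun m => (mdeg m).+1) _ hm isT.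
by rewrite s1 e.
Qed.

Lemma coprime_not_proportional (k : fieldType) n d (f g : {mpoly k[n]}) (a b : k) :
  g != 0 -> g \is d.+1.-homog -> coprime_elt f g -> b != 0 -> a *: g != b *: f.
Proof.
move=> g0 hg cop b0; apply/eqP => e.
have [[|q s] [sp [u uU eg]]] := ufd_mpoly g0.
  by have := homog_nonunit hg; rewrite eg big_nil mulr1 uU.
have qg : divides q g by rewrite eg big_cons mulrCA; apply/divides_mulr/dividesxx.
apply: (cop q (sp q (mem_head _ _))) => //.
have -> : f = (b^-1 * a) *: g by rewrite -scalerA e scalerA mulVf // scale1r.
by rewrite -mul_mpolyC; apply: divides_mull.
Qed.

Lemma meval_mul_comb (R : comNzRingType) n (v : 'I_n -> R) (a b c d : {mpoly R[n]}) s t :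
  (a * b * (s *: c - t *: d)).@[v] = a.@[v] * b.@[v] * (s * c.@[v] - t * d.@[v]).
Proof. by rewrite !mevalM mevalB !mevalZ. Qed.

Lemma meval_cubic_comb (R : comNzRingType) n (v : 'I_n -> R) (U V : {mpoly R[n]}) a0 a1 a2 a3 :
  (a3%:MP * U ^+ 3 + a2%:MP * U ^+ 2 * V + a1%:MP * U * V ^+ 2 + a0%:MP * V ^+ 3).@[v] =
  a3 * U.@[v] ^+ 3 + a2 * U.@[v] ^+ 2 * V.@[v] + a1 * U.@[v] * V.@[v] ^+ 2 + a0 * V.@[v] ^+ 3.
Proof. by rewrite !mevalD !mevalM !mevalC; ring. Qed.

Section Pencil.
Variables (k : fieldType) (m : nat).
Hypothesis k0 : [pchar k] =i pred0.
Implicit Types (p q u w a x : 'rV[k]_m).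
Variables (f g : {mpoly k[m]}) (Df Dg : 'rV[k]_m -> {mpoly k[m]}).
Variables (Tf Tg : 'rV[k]_m -> 'rV[k]_m -> 'rV[k]_m -> k).
Hypotheses (hf : f \is 3.-homog) (hg : g \is 3.-homog).
Hypotheses (hDf : forall u, Df u \is 2.-homog) (hDg : forall u, Dg u \is 2.-homog).
Hypotheses (fE : forall p, f.@[p 0] = Tf p p p) (gE : forall p, g.@[p 0] = Tg p p p).
Hypotheses (DfE : forall p u, (Df u).@[p 0] = Tf p p u) (DgE : forall p u, (Dg u).@[p 0] = Tg p p u).
Hypothesis Tg_comb : forall s t x p, let y := s *: x + t *: p in
  Tg y y y = s ^+ 3 * Tg x x x + 3 * s ^+ 2 * t * Tg x x p + 3 * s * t ^+ 2 * Tg x p p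
    + t ^+ 3 * Tg p p p.
Local Notation om := (fun p u => Tg p p p * Tf p p u - Tf p p p * Tg p p u).
Hypothesis om_lin : forall p s x t y, om p (s *: x + t *: y) = s * om p x + t * om p y.
Hypothesis constant_on_kernel : forall p a x, om p a != 0 -> Tg p p p != 0 -> om p x = 0 ->
  Tg p p p * Tf x x x = Tf p p p * Tg x x x.
Hypotheses (f0 : f != 0) (g0 : g != 0) (cop : coprime_elt f g).

Definition wronskian u := g * Df u - f * Dg u.

Lemma wronskian_eval p u : (wronskian u).@[p 0] = om p u.
Proof. by rewrite /wronskian meval_det fE gE DfE DgE. Qed.

(** From g Df = f Dg and coprimality, [f] divides the quadric [Df u] and [g] divides [Dg u]; the
    degrees leave only 0. *)
Lemma wronskian_eq0 u : wronskian u = 0 -> Df u = 0 /\ Dg u = 0.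
Proof.
move=> /eqP; rewrite subr_eq0 => /eqP e; have ufd := @ufd_mpoly k m; split.
  apply: (homog_divides_eq0 f0 hf (hDf u)) => //.
  by apply: (coprime_Gauss ufd f0 cop (g := g)); exists (Dg u); rewrite e mulrC.
apply: (homog_divides_eq0 g0 hg (hDg u)) => //.
have cop' : coprime_elt g f by exact: coprime_elt_sym.
by apply: (coprime_Gauss ufd g0 cop'); exists (Df u); rewrite -e mulrC.
Qed.

(** Fix a general [p]. On the kernel of [om p] the quotient f / g is constant, equal to its value at
    [p]. This forces [wronskian x] to be a multiple of [wronskian p] for each [x] in that kernel,
    and a second point [p'] detects the multiple. *)
Lemma pencil_codim2 :
  exists p p', forall x, om p x = 0 -> om p' x = 0 -> Df x = 0 /\ Dg x = 0.
Proof.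
have [a Wa] : exists a, wronskian a != 0.
  apply: NNPP => hn; move/eqP: f0; apply; apply: (mpoly_row_eq0 k0) => p.
  have [|e _] := @wronskian_eq0 p.
    by apply/eqP/negPn/negP => h; apply: hn; exists p.
  by rewrite fE -DfE e meval0.
have [p] := mpoly_neq0_row k0 (mulf_neq0 g0 Wa).
rewrite mevalM mulf_eq0 negb_or gE wronskian_eval => /andP[gp oa].
pose bad := g * wronskian a * (Tf p p p *: g - Tg p p p *: f).
have bad0 : bad != 0.
  rewrite /bad !mulf_neq0 // subr_eq0.
  exact: (coprime_not_proportional (Tf p p p) g0 hg cop gp).
have badE q : bad.@[q 0] != 0 -> [/\ om q a != 0, Tg q q q != 0 &
    Tf p p p * Tg q q q != Tg p p p * Tf q q q].
  rewrite /bad meval_mul_comb wronskian_eval fE gE.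
  by rewrite !mulf_eq0 !negb_or => /andP[/andP[h1 h2] h3]; split=> //; rewrite -subr_eq0.
(* In both kernels f / g would have to take two distinct values at [x]; hence [g], and with it [f],
   vanishes there. *)
have onker x q : bad.@[q 0] != 0 -> om p x = 0 -> om q x = 0 -> Tg x x x = 0.
  move=> /badE[o' g' fg'] h h'.
  have e1 := constant_on_kernel oa gp h; have e2 := constant_on_kernel o' g' h'.
  apply/eqP; move: fg'; rewrite -subr_eq0 => fg'; rewrite -(mulrI_eq0 _ (mulfI fg')).
  apply/eqP; transitivity (Tg q q q * (Tf p p p * Tg x x x) - Tg p p p * (Tf q q q * Tg x x x)).
    by ring.
  by rewrite -e1 -e2; ring.
have [q hq] := mpoly_neq0_row k0 bad0.
have V0 : wronskian p != 0.
  apply/eqP => z; move/eqP: gp; apply; apply: (onker p q hq); first by ring.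
  by rewrite -wronskian_eval z meval0.
have [p1 hp1] := mpoly_neq0_row k0 V0.
exists p, p1 => x hx hx1; apply: wronskian_eq0.
(* For general r, the vector om(r, p) x - om(r, x) p lies in the kernels of both [om p] and [om r],
   so [g] vanishes at it. As r varies, this is a cubic relation with constant coefficients between
   [wronskian x] and [wronskian p]. *)
have [c ec] : exists c, wronskian x = c *: wronskian p.
  apply: (@cubic_relation_proportional k k0 m _ _
    (Tg x x x) (- (3 * Tg x x p)) (3 * Tg x p p) (- Tg p p p)) => //; rewrite ?oppr_eq0 //.
  apply: (mulfI bad0); rewrite mulr0; apply: (mpoly_row_eq0 k0) => r.
  have [z|nz] := eqVneq bad.@[r 0] 0; first by rewrite mevalM z mul0r.
  rewrite mevalM meval_cubic_comb !wronskian_eval.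
  move: {nz}(onker (om r p *: x + - om r x *: p) r nz); rewrite Tg_comb => h.
  rewrite -[RHS](mulr0 bad.@[r 0]) -h; first by congr (_ * _); ring.
    by rewrite om_lin hx; ring.
  by rewrite om_lin; ring.
move: hx1; rewrite -wronskian_eval ec mevalZ => /eqP.
by rewrite mulf_eq0 (negPf hp1) orbF => /eqP ->; rewrite scale0r.
Qed.

End Pencil.

(** * Ranks of polars and a direction common to all of them *)

Lemma mxrank_le_of_ker (k : fieldType) m r s (B : 'M[k]_(m, r)) (C : 'M[k]_(m, s)) :
  (forall u : 'rV_m, u *m B = 0 -> u *m C = 0) -> (\rank C <= \rank B)%N.
Proof.
move=> h; have : (kermx B <= kermx C)%MS.
  apply/row_subP => i; apply/sub_kermxP/h/sub_kermxP; exact: row_sub.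
move/mxrankS; rewrite !mxrank_ker; have := rank_leq_row B; have := rank_leq_row C; lia.
Qed.

Lemma rank_le1_line (k : fieldType) m r (S : 'M[k]_(m, r)) : (\rank S <= 1)%N ->
  exists p1 : 'rV_m, forall p : 'rV_m, exists t, (p - t *: p1) *m S = 0.
Proof.
move=> rS; have [->|S0] := eqVneq S 0; first by exists 0 => p; exists 0; rewrite mulmx0.
have [i Si] : exists i, row i S != 0.
  apply: NNPP => hn; move/eqP: S0; apply; apply/row_matrixP => i; rewrite row0.
  by apply/eqP/negPn/negP => h; apply: hn; exists i.
exists (delta_mx 0 i) => p.
have sub : (S <= row i S)%MS.
  rewrite -(mxrank_leqif_sup (row_sub i S)) eqn_leq mxrankS ?row_sub //.
  by rewrite (leq_trans rS) // lt0n mxrank_eq0.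
have [t et] := sub_rVP (submx_trans (submxMl p S) sub).
by exists t; rewrite mulmxBl et -scalemxAl -rowE subrr.
Qed.

Section PolarRank.
Variable k : fieldType.
Hypothesis k0 : [pchar k] =i pred0.
Variables (n m : nat) (F : {mpoly k[n.+2]}) (L : 'M[k]_(m, n.+2)).

Local Notation idk := (idfun : {rmorphism k -> k}).
Local Notation Q := (quartic_form F idk).
Let symQ : sym4 Q := quartic_form_sym4 F idk.

Hypothesis isoL : forall a b c d, Q (a *m L) (b *m L) (c *m L) (d *m L) = 0.
Hypothesis nogood : ~ good_point Q (in_span L).

Implicit Types (p q u w a x : 'rV[k]_m) (y c v : 'rV[k]_n.+2).

Local Notation J := (cubic_of F L).
Local Notation D := (polar_of F L).

(* The left kernel consists of the directions along which [cubic_of y] is constant. *)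
Definition polar_mx y : 'M[k]_(m, m * m) :=
  \matrix_l mxvec (\matrix_(i, j) Q (row i L) (row j L) (row l L) y).

Lemma polar_mxE u y :
  u *m polar_mx y = mxvec (\matrix_(i, j) Q (row i L) (row j L) (u *m L) y).
Proof.
rewrite mulmx_sum_row -[RHS](_ : \sum_l u 0 l *: mxvec
    (\matrix_(i, j) Q (row i L) (row j L) (row l L) y) = _).
  by apply: eq_bigr => l _; rewrite rowK.
under eq_bigr => l _ do rewrite -linearZ /=.
rewrite -linear_sum; congr mxvec; apply/matrixP => i j; rewrite summxE !mxE.
rewrite (form_rot symQ) (form_rot symQ) form_sum1 //; apply: eq_bigr => l _.
by rewrite !mxE (form_rot symQ (row i L)) (form_rot symQ (row j L)).
Qed.

Lemma polar_mx0P u y : u *m polar_mx y = 0 ->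
  forall p q, Q (p *m L) (q *m L) (u *m L) y = 0.
Proof.
rewrite polar_mxE => /eqP; rewrite mxvec_eq0 => /eqP e p q.
rewrite form_sum1 // big1 // => i _; rewrite (sym4_12 symQ) form_sum1 // big1 ?mulr0 // => j _.
by rewrite (sym4_12 symQ); have := congr1 (fun A : 'M_m => A i j) e; rewrite !mxE => ->;
  rewrite mulr0.
Qed.

Lemma polar_of_eq0 u y : D u y = 0 -> u *m polar_mx y = 0.
Proof.
move=> e; have h p : Q (p *m L) (p *m L) (u *m L) y = 0.
  by rewrite -polar_eval e meval0.
have two : (2 : k) != 0 := char0_natf_neq0 k0 (isT : (0 < 2)%N).
rewrite polar_mxE; apply/eqP; rewrite mxvec_eq0; apply/eqP/matrixP => i j; rewrite !mxE !rowE.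
have := h (delta_mx 0 i + 1 *: delta_mx 0 j); rewrite mulmxDl -scalemxAl (form_square symQ) !h.
by rewrite !mulr0 add0r addr0 mulr1 => /eqP; rewrite mulf_eq0 (negPf two) => /eqP.
Qed.

Lemma polar_mx_lin y c t : polar_mx (y + t *: c) = polar_mx y + t *: polar_mx c.
Proof.
apply/row_matrixP => l; rewrite linearD linearZ /= !rowK -linearZ -linearD /=.
by congr mxvec; apply/matrixP => i j; rewrite !mxE (form_comb4 symQ).
Qed.

Lemma polar_mx_pencil y0 c0 : J y0 != 0 -> J c0 != 0 -> coprime_elt (J y0) (J c0) ->
  (\rank (row_mx (polar_mx y0) (polar_mx c0)) <= 2)%N.
Proof.
move=> f0 g0 cop.
have [|||p [p' h]] := @pencil_codim2 k m k0 (J y0) (J c0) (fun u => D u y0) (fun u => D u c0)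
  (fun p q r => Q (p *m L) (q *m L) (r *m L) y0) (fun p q r => Q (p *m L) (q *m L) (r *m L) c0)
  (cubic_homog _ _ _) (cubic_homog _ _ _)
  (fun u => polar_homog _ _ _ _) (fun u => polar_homog _ _ _ _)
  (fun p => cubic_eval F L p y0) (fun p => cubic_eval F L p c0)
  (fun p u => polar_eval F L p u y0) (fun p u => polar_eval F L p u c0)
  _ _ _ f0 g0 cop.
- move=> s t x p /=; rewrite mulmxDl -!scalemxAl.
  rewrite (form_lin1 symQ) !(form_lin2 symQ) !(form_lin3 symQ).
  rewrite (sym4_12 symQ (p *m L) (x *m L)) !(sym4_23 symQ _ (p *m L) (x *m L)).
  by rewrite !(sym4_12 symQ (p *m L) (x *m L)); ring.
- move=> p s x t y; exact: (omega_lin F L y0 c0 p s x t y).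
- move=> p a x; exact: (@constant_on_kernel k k0 n m F L isoL nogood y0 c0 p a x).
(* The two linear forms [omega p] and [omega p'] as columns: their common kernel lies in that of
   both polars. *)
pose B : 'M[k]_(m, 1 + 1) := row_mx (\col_i omega F L y0 c0 p (delta_mx 0 i))
  (\col_i omega F L y0 c0 p' (delta_mx 0 i)).
have omE r u : (u *m \col_i omega F L y0 c0 r (delta_mx 0 i)) 0 0 = omega F L y0 c0 r u.
  rewrite mxE [in RHS](row_sum_delta u).
  elim/big_rec2: _ => [|i a b _ ->].
    by have := omega_lin F L y0 c0 r 0 0 0 0; rewrite !scale0r !mul0r !addr0 => ->.
  have := omega_lin F L y0 c0 r (u 0 i) (delta_mx 0 i) 1 a.
  by rewrite scale1r mul1r mxE => ->.
apply: leq_trans (_ : \rank B <= 2)%N; last exact: rank_leq_col.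
apply: mxrank_le_of_ker => u; rewrite /B !mul_mx_row => /eqP; rewrite row_mx_eq0 =>
  /andP[/eqP h1 /eqP h2].
have [||e1 e2] := h u.
- by rewrite -[LHS]/(omega F L y0 c0 p u) -omE h1 mxE.
- by rewrite -[LHS]/(omega F L y0 c0 p' u) -omE h2 mxE.
by rewrite (polar_of_eq0 e1) (polar_of_eq0 e2) row_mx0.
Qed.

End PolarRank.

Section CommonKernel.
Variable k : fieldType.
Hypothesis k0 : [pchar k] =i pred0.
Variables (n m : nat) (F : {mpoly k[n.+2]}) (L : 'M[k]_(m, n.+2)).

Local Notation idk := (idfun : {rmorphism k -> k}).
Local Notation Q := (quartic_form F idk).
Let symQ : sym4 Q := quartic_form_sym4 F idk.

Hypothesis isoL : forall a b c d, Q (a *m L) (b *m L) (c *m L) (d *m L) = 0.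
Hypothesis nogood : ~ good_point Q (in_span L).

Implicit Types (p q u w a x : 'rV[k]_m) (y c v : 'rV[k]_n.+2).

Local Notation J := (cubic_of F L).
Local Notation A := (polar_mx F L).

Lemma coprime_cubic_neq0 (f : {mpoly k[m]}) c : J c != 0 -> coprime_elt f (J c) -> f != 0.
Proof.
move=> g0 cop; have := coprime_not_proportional 0 g0 (cubic_homog _ _ _) cop (oner_neq0 k).
by rewrite scale0r scale1r eq_sym.
Qed.

Lemma cubic_scale_eval (s : k) p y : (s *: J y).@[p 0] = s * Q (p *m L) (p *m L) (p *m L) y.
Proof. exact: etrans (mevalZ _ _ _) (congr1 (fun r => s * r) (cubic_eval F L p y)). Qed.

Lemma polar_mx0I u y : (forall p q, Q (p *m L) (q *m L) (u *m L) y = 0) -> u *m A y = 0.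
Proof.
move=> h; rewrite polar_mxE; apply/eqP; rewrite mxvec_eq0; apply/eqP/matrixP => i j.
by rewrite !mxE !rowE h.
Qed.

Lemma polar_mx_cube y p p1 t : (p - t *: p1) *m A y = 0 ->
  Q (p *m L) (p *m L) (p *m L) y = t ^+ 3 * Q (p1 *m L) (p1 *m L) (p1 *m L) y.
Proof.
set e := p - t *: p1 => /(polar_mx0P) he.
have -> : p = e + t *: p1 by rewrite /e subrK.
rewrite mulmxDl -scalemxAl (form_cube symQ) he.
rewrite (sym4_23 symQ (e *m L)) he (sym4_12 symQ (e *m L)) (sym4_23 symQ _ (e *m L)) he.
ring.
Qed.

(** If both cubics depended on one linear form only, they would be multiples of the same cube, hence
    proportional, against coprimality. *)
Lemma coprime_not_cubes r (S : 'M[k]_(m, r)) y0 c0 :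
  J y0 != 0 -> J c0 != 0 -> coprime_elt (J y0) (J c0) -> (\rank S <= 1)%N ->
  ~ (forall u, u *m S = 0 -> u *m A y0 = 0 /\ u *m A c0 = 0).
Proof.
move=> f0 g0 cop rS hS; have [p1 h1] := rank_le1_line rS.
have key p : exists t, forall y, y \in [:: y0; c0] ->
    Q (p *m L) (p *m L) (p *m L) y = t ^+ 3 * Q (p1 *m L) (p1 *m L) (p1 *m L) y.
  have [t /hS[e1 e2]] := h1 p; exists t => y.
  by rewrite !inE => /orP[] /eqP->; apply: polar_mx_cube.
have gp1 : Q (p1 *m L) (p1 *m L) (p1 *m L) c0 != 0.
  apply/eqP => z; move/eqP: g0; apply; apply: (mpoly_row_eq0 k0) => p.
  by have [t ht] := key p; rewrite cubic_eval ht ?z ?mulr0 // !inE eqxx orbT.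
have := coprime_not_proportional (Q (p1 *m L) (p1 *m L) (p1 *m L) y0) g0 (cubic_homog _ _ _) cop gp1.
move/eqP; apply; apply: (mpoly_row_ext k0) => p; have [t ht] := key p.
apply: (etrans (cubic_scale_eval _ _ _)); apply: (etrans _ (esym (cubic_scale_eval _ _ _))).
by rewrite !ht ?inE ?eqxx ?orbT //; ring.
Qed.

(* [polar_mx y] has rank at most 1 when [cubic_of y] is a multiple of the cube of a linear
   form; independent cubes of linear forms have a sum that is not such a multiple. *)
Lemma sum_not_cube y0 c0 :
  J y0 != 0 -> J c0 != 0 -> coprime_elt (J y0) (J c0) ->
  (\rank (A y0) <= 1)%N -> (\rank (A c0) <= 1)%N -> (1 < \rank (A (y0 + 1 *: c0)))%N.
Proof.
move=> f0 g0 cop ry rc; rewrite ltnNge; apply/negP => rs.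
set N1 := kermx (A y0); set N2 := kermx (A c0).
have in1 u : (u <= N1)%MS -> u *m A y0 = 0 by move/sub_kermxP.
have in2 u : (u <= N2)%MS -> u *m A c0 = 0 by move/sub_kermxP.
(* If the two kernels span, a vector killed by the sum is killed by each polar, because one term
   vanishes on [N1] and the opposite one on [N2]. Otherwise, both having codimension at most 1, [N1]
   is contained in [N2], and both cubics depend on a single linear form. *)
have [full|nfull] := boolP (row_full (N1 + N2)%MS).
  apply: (coprime_not_cubes f0 g0 cop rs) => u hu.
  have e p q : Q (p *m L) (q *m L) (u *m L) y0 = - Q (p *m L) (q *m L) (u *m L) c0.
    have := polar_mx0P hu p q; rewrite (form_comb4 symQ) mul1r => /eqP.
    by rewrite addr_eq0 => /eqP.
  have z p q : Q (p *m L) (q *m L) (u *m L) y0 = 0.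
    have /sub_addsmxP[[a b] /= ->] : (p <= N1 + N2)%MS by apply: submx_full.
    rewrite mulmxDl (sym4D symQ) [X in _ + X]e.
    have h1 := polar_mx0P (in1 _ (submxMl a N1)) q u.
    have h2 := polar_mx0P (in2 _ (submxMl b N2)) q u.
    rewrite (sym4_12 symQ) (sym4_23 symQ) h1 (sym4_12 symQ (b *m N2 *m L)).
    by rewrite (sym4_23 symQ _ (b *m N2 *m L)) h2 oppr0 addr0.
  split; apply: polar_mx0I => p q //.
  by apply/eqP; rewrite -oppr_eq0 -e z.
have rN : (\rank (N1 + N2)%MS < m)%N by rewrite ltn_neqAle rank_leq_col andbT.
have N12 : (N1 <= N2)%MS.
  apply: submx_trans (addsmxSl N1 N2) _.
  rewrite -(mxrank_leqif_sup (addsmxSr N1 N2)) eqn_leq mxrankS ?addsmxSr //=.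
  by rewrite {2}/N2 mxrank_ker; lia.
apply: (coprime_not_cubes f0 g0 cop ry) => u hu; split=> //; apply: in2.
by apply: submx_trans N12; apply/sub_kermxP.
Qed.

Lemma exists_coprime_cubics : (0 < m)%N ->
  (forall q : {mpoly k[m]}, prime_elt q -> exists y, ~ divides q (J y)) ->
  exists y0 c0, [/\ J y0 != 0, J c0 != 0 & coprime_elt (J y0) (J c0)].
Proof.
move=> m0 nodiv.
have [y0 f0] : exists y, J y != 0.
  have X0 : ('X_(Ordinal m0) : {mpoly k[m]}) != 0 by apply: mpolyX_neq0.
  have [s [sp [u uU e]]] := ufd_mpoly X0.
  case: s sp e => [|q s] sp e.
    have := homog_nonunit (d := 0) (f := 'X_(Ordinal m0) : {mpoly k[m]}).
    rewrite dhomogX /= mdeg1 eqxx e big_nil mulr1 uU => H; by have := H isT.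
  have [y hy] := nodiv q (sp q (mem_head _ _)).
  by exists y; apply/eqP => z; apply: hy; rewrite z; apply: divides0.
have [c0 cop] := exists_coprime_pair k0 (cubic_lin k0 F L) nodiv f0.
exists y0, c0; split=> //; exact: (coprime_cubic_neq0 f0 (coprime_elt_sym cop)).
Qed.

(** Once the polar of [c1] has rank 2, the bound 2 for a coprime pair puts its kernel inside that of
    every cubic coprime to [J c1], and by linearity inside that of every cubic. With m > 2 this
    kernel is nonzero. *)
Lemma exists_common_direction y0 c0 : (2 < m)%N ->
  J y0 != 0 -> J c0 != 0 -> coprime_elt (J y0) (J c0) ->
  exists2 u : 'rV[k]_m, u != 0 & forall p q y, Q (p *m L) (q *m L) (u *m L) y = 0.
Proof.
move=> m2 f0 g0 cop.
have [y1 [c1 [cop1 g1 r1]]] : exists y1 c1, [/\ coprime_elt (J y1) (J c1), J c1 != 0 &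
    (1 < \rank (A c1))%N].
  have [ry|ry] := leqP (\rank (A y0)) 1; last first.
    by exists c0, y0; split=> //; exact: coprime_elt_sym.
  have [rc|rc] := leqP (\rank (A c0)) 1; last by exists y0, c0.
  have cops : coprime_elt (J (y0 + 1 *: c0)) (J c0).
    rewrite (cubic_lin k0) scale1r => q qp qs qc; apply: (cop q qp) => //.
    by have := dividesB qs qc; rewrite addrK.
  exists c0, (y0 + 1 *: c0); split; last exact: sum_not_cube.
    exact: coprime_elt_sym.
  exact: coprime_cubic_neq0 g0 cops.
have pen y : coprime_elt (J y) (J c1) -> (kermx (A c1) <= kermx (A y))%MS.
  move=> cop2; have rk := polar_mx_pencil k0 isoL nogood (coprime_cubic_neq0 g1 cop2) g1 cop2.
  have sub : (kermx (row_mx (A y) (A c1)) <= kermx (A c1))%MS.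
    apply/row_subP => i; apply/sub_kermxP.
    have /sub_kermxP := row_sub i (kermx (row_mx (A y) (A c1))).
    by rewrite mul_mx_row => /eqP; rewrite row_mx_eq0 => /andP[_ /eqP].
  have sup : (kermx (A c1) <= kermx (row_mx (A y) (A c1)))%MS.
    rewrite -(mxrank_leqif_sup sub) eqn_leq mxrankS //= !mxrank_ker.
    by have := rank_leq_row (A c1); lia.
  apply/row_subP => i; apply/sub_kermxP.
  have /sub_kermxP := submx_trans (row_sub i _) sup.
  by rewrite mul_mx_row => /eqP; rewrite row_mx_eq0 => /andP[/eqP].
have kerA y : (kermx (A c1) <= kermx (A y))%MS.
  (* An arbitrary [y] is reached as the difference of [y1 + t *: y] and [y1], both giving cubics
     coprime to that of [c1] for a suitable nonzero [t]. *)
  have [bad hb] := coprime_pencil (J y) g1 cop1.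
  have [t] := exists_notin k0 (0 :: bad); rewrite inE negb_or => /andP[t0 tb].
  have := hb t tb; rewrite -cubic_lin // => /pen; rewrite polar_mx_lin => h.
  have h1 := pen _ cop1; apply/sub_kermxP; move/sub_kermxP: h; move/sub_kermxP: h1 => h1.
  rewrite mulmxDr h1 add0r -scalemxAr => /eqP.
  by rewrite scalemx_eq0 (negPf t0) => /eqP.
have rA : (\rank (A c1) <= 2)%N.
  have rk := polar_mx_pencil k0 isoL nogood (coprime_cubic_neq0 g1 cop1) g1 cop1.
  apply: leq_trans rk; apply: mxrank_le_of_ker => u.
  by rewrite mul_mx_row => /eqP; rewrite row_mx_eq0 => /andP[_ /eqP].
have : kermx (A c1) != 0 by rewrite -mxrank_eq0 mxrank_ker; lia.
move=> ker0; have [i hi] : exists i, row i (kermx (A c1)) != 0.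
  apply: NNPP => hn; move/eqP: ker0; apply; apply/row_matrixP => i; rewrite row0.
  by apply/eqP/negPn/negP => h; apply: hn; exists i.
exists (row i (kermx (A c1))) => // p q y; apply: polar_mx0P.
by apply/sub_kermxP; apply: submx_trans (row_sub _ _) (kerA y).
Qed.

End CommonKernel.

(** * From the equations of Lambda and X to the quadrilinear form; null directions and cones *)

Lemma form_polarization (k : fieldType) (V : lmodType k) (M : V -> V -> V -> V -> k)
    (Lam : V -> Prop) : [pchar k] =i pred0 -> sym4 M ->
  (forall a b t, Lam a -> Lam b -> Lam (a + t *: b)) ->
  (forall a, Lam a -> M a a a a = 0) ->
  forall a b c d, Lam a -> Lam b -> Lam c -> Lam d -> M a b c d = 0.
Proof.
move=> k0 symM LamC diag.
have cancel j (x : k) : (0 < j)%N -> j%:R * x = 0 -> x = 0.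
  move=> j0 /eqP; rewrite mulf_eq0 (negPf (char0_natf_neq0 k0 j0)) => /eqP //.
have h31 a b : Lam a -> Lam b -> M a a a b = 0.
  move=> la lb.
  have E t : 4 * t * M a a a b + 6 * t ^+ 2 * M a a b b + 4 * t ^+ 3 * M a b b b = 0.
    have := diag _ (LamC a b t la lb).
    by rewrite (form_quart symM) !diag // add0r mulr0 addr0.
  apply: (cancel 24%N) => //.
  (* The combination 6 E(1) - 2 E(-1) - E(2) cancels the terms in t^2 and t^3 and leaves 24 times
     the value. *)
  transitivity (6 * (4 * 1 * M a a a b + 6 * 1 ^+ 2 * M a a b b + 4 * 1 ^+ 3 * M a b b b)
    - 2 * (4 * -1 * M a a a b + 6 * (-1) ^+ 2 * M a a b b + 4 * (-1) ^+ 3 * M a b b b)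
    - (4 * 2 * M a a a b + 6 * 2 ^+ 2 * M a a b b + 4 * 2 ^+ 3 * M a b b b)); first by ring.
  by rewrite !E; ring.
have h22 a b c : Lam a -> Lam b -> Lam c -> M a a b c = 0.
  move=> la lb lc.
  have E t : 3 * t * M a a b c + 3 * t ^+ 2 * M a b b c = 0.
    have := h31 _ _ (LamC a b t la lb) lc.
    by rewrite (form_cube symM) !h31 // mulr0 add0r addr0.
  apply: (cancel 6%N) => //.
  transitivity ((3 * 1 * M a a b c + 3 * 1 ^+ 2 * M a b b c)
    - (3 * -1 * M a a b c + 3 * (-1) ^+ 2 * M a b b c)); first by ring.
  by rewrite !E subrr.
move=> a b c d la lb lc ld; apply: (cancel 2%N) => //.
have := h22 _ _ _ (LamC a b 1 la lb) lc ld.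
by rewrite (form_square symM) !h22 // mulr0 add0r addr0 mulr1.
Qed.

Lemma exists_unitmx_last_row (k : fieldType) n (U : 'rV[k]_n.+1) : U != 0 ->
  exists2 A : 'M[k]_n.+1, A \in unitmx & row ord_max A = U.
Proof.
move=> U0; have [i0 hi0] : exists i, U 0 i != 0.
  apply: NNPP => hn; move/eqP: U0; apply; apply/rowP => i; rewrite mxE.
  by apply/eqP/negPn/negP => h; apply: hn; exists i.
(* The remaining rows are the basis vectors other than the one at [i0], a position where [U] is
   nonzero; the transposition relabels them. *)
pose s (i : 'I_n.+1) := tperm i0 ord_max i.
exists (\matrix_i (if i == ord_max then U else delta_mx 0 (s i))); last first.
  by rewrite rowK eqxx.
rewrite unitmxE unitfE; apply/det0P => -[v v0 hv]; move/eqP: v0; apply.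
have E j : \sum_i v 0 i * (if i == ord_max then U else delta_mx 0 (s i)) 0 j = 0.
  have := congr1 (fun w : 'rV_n.+1 => w 0 j) hv; rewrite !mxE => h; rewrite -[RHS]h.
  by apply: eq_bigr => i _; rewrite mxE.
have vm : v 0 ord_max = 0.
  have := E i0; rewrite (bigD1 ord_max) //= eqxx big1 ?addr0.
    by move/eqP; rewrite mulf_eq0 (negPf hi0) orbF => /eqP.
  move=> i im; rewrite (negPf im) mxE /s /=.
  case: eqP => [e|_]; last by rewrite mulr0.
  have : tperm i0 ord_max i = tperm i0 ord_max ord_max by rewrite -e tpermR.
  by move/perm_inj/eqP; rewrite (negPf im).
apply/rowP => l; rewrite mxE; have [->//|lm] := eqVneq l ord_max.
have := E (s l); rewrite (bigD1 l) //= (negPf lm) mxE !eqxx mulr1 big1 ?addr0 // => i il.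
have [->|im] := eqVneq i ord_max; first by rewrite vm mul0r.
rewrite mxE eqxx /=; case: eqP => [/perm_inj e|_]; last by rewrite mulr0.
by rewrite e eqxx in il.
Qed.

Section LinearSubspace.
Variables (k : fieldType) (n m : nat) (F : {mpoly k[n.+2]}).
Hypothesis k0 : [pchar k] =i pred0.
Hypothesis Fh : F \is 4.-homog.

Local Notation idk := (idfun : {rmorphism k -> k}).
Local Notation Q := (quartic_form F idk).
Let symQ : sym4 Q := quartic_form_sym4 F idk.

Lemma lin_subst_eval p (B : 'M[k]_(p, n.+2)) (v : 'rV[k]_p) (H : {mpoly k[n.+2]}) :
  (H \mPo lin_subst B).@[v 0] = mmap idk ((v *m B) 0) H.
Proof.
rewrite comp_mpoly_meval; apply: meval_eq => j.
rewrite tnth_map tnth_ord_tuple rmorph_sum mxE; apply: eq_bigr => i _ /=.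
by rewrite mevalZ mevalXU mulrC.
Qed.

Lemma isotropic_of_contained (L : 'M[k]_(m, n.+2)) : F \mPo lin_subst L = 0 ->
  forall a b c d, Q (a *m L) (b *m L) (c *m L) (d *m L) = 0.
Proof.
move=> FL a b c d; apply: (form_polarization (Lam := in_span L) k0 symQ);
  try exact: in_span_mul.
- by move=> _ _ t [u1 ->] [u2 ->]; exists (u1 + t *: u2); rewrite mulmxDl scalemxAl.
- by move=> _ [u ->]; rewrite -(quartic_form_mmap k0 Fh) -lin_subst_eval FL meval0.
Qed.

Lemma mderiv_lin_subst (L : 'M[k]_(m, n.+2)) i :
  F^`M(i) \mPo lin_subst L = 4%:R *: cubic_of F L (delta_mx 0 i).
Proof.
apply: (mpoly_row_ext k0) => p; rewrite mevalZ cubic_eval lin_subst_eval.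
exact: mderiv_form_mmap.
Qed.

(** In coordinates with [U] as last basis vector, the derivative of [F] in the last variable is 4 M
    x x x U = 0, so in characteristic zero this variable does not occur. *)
Lemma cone_of_null_direction (U : 'rV[k]_n.+2) : U != 0 -> (forall x, Q U x x x = 0) -> is_cone F.
Proof.
move=> /exists_unitmx_last_row[B BU rB] hU; exists B; split=> // mo hmo.
apply/eqP/negPn/negP => h; move: hmo; rewrite mcoeff_msupp => /eqP; apply.
apply: (mderiv_coeff_eq0 k0 _ h); apply: (mpoly_row_eq0 k0) => v.
have eB : lin_subst B = [tuple tnth (lin_subst B) j | j < n.+2].
  by apply: eq_from_tnth => j; rewrite [RHS]tnth_map tnth_ord_tuple.
rewrite {1}eB mderiv_comp rmorph_sum /=.
transitivity (4 * Q (v *m B) (v *m B) (v *m B) U); last by rewrite -(form_rot symQ) hU mulr0.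
rewrite (form_last_linear F _ _ _ U) mxE mulr_sumr; apply: eq_bigr => j _.
rewrite mevalM [in RHS]mxE.
have -> : (F^`M(j) \mPo [tuple tnth (lin_subst B) i | i < n.+2]).@[v 0] =
    4 * Q (v *m B) (v *m B) (v *m B) (delta_mx 0 j).
  by rewrite -eB -(mderiv_form_mmap k0 Fh) -lin_subst_eval.
have -> : (tnth (lin_subst B) j)^`M(ord_max) = (B ord_max j)%:MP.
  rewrite tnth_map tnth_ord_tuple raddf_sum (bigD1 ord_max) //=.
  rewrite mderivZ mderivXU eqxx alg_mpolyC big1 ?addr0 //.
  by move=> i /negPf im; rewrite mderivZ mderivXU im scaler0.
by rewrite mevalC -rB !mxE; ring.
Qed.

End LinearSubspace.

(** * Linearity of the quartic in the common direction *)

Lemma coprime_quadratic_eq0 (k : fieldType) m (f g B11 B12 B22 : {mpoly k[m]}) d e :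
  f != 0 -> g != 0 -> coprime_elt f g -> g \is d.-homog -> B22 \is e.-homog -> (e < d)%N ->
  g ^+ 2 * B11 - 2 * g * f * B12 + f ^+ 2 * B22 = 0 -> B22 = 0.
Proof.
move=> f0 g0 cop hg hB ed E; have ufd := @ufd_mpoly k m.
have cop' : coprime_elt g f by exact: coprime_elt_sym.
apply: (homog_divides_eq0 g0 hg hB ed); apply: (coprime_Gauss ufd g0 cop').
apply: (coprime_Gauss ufd g0 cop'); exists (2 * f * B12 - g * B11).
transitivity (f * (f * B22) - (g ^+ 2 * B11 - 2 * g * f * B12 + f ^+ 2 * B22)).
  by rewrite E subr0.
ring.
Qed.

Lemma meval_quadratic_comb (R : comNzRingType) n (v : 'I_n -> R) (f g b11 b12 b22 : {mpoly R[n]}) :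
  (g ^+ 2 * b11 - 2 * g * f * b12 + f ^+ 2 * b22).@[v] =
  g.@[v] ^+ 2 * b11.@[v] - 2 * g.@[v] * f.@[v] * b12.@[v] + f.@[v] ^+ 2 * b22.@[v].
Proof.
have e2 : (2 : {mpoly R[n]}) = 2%:MP by rewrite mpolyC_nat.
by rewrite e2 mevalD mevalB !mevalM mevalC; ring.
Qed.

Section CommonDirection.
Variable k : fieldType.
Hypothesis k0 : [pchar k] =i pred0.
Variables (n m : nat) (F : {mpoly k[n.+2]}) (L : 'M[k]_(m, n.+2)).

Local Notation idk := (idfun : {rmorphism k -> k}).
Local Notation Q := (quartic_form F idk).
Local Notation QM := (quartic_form F (@mpolyC m k : {rmorphism k -> {mpoly k[m]}})).
Let symQ : sym4 Q := quartic_form_sym4 F idk.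

Hypothesis isoL : forall a b c d, Q (a *m L) (b *m L) (c *m L) (d *m L) = 0.
Hypothesis nogood : ~ good_point Q (in_span L).

Implicit Types (p q w a x : 'rV[k]_m) (y c v : 'rV[k]_n.+2).

Local Notation J := (cubic_of F L).
Variable u : 'rV[k]_m.
Hypothesis uker : forall p q y, Q (p *m L) (q *m L) (u *m L) y = 0.

Definition second_polar y c := locked (fun y c =>
  QM (generic_pt L) (map_mx (@mpolyC m k) (u *m L)) (map_mx (@mpolyC m k) y) (map_mx (@mpolyC m k) c)) y c.

Lemma second_polar_eval p y c : (second_polar y c).@[p 0] = Q (p *m L) (u *m L) y c.
Proof. by rewrite /second_polar -lock form_eval generic_pt_eval !mcst_eval. Qed.

Lemma second_polar_homog y c : second_polar y c \is 1.-homog.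
Proof.
have hg : row_homog 1 (generic_pt L) by apply: row_homog_var.
rewrite /second_polar -lock.
exact: (form_homog _ hg (row_homog_const _ _) (row_homog_const _ _) (row_homog_const _ _)).
Qed.

(** Where the differential of the quotient is nonzero, puvv must vanish, since otherwise
    [good_point_of_direction] applies with U = u. Expanding in v = g y - f c gives a quadratic
    identity in the cubics, to which [coprime_quadratic_eq0] applies. *)
Lemma second_polar_coprime y c : J y != 0 -> J c != 0 -> coprime_elt (J y) (J c) ->
  second_polar c c = 0.
Proof.
move=> f0 g0 cop.
have [a Wa] : exists a, J c * polar_of F L a y - J y * polar_of F L a c != 0.
  apply: NNPP => hn; have /eqP := f0; apply; apply: (mpoly_row_eq0 k0) => p.
  have z : J c * polar_of F L p y - J y * polar_of F L p c = 0.
    by apply/eqP/negPn/negP => h; apply: hn; exists p.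
  have [e _] := wronskian_eq0 (Df := fun u => polar_of F L u y) (Dg := fun u => polar_of F L u c)
    (cubic_homog _ _ _) (cubic_homog _ _ _) (fun u => polar_homog _ _ _ _)
    (fun u => polar_homog _ _ _ _) f0 g0 cop z.
  by rewrite cubic_eval -polar_eval e meval0.
apply: (@coprime_quadratic_eq0 k m (J y) (J c) (second_polar y y) (second_polar y c) _ 3 1) => //.
- exact: cubic_homog.
- exact: second_polar_homog.
move: (J c * polar_of F L a y - J y * polar_of F L a c) (Wa)
  (fun p => meval_det (p 0) (J c) (polar_of F L a y) (J y) (polar_of F L a c)) => W W0 hW.
(* Multiplying by the nonzero polynomial [W] restricts the check to points where a direction with
   nonzero differential is at hand. *)
set B := _ + _; apply: (mulfI W0); rewrite mulr0; apply: (mpoly_row_eq0 k0) => p.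
apply/eqP; rewrite mevalM mulf_eq0; apply/negPn/negP; rewrite negb_or => /andP[].
pose g := Q (p *m L) (p *m L) (p *m L) c; pose f := Q (p *m L) (p *m L) (p *m L) y.
have -> : B.@[p 0] = g ^+ 2 * Q (p *m L) (u *m L) y y
    - 2 * g * f * Q (p *m L) (u *m L) y c + f ^+ 2 * Q (p *m L) (u *m L) c c.
  by rewrite /B meval_quadratic_comb !cubic_eval !second_polar_eval.
rewrite hW !cubic_eval !polar_eval -/f -/g => hw hB.
pose v := g *: y + - f *: c.
have vE a1 b1 : Q (p *m L) (a1 *m L) (b1 *m L) v =
    g * Q (p *m L) (a1 *m L) (b1 *m L) y - f * Q (p *m L) (a1 *m L) (b1 *m L) c.
  by rewrite /v (form_lin4 symQ) mulNr.
have [c1 hc1] : exists c1, Q (p *m L) (p *m L) (p *m L) c1 != 0.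
  have [e|] := eqVneq g 0; last by exists c.
  have [e'|] := eqVneq f 0; last by exists y.
  by move: hw; rewrite e e' !mul0r subrr eqxx.
apply: nogood; apply: (@good_point_of_direction k _ Q symQ k0 (in_span L) _
  (p *m L) (u *m L) (a *m L) v c1).
- by move=> _ _ _ _ [a1 ->] [a2 ->] [a3 ->] [a4 ->]; apply: isoL.
- exact: in_span_mul.
- exact: in_span_mul.
- exact: in_span_mul.
- exact: hc1.
- by rewrite vE mulrC subrr.
- by rewrite vE.
- exact: uker.
- exact: uker.
- by rewrite (sym4_12 symQ) uker.
- by rewrite /v (form_lin_square34 symQ); apply: contraNneq hB => <-; apply/eqP; ring.
Qed.

(** For almost all [t], c0 + t c is again coprime to [y0]. The value puzz at z = c0 + t c is a
    quadratic in [t] without constant term, so two such nonzero values of [t] suffice to kill its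
    leading coefficient. *)
Lemma second_polar_eq0 y0 c0 : J y0 != 0 -> J c0 != 0 -> coprime_elt (J y0) (J c0) ->
  forall p c, Q (p *m L) (u *m L) c c = 0.
Proof.
move=> f0 g0 cop p c.
have two : (2 : k) != 0 := char0_natf_neq0 k0 (isT : (0 < 2)%N).
have [bad hb] := coprime_pencil (J c) f0 (coprime_elt_sym cop).
have E t : t \notin bad -> Q (p *m L) (u *m L) (c0 + t *: c) (c0 + t *: c) = 0.
  move=> /hb; rewrite -(cubic_lin k0) => cop'.
  have g0' := coprime_cubic_neq0 f0 cop'.
  by rewrite -second_polar_eval (second_polar_coprime f0 g0' (coprime_elt_sym cop')) meval0.
have E0 : Q (p *m L) (u *m L) c0 c0 = 0.
  by rewrite -second_polar_eval (second_polar_coprime f0 g0 cop) meval0.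
have E' t : t \notin 0 :: bad ->
    2 * Q (p *m L) (u *m L) c0 c + t * Q (p *m L) (u *m L) c c = 0.
  rewrite inE negb_or => /andP[t0 /E].
  rewrite -[c0]scale1r (form_lin_square34 symQ) scale1r E0 => e.
  by apply: (mulfI t0); rewrite mulr0 -e; ring.
have [t1 h1] := exists_notin k0 (0 :: bad).
have [t2 h2] := exists_notin k0 (t1 :: 0 :: bad).
move: h2; rewrite inE negb_or => /andP[t12 h2].
have /eqP := etrans (E' t2 h2) (esym (E' t1 h1)).
rewrite -subr_eq0 opprD addrACA subrr add0r -mulrBl mulf_eq0 subr_eq0 (negPf t12).
by rewrite orFb => /eqP.
Qed.

End CommonDirection.

Theorem theorem3p20 (k : fieldType) (n h : nat) (F : {mpoly k[n.+2]})
    (L : 'M[k]_(h.+1, n.+2)) :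
  [pchar k] =i pred0 ->
  (3 <= n)%N -> (2 <= h)%N ->
  F \is 4.-homog -> F != 0 ->
  mpoly_irreducible F ->
  (* Lambda = rowspace of L, an h-dimensional linear subspace, contained in X_4 *)
  \rank L = h.+1 ->
  F \mPo lin_subst L = 0 ->
  (* dim (Lambda cap Sing X_4) <= h - 2 *)
  proj_dim_le [seq (F^`M(i)) \mPo lin_subst L | i <- enum 'I_(n.+2)] (h - 2) ->
  ~ is_cone F ->
  unirational_hypersurface F.
Proof.
move=> k0 _ h2 Fh _ /mpoly_irreducible_prime Fp rL FL dimS ncone.
have isoL := isotropic_of_contained k0 Fh FL.
have symQ := quartic_form_sym4 F (idfun : {rmorphism k -> k}).
have [good|nogood] := classic (good_point (quartic_form F idfun) (in_span L)).
  exact: (unirational_of_good_point k0 Fh Fp isoL good).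
(* The cubics are, up to the factor 4, the partial derivatives of [F] restricted to Lambda; a common
   factor would make the singular locus contain a hypersurface of Lambda. *)
have nodiv (q : {mpoly k[h.+1]}) : prime_elt q -> exists y, ~ divides q (cubic_of F L y).
  move=> qp; apply: NNPP => hn.
  have dv y : divides q (cubic_of F L y) by apply: NNPP => hy; apply: hn; exists y.
  have [q0 qU _] := qp.
  have sub (r : {mpoly k[h.+1]}) : (forall y, divides r (cubic_of F L y)) ->
      forall g, g \in [seq (F^`M(i)) \mPo lin_subst L | i <- enum 'I_(n.+2)] -> divides r g.
    move=> hr _ /mapP[i _ ->]; rewrite (mderiv_lin_subst k0 Fh) -mul_mpolyC.
    exact: divides_mull.
  have [[y hy]|hz] := classic (exists y, cubic_of F L y != 0).
    apply: (proj_dim_le_no_divisor h2 dimS q0 _ (sub q dv)).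
    exact: (homog_divisor_eval0 hy (cubic_homog _ _ _) qU (dv y)).
  (* If all cubics vanish, all of Lambda is singular and any variable serves as a common divisor. *)
  apply: (proj_dim_le_no_divisor h2 dimS (mpolyX_neq0 k ord0)); first by rewrite mevalXU.
  apply: sub => y; have -> : cubic_of F L y = 0; last exact: divides0.
  by apply/eqP/negPn/negP => hy; apply: hz; exists y.
have [y0 [c0 [f0 g0 cop]]] := exists_coprime_cubics k0 (ltn0Sn h) nodiv.
have [u u0 uker] := exists_common_direction k0 isoL nogood (h2 : (2 < h.+1)%N) f0 g0 cop.
have Lfree : row_free L by rewrite /row_free rL.
have U0 : u *m L != 0 by rewrite (mulmx_free_eq0 _ Lfree).
have polar0 := second_polar_eq0 k0 isoL nogood uker f0 g0 cop.
apply: (unirational_of_linear_direction k0 Fh Fp (U := u *m L)).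
  (* [polar0] at p = u gives uuzz = 0 for all z; polarizing in z gives uuxy = 0. *)
  move=> x y; have two : (2 : k) != 0 := char0_natf_neq0 k0 (isT : (0 < 2)%N).
  have := polar0 u (1 *: x + 1 *: y).
  rewrite (form_lin_square34 symQ) !polar0 => /eqP.
  rewrite !mulr0 add0r addr0 !mulr1 mulf_eq0 (negPf two) => /eqP //.
(* If uxxx vanished for all x, X would be a cone with vertex [u *m L]. *)
apply: NNPP => hn; apply: ncone; apply: (cone_of_null_direction k0 Fh U0) => x.
by apply/eqP/negPn/negP => hx; apply: hn; exists x.
Qed.
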